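(* For every formed space $E$ and every $U\in\mathcal{P}^\omega(E)$, the poset $\mathcal{P}^\omega(E,U)$ is Cohen–Macaulay.
   Context: Formed spaces over a field $\mathbb{F}$ with involution $\sigma$ ($\bar c=\sigma(c)$), $\varepsilon$ ($\varepsilon\bar\varepsilon=1$) and additive subgroup $\Lambda$ with $\{c-\varepsilon\bar c\}\le\Lambda\le\{c:c+\varepsilon\bar c=0\}$: a form on a finite-dimensional $E$ is a sesquilinear $f$ ($f(av,bw)=\bar af(v,w)b$) modulo those with $f(v,v)\in\Lambda$, $f(w,v)=-\varepsilon\overline{f(v,w)}$. $\omega_q(v,w)=q(v,w)+\varepsilon\overline{q(w,v)}$, $Q_q(v)=q(v,v)+\Lambda$; $K(E)=\{v:\omega_q(E,v)=0\}$, radical $R(E)=\{v\in K(E):Q_q(v)=0\}$; $U^\perp=\{v:\omega_q(v,U)=0\}$; isotropic means $\omega_q,Q_q$ vanish on the subspace. $\mathcal{P}^\omega(E)$ is the poset (inclusion) of isotropic $W$ with $R(E)<W<E$, and $\mathcal{P}^\omega(E,U)=\{W\in\mathcal{P}^\omega(E):W+U^\perp=E\}$. A graded poset is Cohen–Macaulay if for all $-\infty\le x\le y\le\infty$ the interval $(x,y)=\{z:x<z<y\}$ has $(\dim(x,y)-1)$-connected realization, $\dim$ being maximal chain length. *)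

(* Defs.v *)
From HB Require Import structures.
From mathcomp Require Import all_boot all_order all_algebra.
From mathcomp Require Import all_classical all_reals all_analysis.
From mathcomp Require Import Rstruct Rstruct_topology.

Set Implicit Arguments.
Unset Strict Implicit.
Unset Printing Implicit Defensive.

Import Order.TTheory GRing.Theory Num.Theory.
Local Open Scope ring_scope.
Local Open Scope classical_set_scope.

(* A poset is given by a carrier T, an order relation le on T, and a   *)
(* subset S of T (the elements of the poset).                          *)

Notation RR := Rdefinitions.R.

Section Posets.
Variables (T : eqType) (le : rel T).

Definition plt (a b : T) : bool := le a b && (a != b).

(* a chain of the poset S : a strictly increasing finite sequence in S;
   its length (as a chain) is size c - 1. *)
Definition is_chain (S : set T) (c : seq T) : Prop :=
  sorted plt c /\ (forall t, t \in c -> S t).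

Definition is_maxchain (S : set T) (c : seq T) : Prop :=
  is_chain S c /\
  (forall c', is_chain S c' -> {subset c <= c'} -> {subset c' <= c}).

(* dim S = d : maximal length of a chain (d = -1 for the empty poset) *)
Definition has_dim (S : set T) (d : int) : Prop :=
  (exists c, is_chain S c /\ (size c)%:Z = d + 1) /\
  (forall c, is_chain S c -> (size c)%:Z <= d + 1).

Definition graded (S : set T) : Prop :=
  exists d, has_dim S d /\ forall c, is_maxchain S c -> (size c)%:Z = d + 1.

(* Geometric realization of the order complex of S: points are
   functions alpha : T -> R, nonnegative, supported on a chain of S,
   with coordinates summing to 1. *)
Definition realization (S : set T) : set (T -> RR) :=
  [set alpha | exists c, [/\ is_chain S c,
     forall t, t \notin c -> alpha t = 0,
     forall t, 0 <= alpha t & \sum_(t <- c) alpha t = 1]].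

Definition std_simplex (n : nat) : set 'rV[RR]_n :=
  [set l | (forall i, 0 <= l ord0 i) /\ \sum_(i < n) l ord0 i = 1].
Arguments std_simplex n : clear implicits.

(* the characteristic (barycentric) map of the simplex spanned by c *)
Definition bary (c : seq T) (l : 'rV[RR]_(size c)) : T -> RR :=
  fun t => \sum_(i < size c | nth t c i == t) l ord0 i.
Arguments bary c l : clear implicits.

(* coherent (weak) topology on the realization: O is open iff its trace
   on every closed simplex is open in that simplex *)
Definition coh_open (S : set T) (O : set (T -> RR)) : Prop :=
  forall c, is_chain S c ->
    exists V : set 'rV[RR]_(size c), open V /\
      std_simplex (size c) `&` (bary c @^-1` O) = std_simplex (size c) `&` V.

Definition cont_into (S : set T) (m : nat) (A : set 'rV[RR]_m)
  (f : 'rV[RR]_m -> T -> RR) : Prop :=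
  (forall x, A x -> realization S (f x)) /\
  (forall O, coh_open S O ->
     exists V : set 'rV[RR]_m, open V /\ A `&` (f @^-1` O) = A `&` V).

Definition sphere (n : nat) : set 'rV[RR]_n.+1 :=
  [set x | \sum_(i < n.+1) x ord0 i ^+ 2 = 1].
Definition ball_closed (n : nat) : set 'rV[RR]_n.+1 :=
  [set x | \sum_(i < n.+1) x ord0 i ^+ 2 <= 1].
Arguments sphere n : clear implicits.
Arguments ball_closed n : clear implicits.

(* |S| is k-connected (k : int, k >= -1 meaningful): nonempty if
   k >= -1, and every continuous map S^n -> |S| with n <= k extends
   to a continuous map D^(n+1) -> |S|.  For k <= -2 no condition. *)
Definition k_connected (S : set T) (k : int) : Prop :=
  (-1 <= k -> exists alpha, realization S alpha) /\
  (forall n : nat, (n%:Z <= k) ->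
     forall f, cont_into S (sphere n) f ->
       exists g, cont_into S (ball_closed n) g /\
                 (forall x, sphere n x -> g x = f x)).

Inductive ext := Bot | Mid of T | Top.

Definition ext_le (x y : ext) : Prop :=
  match x, y with
  | Bot, _ => True
  | _, Top => True
  | Mid a, Mid b => le a b
  | _, _ => False
  end.

Definition ext_lt (x y : ext) : Prop := ext_le x y /\ x <> y.

Definition in_ext (S : set T) (x : ext) : Prop :=
  match x with Mid a => S a | _ => True end.

Definition open_interval (S : set T) (x y : ext) : set T :=
  [set z | S z /\ ext_lt x (Mid z) /\ ext_lt (Mid z) y].

Definition cohen_macaulay (S : set T) : Prop :=
  graded S /\
  forall x y : ext, in_ext S x -> in_ext S y -> ext_le x y ->
    exists d, has_dim (open_interval S x y) d /\
              k_connected (open_interval S x y) (d - 1).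

End Posets.

Section Formed.
Variables (F : fieldType) (E : vectType F).
Variables (sigma : {rmorphism F -> F}) (eps : F) (Lambda : pred F).

Definition form_parameters : Prop :=
  [/\ involutive sigma, eps * sigma eps = 1,
      (forall a b, a \in Lambda -> b \in Lambda -> a - b \in Lambda),
      (forall c, c - eps * sigma c \in Lambda) &
      (forall c, c \in Lambda -> c + eps * sigma c = 0)].

Definition sesquilinear (q : E -> E -> F) : Prop :=
  [/\ forall v v' w, q (v + v') w = q v w + q v' w,
      forall v w w', q v (w + w') = q v w + q v w' &
      forall a b v w, q (a *: v) (b *: w) = sigma a * q v w * b].

Variable q : E -> E -> F.

Definition omega (v w : E) : F := q v w + eps * sigma (q w v).

(* Q_q(v) = 0 in F / Lambda *)
Definition Qzero (v : E) : Prop := q v v \in Lambda.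

Definition Kset (v : E) : Prop := forall u, omega u v = 0.
Definition Rad (v : E) : Prop := Kset v /\ Qzero v.

Definition perp (U : {vspace E}) (v : E) : Prop :=
  forall u, u \in U -> omega v u = 0.

Definition isotropic (W : {vspace E}) : Prop :=
  (forall v w, v \in W -> w \in W -> omega v w = 0) /\
  (forall v, v \in W -> Qzero v).

Definition Pomega (W : {vspace E}) : Prop :=
  [/\ isotropic W,
      (forall v, Rad v -> v \in W),
      (exists2 w, w \in W & ~ Rad w) &
      W <> fullv].

Definition PomegaU (U : {vspace E}) (W : {vspace E}) : Prop :=
  Pomega W /\
  forall e : E, exists w x, [/\ w \in W, perp U x & e = w + x].

End Formed.

Definition vsub_le (F : fieldType) (E : vectType F) : rel {vspace E} :=
  fun A B => (A <= B)%VS.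

(* Main.v *)
Require Import Defs.
From HB Require Import structures.
From mathcomp Require Import all_boot all_order all_algebra.
From mathcomp Require Import all_classical all_reals all_analysis.
From mathcomp Require Import Rstruct Rstruct_topology zify ring lra.

Set Implicit Arguments.
Unset Strict Implicit.
Unset Printing Implicit Defensive.

Import Order.TTheory GRing.Theory Num.Theory numFieldNormedType.Exports.
Local Open Scope ring_scope.
Local Open Scope classical_set_scope.

(** Attaching to a complex cones over [(k - 1)]-connected subcomplexes preserves
    [k]-connectivity: a map of a sphere of dimension at most [k] is pushed off the cone
    points cell by cell, on a fine cubical grid. All intervals of the poset are built in
    this way from contractible pieces.

    Modulo the radical, an isotropic [W] belongs to the poset iff no nonzero vector of [U] is
    orthogonal to [W]. Induct on [dim U]: choose an isotropic [w] not orthogonal to [U]. The [W]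
    containing [w] form the poset of [U :&: w^perp] in [w^perp / w]. The [W] such that
    [W :&: w^perp] is still in the poset deform to them. For any other [W] there is a unique
    [y] orthogonal to [W] and congruent to [w] modulo [U]. These [W] are attached in two rounds:
    first, by increasing dimension, those which do not contain [y], along the join of the [W']
    below [W] (supplements of [W :&: U^perp] in [W]) with the [W'] above [W] which are not
    orthogonal to [y], an instance of the same problem for a single, possibly anisotropic,
    vector; then, by decreasing dimension, those which contain [y], along the join of the
    supplements avoiding [y] with all isotropic subspaces above [W]. *)

(** * Maps from cubes to flag complexes *)

Section Continuity.
Variable R : realType.

Lemma continuous_ptws (M I : topologicalType) (u : M -> {ptws I -> R}) :
  (forall i, continuous (fun x => u x i)) -> continuous u.
Proof. by move=> cu x; apply/pointwise_cvgP => i; exact: cu. Qed.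

Lemma coord_ptws_continuous (I : eqType) (i : I) :
  continuous (fun x : {ptws I -> R} => x i).
Proof. exact: proj_continuous. Qed.

Lemma within_continuous_subst (M N V : topologicalType) (X : set M) (Y : set N)
    (u : N -> M) (phi : M -> V) :
  (forall y, Y y -> X (u y)) -> {within Y, continuous u} ->
  {within X, continuous phi} -> {within Y, continuous (phi \o u)}.
Proof.
move=> uX /subspace_continuousP cu /subspace_continuousP cphi.
apply/subspace_continuousP => y Yy.
have cu_in : u @ within Y (nbhs y) --> within X (nbhs (u y)).
  move=> A /cu -/(_ Yy); rewrite /= !nbhs_simpl /within /= => near_A.
  by apply: filterS near_A => z near_A Yz; apply: near_A => //; exact: uX.
exact: cvg_comp cu_in (cphi _ (uX _ Yy)).
Qed.

Lemma within_continuous_near_neq0 (M : topologicalType) (X : set M) (phi : M -> R) x :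
  {within X, continuous phi} -> X x -> phi x != 0 ->
  \forall y \near within X (nbhs x), phi y != 0.
Proof.
move=> /subspace_continuousP cphi Xx phix; apply: (cvgr_neq0 (phi x)) => //.
exact: cphi.
Qed.

Lemma continuous_row (M : topologicalType) n (u : M -> 'rV[R]_n) :
  (forall i, continuous (fun x => u x ord0 i)) -> continuous u.
Proof.
move=> cu x A [P nbhsP PA]; apply: filterS PA _; apply: filter_forall => i.
apply: filter_forall => j; rewrite (ord1 i); exact: cu (nbhsP ord0 j).
Qed.

Lemma continuous_sum_coord n (P : pred 'I_n) :
  continuous (fun x : 'rV[R]_n => \sum_(i < n | P i) x ord0 i).
Proof.
apply: (@continuous_big R _ +%R 0) => [|i _]; first exact: add_continuous.
exact: coord_continuous.
Qed.

Lemma continuous_pair (M N1 N2 : topologicalType) (f : M -> N1) (g : M -> N2) :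
  continuous f -> continuous g -> continuous (fun x => (f x, g x)).
Proof. by move=> cf cg x; apply: cvg_pair; [exact: cf|exact: cg]. Qed.

Lemma continuous_maxr (M : topologicalType) (phi psi : M -> R) :
  continuous phi -> continuous psi -> continuous (fun x => Num.max (phi x) (psi x)).
Proof. by move=> cphi cpsi x; exact: (continuous_max (cphi x) (cpsi x)). Qed.

Lemma continuous_bigmax (M : topologicalType) (I : Type) (s : seq I)
    (phi : I -> M -> R) : (forall i, continuous (phi i)) ->
  continuous (fun x => \big[Num.max/0]_(i <- s) phi i x).
Proof.
move=> cphi; apply: (@continuous_big R I Num.max) => // -[a b].
by apply: (@continuous_maxr _ fst snd) => x; [exact: cvg_fst|exact: cvg_snd].
Qed.

End Continuity.

Section FlagComplex.
Variables (R : realType) (T : eqType) (cmp : rel T).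
Hypotheses (cmpxx : reflexive cmp) (cmpC : symmetric cmp).
Implicit Types (S : set T) (a b : T -> R).

Definition flag_point S (ts : seq T) a :=
  [/\ forall t, 0 <= a t, forall t, t \notin ts -> a t = 0,
      forall t, a t != 0 -> S t,
      forall s t, a s != 0 -> a t != 0 -> cmp s t &
      \sum_(t <- ts) a t = 1].

Lemma sum_supported (ts ts' : seq T) a : uniq ts -> uniq ts' ->
  {subset ts <= ts'} -> (forall t, t \notin ts -> a t = 0) ->
  \sum_(t <- ts') a t = \sum_(t <- ts) a t.
Proof.
move=> u u' sub a0; rewrite (bigID (mem ts)) /= [X in _ + X]big1 ?addr0; last first.
  by move=> t /a0.
rewrite -big_filter; apply: perm_big; apply: uniq_perm; rewrite ?filter_uniq //.
by move=> t; rewrite mem_filter /=; case: (boolP (t \in ts)) => // /sub ->.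
Qed.

Lemma flag_point_widen S ts ts' a : uniq ts -> uniq ts' -> {subset ts <= ts'} ->
  flag_point S ts a -> flag_point S ts' a.
Proof.
move=> u u' sub [a_ge0 a_out aS a_cmp a1]; split=> //; last by rewrite (sum_supported u).
by move=> t nt; apply: a_out; apply: contra nt; apply: sub.
Qed.

Lemma flag_point_sub S S' ts a : (forall t, a t != 0 -> S t -> S' t) ->
  flag_point S ts a -> flag_point S' ts a.
Proof. by move=> sub [? ? aS ? ?]; split=> // t at0; apply: sub => //; exact: aS. Qed.

Lemma flag_point_conv S ts a b s : 0 <= s <= 1 ->
  flag_point S ts a -> flag_point S ts b ->
  (forall x y, a x != 0 -> b y != 0 -> cmp x y) ->
  flag_point S ts (fun t => (1 - s) * a t + s * b t).
Proof.
move=> /andP[s0 s1] [a_ge0 a_out aS a_cmp a1] [b_ge0 b_out bS b_cmp b1] ab.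
have nz t : (1 - s) * a t + s * b t != 0 -> a t != 0 \/ b t != 0.
  case: (eqVneq (a t) 0) => [->|]; last by left.
  by case: (eqVneq (b t) 0) => [->|]; [rewrite !mulr0 addr0 eqxx|right].
split.
- by move=> t; rewrite addr_ge0 // mulr_ge0 // subr_ge0.
- by move=> t nt; rewrite a_out // b_out // !mulr0 addr0.
- by move=> t /nz[/aS|/bS].
- move=> x y /nz[ax|bx] /nz[ay|by']; [exact: a_cmp|exact: ab| |exact: b_cmp].
  by rewrite cmpC; exact: ab.
- by rewrite big_split /= -!mulr_sumr a1 b1; ring.
Qed.

Lemma flag_point_vertex S v : S v -> flag_point S [:: v] (fun t => (t == v)%:R).
Proof.
move=> Sv; split; rewrite ?big_seq1 ?eqxx //.
- by move=> t; rewrite inE => /negPf->.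
- by move=> t; case: (eqVneq t v) => [->|_]; rewrite ?eqxx.
- move=> s t; case: (eqVneq s v) => [->|_]; rewrite ?eqxx // => _.
  by case: (eqVneq t v) => [->|_]; rewrite ?eqxx.
Qed.

Section FlagMaps.
Variable M : topologicalType.
Implicit Types (X Y A : set M) (f g : M -> T -> R).

Definition flag_map S X f :=
  exists2 ts, uniq ts & (forall x, X x -> flag_point S ts (f x)) /\
    forall t, {within X, continuous (f^~ t)}.

Lemma flag_map_sub S S' X Y f : Y `<=` X ->
  (forall x t, Y x -> f x t != 0 -> S t -> S' t) ->
  flag_map S X f -> flag_map S' Y f.
Proof.
move=> YX SS' [ts u [fS cf]]; exists ts => //; split=> [x Yx|t].
  by apply: flag_point_sub (fS _ (YX _ Yx)) => t; exact: SS'.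
exact: continuous_subspaceW YX (cf t).
Qed.

Lemma flag_map_subS S S' X f : S `<=` S' -> flag_map S X f -> flag_map S' X f.
Proof. by move=> SS'; apply: flag_map_sub => // x t _ _ /SS'. Qed.

Lemma flag_map_subX S X Y f : Y `<=` X -> flag_map S X f -> flag_map S Y f.
Proof. by move=> YX; apply: flag_map_sub. Qed.

Lemma eq_flag_map S X f g : (forall x, X x -> f x = g x) ->
  flag_map S X f -> flag_map S X g.
Proof.
move=> fg [ts u [fS cf]]; exists ts => //; split=> [x Xx|t]; first by rewrite -fg //; exact: fS.
apply: (subspace_eq_continuous (f := f^~ t)) (cf t) => x; rewrite inE => Xx.
by rewrite fg.
Qed.

Lemma flag_map_support2 S S' X Y f g : flag_map S X f -> flag_map S' Y g ->
  exists2 ts, uniq ts & (forall x, X x -> flag_point S ts (f x)) /\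
    forall y, Y y -> flag_point S' ts (g y).
Proof.
move=> [ts u [fS _]] [ts' u' [gS _]]; exists (undup (ts ++ ts')); first exact: undup_uniq.
split=> x Xx.
  apply: flag_point_widen u (undup_uniq _) _ (fS _ Xx) => t tin.
  by rewrite mem_undup mem_cat tin.
apply: flag_point_widen u' (undup_uniq _) _ (gS _ Xx) => t tin.
by rewrite mem_undup mem_cat tin orbT.
Qed.

Lemma flag_map_setU S A B f : closed A -> closed B ->
  flag_map S A f -> flag_map S B f -> flag_map S (A `|` B) f.
Proof.
move=> cA cB fA fB; have [ts u [tsA tsB]] := flag_map_support2 fA fB.
exists ts => //; split=> [x [/tsA|/tsB]//|t].
by case: fA fB => _ _ [_ fA] [_ _ [_ fB]]; exact: withinU_continuous.
Qed.

Lemma flag_map_level S X (phi : M -> R) r f : closed X -> continuous phi ->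
  flag_map S (X `&` [set x | r <= phi x]) f -> flag_map S (X `&` [set x | phi x <= r]) f ->
  flag_map S X f.
Proof.
move=> clX cphi f_ge f_le.
apply: (flag_map_subX (X := (X `&` [set x | r <= phi x]) `|` (X `&` [set x | phi x <= r]))).
  by move=> x Xx; case: (leP r (phi x)) => phix; [left|right; split=> //; exact: ltW].
apply: flag_map_setU f_ge f_le; apply: closedI => //.
- by apply: preimage_closed (@closed_ge _ _) => x _; exact: cphi.
- by apply: preimage_closed (@closed_le _ _) => x _; exact: cphi.
Qed.

Lemma flag_map_cover S X (K : eqType) (s : seq K) (A : K -> set M) f :
  (forall x, X x -> exists2 k, k \in s & A k x) ->
  (forall k, k \in s -> closed (A k)) ->
  (forall k, k \in s -> flag_map S (A k) f) -> flag_map S X f.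
Proof.
move=> cov clA fA.
have fU : flag_map S (\big[setU/set0]_(k <- s) A k) f.
  elim: s clA fA {cov} => [|k s IH] clA fA.
    rewrite big_nil; exists [::] => //; split=> // t; exact: continuous_subspace0.
  have js j : j \in s -> j \in k :: s by rewrite inE => ->; rewrite orbT.
  rewrite big_cons; apply: flag_map_setU; first by apply: clA; exact: mem_head.
  - by apply: closed_bigsetU => j /js; exact: clA.
  - by apply: fA; exact: mem_head.
  - by apply: IH => j /js; [exact: clA|exact: fA].
by apply: flag_map_subX fU => x /cov[k ks Ax]; rewrite (big_rem k) //=; left.
Qed.

End FlagMaps.

Lemma flag_map_subst (M N : topologicalType) S (X : set M) (Y : set N) (u : N -> M) f :
  (forall y, Y y -> X (u y)) -> {within Y, continuous u} ->
  flag_map S X f -> flag_map S Y (f \o u).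
Proof.
move=> uX cu [ts uts [fS cf]]; exists ts => //; split=> [y /uX/fS//|t].
exact: (within_continuous_subst uX cu (cf t)).
Qed.

End FlagComplex.

Lemma filter_all_seq (M : Type) (F : set_system M) (K : eqType) (s : seq K) (P : K -> set M) :
  Filter F -> (forall k, k \in s -> F (P k)) -> F [set x | forall k, k \in s -> P k x].
Proof.
move=> FF; elim: s => [|k s IH] Fs; first by apply: filterS filterT.
have Fk := Fs k (mem_head _ _).
have {}IH : F [set x | forall j, j \in s -> P j x].
  by apply: IH => j js; apply: Fs; rewrite inE js orbT.
by apply: filterS2 Fk IH => x Pk Ps j; rewrite inE => /predU1P[->//|]; exact: Ps.
Qed.

Section Cubes.
Variable R : realType.
Local Notation point := {ptws nat -> R}.
Implicit Types (D : seq nat) (c x y : point) (rho : R).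

Definition cube D c rho : set point :=
  [set x | forall i, `|x i - c i| <= if i \in D then rho else 0].

Definition cube_boundary D c rho : set point :=
  [set x | cube D c rho x /\ exists2 i, i \in D & `|x i - c i| = rho].

Definition supdist D c x : R := \big[Num.max/0]_(i <- D) `|x i - c i|.

Lemma le_supdist D c x i : i \in D -> `|x i - c i| <= supdist D c x.
Proof. by move=> iD; exact: (le_bigmax_seq _ i xpredT (fun j => `|x j - c j|)). Qed.

Lemma supdist_attained D c x : 0 < supdist D c x ->
  exists2 i, i \in D & `|x i - c i| = supdist D c x.
Proof.
rewrite /supdist; elim: D => [|i D IH]; first by rewrite big_nil ltxx.
rewrite big_cons; case: (leP `|x i - c i|) => _; last by exists i; rewrite ?mem_head.
by move/IH => [j jD e]; exists j => //; rewrite inE jD orbT.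
Qed.

Lemma coord_sub_continuous i (r : R) : continuous (fun x : point => x i - r).
Proof.
move=> x; apply: (@cvgB R R point (nbhs x) _ (fun x => x i) (cst r)); last exact: cvg_cst.
exact: (@coord_ptws_continuous R nat i x).
Qed.

Lemma coord_dist_continuous i (r : R) : continuous (fun x : point => `|x i - r|).
Proof. by move=> x; exact: (@cvg_norm R R point _ _ _ _ (@coord_sub_continuous i r x)). Qed.

Lemma supdist_continuous D c : continuous (supdist D c).
Proof.
by apply: (@continuous_bigmax R _ _ D (fun i x => `|x i - c i|)) => i; exact: coord_dist_continuous.
Qed.

Lemma cube_out D c rho x i : cube D c rho x -> i \notin D -> x i = c i.
Proof.
move=> cx iD; have := cx i; rewrite (negPf iD) normr_le0 subr_eq0.
by move/eqP.
Qed.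

Lemma cube_supdist D c rho x : 0 <= rho ->
  cube D c rho x <-> supdist D c x <= rho /\ forall i, i \notin D -> x i = c i.
Proof.
move=> rho0; split=> [cx|[dx xout] i].
  split; last by move=> i; exact: cube_out cx.
  by rewrite /supdist big_seq; apply: bigmax_le => // i iD; have := cx i; rewrite iD.
case: ifP => iD; first exact: le_trans (le_supdist _ _ iD) dx.
by rewrite xout ?iD // subrr normr0.
Qed.

Lemma cube_boundary_supdist D c rho x : 0 < rho ->
  cube_boundary D c rho x <-> cube D c rho x /\ supdist D c x = rho.
Proof.
move=> rho0; split=> -[cx]; have [dx _] := (cube_supdist D c x (ltW rho0)).1 cx.
  by move=> [i iD e]; split=> //; apply/eqP; rewrite eq_le dx -{1}e le_supdist.
by move=> e; split=> //; rewrite -e; apply: supdist_attained; rewrite e.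
Qed.

Lemma closed_cube D c rho : closed (cube D c rho).
Proof.
rewrite (_ : cube D c rho = \bigcap_i [set x | `|x i - c i| <= if i \in D then rho else 0]).
  apply: closed_bigI => i _.
  apply: (@preimage_closed _ _ _ [set r | r <= _]); last exact: closed_le.
  by move=> x _; exact: coord_dist_continuous.
by apply/seteqP; split=> x cx i; [move=> _|]; exact: cx.
Qed.

Lemma cube_compact D c rho : compact (cube D c rho).
Proof.
pose r i : R := if i \in D then rho else 0.
have -> : cube D c rho = [set x : point | forall i, `[c i - r i, c i + r i]%classic (x i)].
  apply/seteqP; split=> x cx i; have := cx i; rewrite /= in_itv /= -/(r i) ler_norml.
    by move=> /andP[? ?]; apply/andP; split; lra.
  by move=> /andP[? ?]; apply/andP; split; lra.
apply: (@tychonoff nat (fun=> R) (fun i => `[c i - r i, c i + r i]%classic)) => i.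
exact: segment_compact.
Qed.

Lemma cube_boundary_compact D c rho : 0 < rho -> compact (cube_boundary D c rho).
Proof.
move=> rho0.
have -> : cube_boundary D c rho = cube D c rho `&` supdist D c @^-1` [set rho].
  by apply/seteqP; split=> x /(cube_boundary_supdist _ _ _ rho0).
apply: compact_closedI; first exact: cube_compact.
apply: preimage_closed; last exact: closed_eq.
by move=> x _; exact: supdist_continuous.
Qed.

Definition inflate D c rho x : point :=
  fun i => c i + rho / Num.max (supdist D c x) (rho / 2) * (x i - c i).

Lemma inflate_continuous D c rho : 0 < rho -> continuous (inflate D c rho).
Proof.
move=> rho0; apply: continuous_ptws => i.
have cr : continuous (fun x => Num.max (supdist D c x) (rho / 2)).
  by apply: continuous_maxr; [exact: supdist_continuous|exact: cst_continuous].
have r_neq0 x : Num.max (supdist D c x) (rho / 2) != 0.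
  by rewrite gt_eqF // lt_max divr_gt0 ?orbT.
have cst_cont (r : R) : continuous (cst r : point -> R) by exact: cst_continuous.
move=> x; apply: (continuousD (cst_cont _ x)).
apply: (continuousM _ (@coord_sub_continuous i (c i) x)).
exact: (continuousM (cst_cont rho x) (@continuousV _ _ _ x (r_neq0 x) (cr x))).
Qed.

Lemma inflate_cube D c rho x : 0 < rho -> cube D c rho x ->
  cube D c rho (inflate D c rho x).
Proof.
move=> rho0 cx i; rewrite /inflate addrAC subrr add0r normrM.
case: ifP => iD; last by rewrite (cube_out cx) ?iD // subrr normr0 mulr0.
have d0 : 0 < Num.max (supdist D c x) (rho / 2) by rewrite lt_max divr_gt0 ?orbT.
rewrite ger0_norm ?divr_ge0 ?(ltW rho0) ?(ltW d0) // mulrAC ler_pdivrMr // ler_wpM2l ?(ltW rho0) //.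
by rewrite le_max le_supdist.
Qed.

Lemma inflate_boundary D c rho x : 0 < rho -> cube D c rho x -> rho / 2 <= supdist D c x ->
  cube_boundary D c rho (inflate D c rho x).
Proof.
move=> rho0 cx dx; split; first exact: inflate_cube.
have d0 : 0 < supdist D c x by apply: lt_le_trans dx; rewrite divr_gt0.
have [i iD e] := supdist_attained d0; exists i => //.
rewrite /inflate (max_idPl dx) addrAC subrr add0r normrM e.
by rewrite ger0_norm ?divr_ge0 ?(ltW rho0) ?(ltW d0) // divfK ?gt_eqF.
Qed.

Lemma inflate_id D c rho x : 0 < rho -> cube_boundary D c rho x -> inflate D c rho x = x.
Proof.
move=> rho0 /(cube_boundary_supdist _ _ _ rho0)[_ e]; apply: funext => i.
have half_le : rho / 2 <= rho by lra.
by rewrite /inflate e (max_idPl half_le) divff ?gt_eqF // mul1r addrC subrK.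
Qed.

Lemma near_coord_ptws D x d : 0 < d ->
  \forall y \near x, forall i, i \in D -> `|x i - y i| < d.
Proof.
move=> d0; apply: (@filter_all_seq _ (nbhs x) _ D (fun i y => `|x i - y i| < d)) => i _.
exact: (@coord_ptws_continuous R nat i x _ (nbhsx_ballx (x i) d d0)).
Qed.

Lemma ptws_nbhs_supball x (A : set point) : nbhs x A ->
  exists2 d, 0 < d & forall y, (forall i, `|x i - y i| < d) -> A y.
Proof.
pose supball d := [set y : point | forall i, `|x i - y i| < d].
have supball_filter : Filter (filter_from [set d | 0 < d] supball).
  apply: filter_from_filter; first by exists 1 => /=.
  move=> d d' /= d0 d'0; exists (Num.min d d'); first by rewrite /= lt_min d0.
  by move=> y yd; split=> i; apply: lt_le_trans (yd i) _; rewrite ge_min lexx ?orbT.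
suff cvg_x : filter_from [set d | 0 < d] supball --> x.
  by move=> /cvg_x[d d0 sub]; exists d.
apply/pointwise_cvgP => i A' /nbhs_ballP[d /= d0 sub]; exists d => // y yd.
exact/sub/yd.
Qed.

Lemma compact_unif_continuous D (K : set point) (phi : point -> R) e :
  compact K -> (forall x y i, K x -> K y -> i \notin D -> x i = y i) ->
  {within K, continuous phi} -> 0 < e ->
  \forall d \near 0^'+, forall x y, K x -> K y ->
    (forall i, i \in D -> `|x i - y i| < d) -> `|phi x - phi y| < e.
Proof.
move=> cK Kout /subspace_continuousP cphi e0.
pose P d x := K x -> forall y, K y -> (forall i, i \in D -> `|x i - y i| < d) ->
  `|phi x - phi y| < e.
suff : \forall d \near 0^'+, K `<=` P d by apply: filterS => d dP x y Kx; exact: dP.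
apply: (compact_near_coveringP K).1 => // x Kx.
have e20 : 0 < e / 2 by rewrite divr_gt0.
have /ptws_nbhs_supball[d d0 near_x] := cphi x Kx _ (nbhsx_ballx (phi x) _ e20).
have d20 : 0 < d / 2 by rewrite divr_gt0.
exists ([set x' | forall i, i \in D -> `|x i - x' i| < d / 2], [set d' | d' < d / 2]).
  by split; [exact: near_coord_ptws|exact: nbhs_right_lt].
move=> [x' d'] /= [xx' d'd] Kx' y Ky x'y.
have phi_near z : K z -> (forall i, i \in D -> `|x i - z i| < d) -> `|phi x - phi z| < e / 2.
  move=> Kz xz; apply: near_x => // i; have [iD|iD] := boolP (i \in D); first exact: xz.
  by rewrite (Kout x z) // subrr normr0.
have xx'd i : i \in D -> `|x i - x' i| < d by move=> /xx'; lra.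
have xyd i : i \in D -> `|x i - y i| < d.
  by move=> iD; have := xx' i iD; have := x'y i iD; rewrite !ltr_norml; lra.
have := phi_near _ Kx' xx'd; have := phi_near _ Ky xyd; rewrite !ltr_norml; lra.
Qed.

End Cubes.

Section Extension.
Variables (R : realType) (T : eqType) (cmp : rel T).
Hypotheses (cmpxx : reflexive cmp) (cmpC : symmetric cmp).
Local Notation point := {ptws nat -> R}.
Implicit Types (S : set T) (D : seq nat) (c x : point) (rho : R) (f g : point -> T -> R).

Definition extendable S D c rho f := exists2 g, flag_map cmp S (cube D c rho) g &
  forall x, cube_boundary D c rho x -> g x = f x.

Definition fillable (j : nat) S := forall D c rho f, uniq D -> size D = j -> 0 < rho ->
  flag_map cmp S (cube_boundary D c rho) f -> extendable S D c rho f.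

(* Collar argument: the homotopy fills the outer half of the cube, and the extension of its
   end, shrunk by a factor of two, the inner half. *)
Lemma homotopy_extendable S D c rho (h : point * R -> T -> R) f0 f1 : 0 < rho ->
  flag_map cmp S (cube_boundary D c rho `*` `[0 : R, 1 : R]%classic) h ->
  (forall x, cube_boundary D c rho x -> f0 x = h (x, 0)) ->
  (forall x, cube_boundary D c rho x -> f1 x = h (x, 1)) ->
  extendable S D c rho f1 -> extendable S D c rho f0.
Proof.
move=> rho0 h_S f0_h f1_h [g gS gf1].
have rho_neq0 : rho != 0 by rewrite gt_eqF.
pose s x := supdist D c x / rho.
have cst_cont (r : R) : continuous (cst r : point -> R) by exact: cst_continuous.
have s_cont : continuous s.
  by move=> x; exact: (continuousM (@supdist_continuous _ D c x) (cst_cont _ x)).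
have s_supdist x : supdist D c x = rho * s x by rewrite /s mulrC divfK.
have s_le1 x : cube D c rho x -> s x <= 1.
  by move=> /(cube_supdist _ _ _ (ltW rho0))[dx _]; rewrite ler_pdivrMr // mul1r.
pose outer := cube D c rho `&` [set x | 2^-1 <= s x].
pose inner := cube D c rho `&` [set x | s x <= 2^-1].
have outer_boundary x : outer x -> cube_boundary D c rho (inflate D c rho x).
  by move=> [cx sx]; apply: inflate_boundary => //; rewrite s_supdist ler_wpM2l // ltW.
pose G x := if 2^-1 <= s x then h (inflate D c rho x, 2 - 2 * s x)
            else g (inflate D c rho x).
have G_outer : flag_map cmp S outer G.
  apply: (@eq_flag_map _ _ _ _ _ _ (h \o fun x => (inflate D c rho x, 2 - 2 * s x))).
    by move=> x [_ /= sx]; rewrite /G sx.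
  apply: flag_map_subst h_S.
    move=> x ox; split; first exact: outer_boundary.
    by case: ox => /s_le1 s1 /= s2; rewrite /= in_itv /=; apply/andP; split; lra.
  apply: continuous_subspaceT; apply: continuous_pair; first exact: inflate_continuous.
  by move=> x; exact: (continuousB (cst_cont 2 x) (continuousM (cst_cont 2 x) (s_cont x))).
have G_inner : flag_map cmp S inner G.
  apply: (@eq_flag_map _ _ _ _ _ _ (g \o inflate D c rho)).
    move=> x [cx /= sx]; rewrite /G; case: leP => // sx'.
    have sx_half : s x = 2^-1 by apply/eqP; rewrite eq_le sx.
    have ox : outer x by [].
    rewrite sx_half mulfV ?pnatr_eq0 // (_ : 2 - 1 = 1); last by ring.
    by rewrite gf1 ?f1_h //; exact: outer_boundary.
  apply: flag_map_subst gS; first by move=> x [cx _]; exact: inflate_cube.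
  by apply: continuous_subspaceT; exact: inflate_continuous.
exists G; last first.
  move=> x bx; have [_ dx] := (cube_boundary_supdist _ _ _ rho0).1 bx.
  rewrite /G inflate_id // /s dx divff // invf_le1 ?ltr0n // ler1n /= mulr1 subrr.
  exact/esym/f0_h.
exact: flag_map_level (@closed_cube _ D c rho) s_cont G_outer G_inner.
Qed.

Lemma linear_homotopy_extendable S D c rho f0 f1 : 0 < rho ->
  flag_map cmp S (cube_boundary D c rho) f0 -> flag_map cmp S (cube_boundary D c rho) f1 ->
  (forall x s t, cube_boundary D c rho x -> f0 x s != 0 -> f1 x t != 0 -> cmp s t) ->
  extendable S D c rho f1 -> extendable S D c rho f0.
Proof.
move=> rho0 f0S f1S f01.
have [ts uts [ts0 ts1]] := flag_map_support2 f0S f1S.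
case: f0S f1S => _ _ [_ c0] [_ _ [_ c1]].
pose h (xs : point * R) t := (1 - xs.2) * f0 xs.1 t + xs.2 * f1 xs.1 t.
apply: (@homotopy_extendable _ _ _ _ h) => //.
- exists ts => //; split=> [[x s] [/= bx]|t].
    rewrite in_itv /= => s01; apply: (flag_point_conv cmpC s01 (ts0 _ bx) (ts1 _ bx)).
    by move=> *; exact: (f01 x).
  pose bd_I := cube_boundary D c rho `*` `[0 : R, 1 : R]%classic.
  have c_fst (phi : point -> R) : {within cube_boundary D c rho, continuous phi} ->
      {within bd_I, continuous (phi \o fst : point * R -> R)}.
    apply: within_continuous_subst; first by move=> [x s] [].
    by apply: continuous_subspaceT => xs; exact: cvg_fst.
  have c_snd : {within bd_I, continuous (snd : point * R -> R)}.
    by apply: continuous_subspaceT => xs; exact: cvg_snd.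
  move=> xs; apply: cvgD; apply: cvgM;
    [|exact: c_fst (c0 t) xs|exact: c_snd|exact: c_fst (c1 t) xs].
  by apply: cvgB; [exact: cvg_cst|exact: c_snd].
- by move=> x _; apply/funext => t; rewrite /h subr0 mul1r mul0r addr0.
- by move=> x _; apply/funext => t; rewrite /h subrr mul1r mul0r add0r.
Qed.

Lemma cone_fillable j S v : S v -> (forall s, S s -> cmp s v) -> fillable j S.
Proof.
move=> Sv S_v D c rho f _ _ rho0 fS.
have vS X : flag_map cmp S X (fun (_ : point) t => (t == v)%:R).
  exists [:: v] => //; split=> [x _|t]; first exact: flag_point_vertex.
  by apply: continuous_subspaceT; exact: cst_continuous.
apply: (@linear_homotopy_extendable _ _ _ _ _ (fun _ t => (t == v)%:R)) => //; last by eexists.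
move=> x s t bx fs; case: (eqVneq t v) => [->|_]; rewrite ?eqxx // => _; apply: S_v.
by case: fS => ts _ [fS _]; case: (fS x bx) => _ _ + _ _; apply.
Qed.

End Extension.

Lemma unit_grid_coord (R : realType) (y : R) (k : nat) : 0 <= y <= k%:R -> ~~ odd k ->
  exists j, [/\ (j <= k)%N, `|y - j%:R| <= (odd j)%:R &
    forall q, ~~ odd q -> y = q%:R -> j = q].
Proof.
move=> /andP[y0 yk] ek; have /andP[j1 j2] := truncn_itv y0; set j := Num.truncn y in j1 j2.
have jk : (j <= k)%N by rewrite -(ler_nat R); exact: le_trans yk.
have jq q : y = q%:R -> j = q.
  by move: (j) j1 j2 => p k1 k2 e; move: k1 k2; rewrite e ler_nat ltr_nat; lia.
rewrite -natr1 in j2.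
case oj : (odd j).
  exists j; split=> //; first by rewrite oj ger0_norm ?subr_ge0 //=; lra.
  by move=> q oq /jq.
have [yj|yj] := eqVneq y j%:R.
  by exists j; split=> //; [rewrite yj subrr normr0 ler0n|move=> q _ /jq].
have jy : j%:R < y by rewrite lt_neqAle eq_sym yj.
exists j.+1; split.
- by rewrite -(ltr_nat R); exact: lt_le_trans yk.
- by rewrite /= oj /= -natr1 ler_norml; apply/andP; split; lra.
- by move=> q _ /[dup] /jq <- e; rewrite e eqxx in yj.
Qed.

Section Grid.
Variables (R : realType) (b : {ptws nat -> R}) (eta : R) (D : seq nat) (K : nat -> nat).
Local Notation point := {ptws nat -> R}.
Implicit Types (m n : nat -> nat) (x : point) (i : nat).

(* The cells of the cubical grid of mesh [2 * eta] on the box with corners [b] and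
   [b + eta * K] are encoded by functions [m <= K]: the coordinate [i] of the points of the
   cell is free when [m i] is odd, its midpoint being [corner m i], and fixed when [m i] is
   even. *)
Definition grid : set (nat -> nat) := [set m | forall i, (m i <= K i)%N].

Definition corner m : point := fun i => b i + eta * (m i)%:R.

Definition free m := [seq i <- D | odd (m i)].

Definition cell m : set point := cube (free m) (corner m) eta.

Definition cell_boundary m : set point := cube_boundary (free m) (corner m) eta.

Definition face n m := forall i, n i = m i \/ odd (m i) /\ (n i = (m i).+1 \/ (n i).+1 = m i).

Definition box : set point := [set x | forall i, b i <= x i <= b i + eta * (K i)%:R].

Definition facet m (p : nat * bool) : nat -> nat :=
  dfwith m p.1 (if p.2 then (m p.1).+1 else (m p.1).-1).

Definition facets m := [seq facet m p | p <- [seq (i, s) | i <- free m, s <- [:: true; false]]].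

Hypothesis K_even : forall i, ~~ odd (K i).

Lemma face_grid n m : grid m -> face n m -> grid n.
Proof.
by move=> gm nm i; have := gm i; have := K_even i; case: (nm i) => [->|[om [|]]] //; lia.
Qed.

Hypothesis K_out : forall i, i \notin D -> K i = 0%N.

Lemma mem_free m i : grid m -> (i \in free m) = odd (m i).
Proof.
move=> gm; rewrite mem_filter andb_idr // => om; apply: contraTT om => iD.
by have := gm i; rewrite K_out // leqn0 => /eqP ->.
Qed.

Lemma cellP m x : grid m ->
  cell m x <-> forall i, `|x i - corner m i| <= if odd (m i) then eta else 0.
Proof. by move=> gm; split=> cx i; have := cx i; rewrite mem_free. Qed.

Lemma facetsP m n : grid m -> n \in facets m -> face n m /\ n <> m.
Proof.
move=> gm /mapP[_ /allpairsP[[i s] [/= ifree _ ->]] ->]; rewrite mem_free // in ifree.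
split=> [j|/(congr1 (fun h => h i))]; rewrite /facet /=.
  have [->|ji] := eqVneq j i; last by left; rewrite dfwithout // eq_sym.
  by right; rewrite dfwithin; split=> //; case: s; [left|right; lia].
by rewrite dfwithin; case: s; lia.
Qed.

Lemma grid_finite : exists s : seq (nat -> nat), forall m, grid m -> m \in s.
Proof.
have [s s_grid] : exists s : seq (nat -> nat), forall m, grid m ->
    (forall i, i \notin D -> m i = 0%N) -> m \in s.
  elim: (D) => [|i D' [s s_grid]].
    by exists [:: fun=> 0%N] => m _ m0; rewrite inE; apply/eqP/funext => i; rewrite m0.
  exists [seq dfwith m i k | m <- s, k <- iota 0 (K i).+1] => m gm m0.
  apply/allpairsP; exists (dfwith m i 0%N, m i); split.
  - apply: s_grid => j; rewrite /=; have [->|ji] := eqVneq i j; rewrite ?dfwithin ?dfwithout //.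
    by move=> jD; apply: m0; rewrite inE negb_or eq_sym ji.
  - by rewrite mem_iota add0n ltnS /= gm.
  - apply/funext => j; rewrite /=; have [<-|ij] := eqVneq i j; first by rewrite dfwithin.
    by rewrite !dfwithout.
by exists s => m gm; apply: s_grid => // i iD; have := gm i; rewrite K_out // leqn0 => /eqP.
Qed.

Hypothesis eta0 : 0 < eta.

Lemma corner_cell m : cell m (corner m).
Proof. by move=> i; rewrite subrr normr0; case: ifP => // _; exact: ltW. Qed.

Lemma face_cell n m : grid m -> face n m -> cell n `<=` cell m.
Proof.
move=> gm nm x /(cellP _ (face_grid gm nm)) cx; apply/cellP => // i; have := cx i.
case: (nm i) => [e|[om e]]; first by rewrite /corner e.
have -> : odd (n i) = false by case: e; lia.
rewrite om normr_le0 subr_eq0 => /eqP ->; rewrite /corner.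
have -> : b i + eta * (n i)%:R - (b i + eta * (m i)%:R) = eta * ((n i)%:R - (m i)%:R) by ring.
rewrite normrM gtr0_norm // -[leRHS]mulr1 ler_pM2l //.
case: e => [->|<-]; rewrite -natr1.
  by rewrite (_ : _ + 1 - _ = 1) ?normr1 //; ring.
by rewrite (_ : _ - (_ + 1) = -1) ?normrN1 //; ring.
Qed.

Lemma grid_dist_lt (p q k : nat) : `|eta * p%:R - eta * q%:R| < eta * k%:R ->
  (p < q + k)%N /\ (q < p + k)%N.
Proof.
rewrite -mulrBr normrM gtr0_norm // ltr_pM2l // ltr_norml => /andP[? ?].
by split; rewrite -(ltr_nat R) natrD; lra.
Qed.

Lemma open_cell_face n m x : grid n -> grid m ->
  cell n x -> ~ cell_boundary n x -> cell m x -> face n m.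
Proof.
move=> gn gm cn nbn /(cellP _ gm) cm i; have := (cellP _ gn).1 cn i; have := cm i.
have : odd (n i) -> `|x i - corner n i| < eta.
  move=> on; rewrite lt_neqAle; have := (cellP _ gn).1 cn i; rewrite on => ->.
  by rewrite andbT; apply/eqP => e; apply: nbn; split=> //; exists i; rewrite ?mem_free.
have tri : `|eta * (n i)%:R - eta * (m i)%:R| <= `|x i - corner m i| + `|x i - corner n i|.
  rewrite (_ : _ - _ = (x i - corner m i) - (x i - corner n i)); first exact: ler_normB.
  by rewrite /corner; ring.
case on : (odd (n i)); case om : (odd (m i)) => /= open_n dm dn.
- left; have : `|eta * (n i)%:R - eta * (m i)%:R| < eta * 2%:R by have := open_n isT; lra.
  by move/grid_dist_lt => [? ?]; lia.
- have : `|eta * (n i)%:R - eta * (m i)%:R| < eta * 1%:R.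
    by rewrite mulr1; have := open_n isT; lra.
  by move/grid_dist_lt => [? ?]; lia.
- right; split=> //; have : `|eta * (n i)%:R - eta * (m i)%:R| < eta * 2%:R.
    by have := eta0; lra.
  by move/grid_dist_lt => [? ?]; lia.
- left; have : `|eta * (n i)%:R - eta * (m i)%:R| < eta * 1%:R.
    by rewrite mulr1; have := eta0; lra.
  by move/grid_dist_lt => [? ?]; lia.
Qed.

Lemma cell_boundary_facets m x : grid m -> cell_boundary m x ->
  exists2 n, n \in facets m & cell n x.
Proof.
move=> gm [cx [i ifree ei]]; have om := ifree; rewrite mem_free // in om.
pose s := 0 <= x i - corner m i.
have nm : facet m (i, s) \in facets m.
  by apply: map_f; apply/allpairsP; exists (i, s); split=> //; case: (s).
exists (facet m (i, s)) => //; have [fnm _] := facetsP gm nm.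
apply/cellP => [|j]; first exact: face_grid fnm.
have [->|ji] := eqVneq j i; last first.
  have := (cellP x gm).1 cx j.
  by rewrite /corner /facet dfwithout // eq_sym.
have x_facet : x i = corner (facet m (i, s)) i.
  rewrite /corner /facet dfwithin /= /s; case: leP ei => h.
    rewrite ger0_norm // /corner => e; rewrite -natr1; lra.
  rewrite ltr0_norm // /corner => e.
  have : ((m i).-1)%:R + 1 = (m i)%:R :> R by rewrite natr1 prednK //; lia.
  nra.
by rewrite -x_facet subrr normr0; case: ifP => // _; exact: ltW.
Qed.

Lemma cell_box m : grid m -> cell m `<=` box.
Proof.
move=> gm x /(cellP _ gm) cx i; have := cx i; rewrite /corner.
have lo : 0 <= eta * (m i)%:R by rewrite mulr_ge0 ?ler0n // ltW.
have hi : eta * (m i)%:R <= eta * (K i)%:R by rewrite ler_pM2l // ler_nat.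
case: ifP => om; last by rewrite ler_norml; have := eta0; lra.
have lo1 : eta <= eta * (m i)%:R by rewrite -{1}(mulr1 eta) ler_pM2l // ler1n odd_gt0.
have hi1 : eta * (m i)%:R + eta <= eta * (K i)%:R.
  rewrite -{2}(mulr1 eta) -mulrDr natr1 ler_pM2l // ler_nat.
  by have := gm i; have := K_even i; lia.
by rewrite ler_norml; have := eta0; lra.
Qed.

Lemma box_cell x : box x -> exists2 m, grid m & cell m x /\
  forall i q, ~~ odd q -> x i = b i + eta * q%:R -> m i = q.
Proof.
move=> bx; pose y i := (x i - b i) / eta.
have xy i : x i = b i + eta * y i by rewrite /y mulrC divfK ?gt_eqF // addrC subrK.
have yK i : 0 <= y i <= (K i)%:R.
  have /andP[lo hi] := bx i; apply/andP; split; first by apply: divr_ge0; [lra|exact: ltW].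
  by rewrite ler_pdivrMr // mulrC; lra.
have /choice[m m_coord] := fun i => unit_grid_coord (yK i) (K_even i).
have gm : grid m by move=> i; have [] := m_coord i.
exists m => //; split=> [|i q eq xq].
  apply/cellP => // i; rewrite /corner xy (_ : _ - _ = eta * (y i - (m i)%:R)); last by ring.
  rewrite normrM gtr0_norm //; have [_ + _] := m_coord i; case: (odd (m i)) => /= ym.
    by rewrite -[leRHS]mulr1 ler_pM2l.
  by rewrite -[leRHS](mulr0 eta) ler_pM2l.
have [_ _ m_exact] := m_coord i; apply: m_exact => //; apply: (mulfI (lt0r_neq0 eta0)).
by apply: (addrI (b i)); rewrite -xy.
Qed.

Hypothesis uniq_D : uniq D.

Lemma face_dim n m : grid m -> face n m -> n <> m -> (size (free n) < size (free m))%N.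
Proof.
move=> gm nm n_neq_m.
have [i ni] : exists i, n i <> m i.
  apply: contrapT => all_eq; apply: n_neq_m; apply/funext => i.
  by apply: contrapT => ni; case: all_eq; exists i.
have [//|[om e]] := nm i.
have odd_nm j : odd (n j) -> odd (m j) by case: (nm j) => [->|[]].
have iD : i \in D by have := mem_free i gm; rewrite om mem_filter => /andP[].
rewrite !size_filter !(seq.permP (perm_to_rem iD)) /= om.
have -> : odd (n i) = false by case: e; lia.
by rewrite add0n add1n ltnS; exact: sub_count.
Qed.

Section CarrierExtension.
Variables (T : eqType) (cmp : rel T) (X L : set (nat -> nat)) (C : (nat -> nat) -> set T).
Variable f : point -> T -> R.
Hypotheses (X_grid : X `<=` grid) (L_sub : L `<=` X).
Hypothesis X_face : forall m n, X m -> face n m -> X n.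
Hypothesis L_face : forall m n, L m -> face n m -> L n.
Hypothesis C_fillable : forall m, X m -> ~ L m -> fillable R cmp (size (free m)) (C m).
Hypothesis f_carried : forall m n, X m -> ~ L m -> face n m -> L n ->
  flag_map cmp (C m) (cell n) f.
Hypothesis C_face : forall m n, X m -> ~ L m -> face n m -> ~ L n -> C n `<=` C m.

Definition carried_extension k (g : point -> T -> R) :=
  (forall m x, L m -> cell m x -> g x = f x) /\
  forall m, X m -> ~ L m -> (size (free m) < k)%N -> flag_map cmp (C m) (cell m) g.

Lemma carried_boundary k g m : carried_extension k g -> X m -> ~ L m ->
  size (free m) = k -> flag_map cmp (C m) (cell_boundary m) g.
Proof.
move=> [gL gX] Xm nLm dm; have gm := X_grid Xm.
apply: (@flag_map_cover _ _ _ _ _ _ _ (facets m) cell) => [x|n _|n /(facetsP gm)[nm n_neq_m]].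
- exact: cell_boundary_facets.
- exact: closed_cube.
have [Ln|nLn] := pselect (L n).
  by apply: eq_flag_map (f_carried Xm nLm nm Ln) => x cx; rewrite (gL n).
apply: (flag_map_subS (C_face Xm nLm nm nLn)).
by apply: gX => //; [exact: X_face nm|rewrite -dm; exact: face_dim].
Qed.

Lemma carried_extension_step k g : carried_extension k g ->
  exists g', carried_extension k.+1 g'.
Proof.
move=> gk; have [gL gX] := gk.
pose new m := [/\ X m, ~ L m & size (free m) = k].
have /choice[H H_new] : forall m, exists h, new m -> flag_map cmp (C m) (cell m) h /\
    forall x, cell_boundary m x -> h x = g x.
  move=> m; have [[Xm nLm dm]|nnew] := pselect (new m); last by exists f.
  have gb := carried_boundary gk Xm nLm dm.
  have uf : uniq (free m) by exact: filter_uniq.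
  by have [h h_C h_g] := C_fillable Xm nLm uf erefl eta0 gb; exists h.
pose interior m x := cell m x /\ ~ cell_boundary m x.
have new_face m n x : new m -> X n -> interior m x -> cell n x ->
    m = n \/ (k < size (free n))%N /\ face m n.
  move=> [Xm _ dm] Xn [cm nbm] cn.
  have mn := open_cell_face (X_grid Xm) (X_grid Xn) cm nbm cn.
  have [|m_neq_n] := pselect (m = n); [by left|right; split=> //].
  by rewrite -dm; exact: face_dim (X_grid Xn) mn m_neq_n.
pose g' x := if pselect (exists m, new m /\ interior m x) is left e then H (projT1 (cid e)) x
             else g x.
have g'_old x : (forall m, new m -> ~ interior m x) -> g' x = g x.
  by move=> old; rewrite /g'; case: pselect => // -[m [newm intm]]; case: (old m newm).
have g'_new m x : new m -> cell m x -> g' x = H m x.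
  move=> newm cm; rewrite /g'; case: pselect => [e|old].
    case: (cid e) => n [newn intn] /=; have [Xm _ dm] := newm.
    by case: (new_face n m x newn Xm intn cm) => [->//|[]]; rewrite dm ltnn.
  have [bm|nbm] := pselect (cell_boundary m x); first by have [_ ->] := H_new m newm.
  by case: old; exists m.
exists g'; split=> [m x Lm cm|m Xm nLm].
  rewrite g'_old ?(gL m) // => n newn intn; have [_ nLn _] := newn; apply: nLn.
  by case: (new_face n m x newn (L_sub Lm) intn cm) => [->//|[_]]; exact: L_face.
rewrite ltnS leq_eqVlt => /predU1P[dm|dm].
  have newm : new m by [].
  by apply: eq_flag_map (H_new m newm).1 => x cm; rewrite (g'_new m).
apply: eq_flag_map (gX m Xm nLm dm) => x cm; rewrite g'_old // => n newn intn.
have [_ _ dn] := newn; case: (new_face n m x newn Xm intn cm) => [e|[dm' _]].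
  by move: dm; rewrite -e dn ltnn.
by have := ltn_trans dm dm'; rewrite ltnn.
Qed.

Lemma carrier_extension : exists2 g, (forall m x, L m -> cell m x -> g x = f x) &
  forall m, X m -> ~ L m -> flag_map cmp (C m) (cell m) g.
Proof.
have [g [gL gX]] : exists g, carried_extension (size D).+1 g.
  elim: (size D).+1 => [|k [g gk]]; first by exists f.
  exact: carried_extension_step gk.
exists g => // m Xm nLm; apply: gX => //.
by rewrite ltnS size_filter; exact: count_size.
Qed.

End CarrierExtension.

End Grid.

Lemma sum_map_singleton (R : nmodType) (T : eqType) (ts : seq T) (P : pred T) (a : T -> R)
    (phi : R -> R) : uniq ts -> phi 0 = 0 ->
  (forall s t, P s -> P t -> a s != 0 -> a t != 0 -> s = t) ->
  \sum_(t <- ts | P t) phi (a t) = phi (\sum_(t <- ts | P t) a t).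
Proof.
move=> uts phi0 single.
have [[v [vts Pv av]]|none] := pselect (exists v, [/\ v \in ts, P v & a v != 0]).
  have a0 t : t \in rem v ts -> P t -> a t = 0.
    rewrite mem_rem_uniq // inE => /andP[tv _] Pt; apply/eqP; apply: contraNT tv => at0.
    by apply/eqP; apply: single.
  have sum_rem (psi : R -> R) : psi 0 = 0 -> \sum_(t <- ts | P t) psi (a t) = psi (a v).
    move=> psi0; rewrite (big_rem v vts) /= Pv big_seq_cond big1 ?addr0 // => t /andP[tin Pt].
    by rewrite a0.
  by rewrite (sum_rem phi) // (sum_rem id).
have sum0 (psi : R -> R) : psi 0 = 0 -> \sum_(t <- ts | P t) psi (a t) = 0.
  move=> psi0; rewrite big_seq_cond big1 // => t /andP[tin Pt].
  suff -> : a t = 0 by [].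
  by apply: contrapT => /eqP at0; apply: none; exists t.
by rewrite (sum0 phi) // (sum0 id).
Qed.

Section Attach.
Variables (R : realType) (T : eqType) (cmp : rel T).
Hypotheses (cmpxx : reflexive cmp) (cmpC : symmetric cmp).
Variables (S0 S : set T).
Hypothesis S0_sub : S0 `<=` S.
Hypothesis new_eq : forall u v, S u -> S v -> ~ S0 u -> ~ S0 v -> cmp u v -> u = v.
Local Notation point := {ptws nat -> R}.
Implicit Types (ts : seq T) (a : T -> R).

Definition link v : set T := [set s | S0 s /\ cmp s v].

Definition new_mass ts a := \sum_(t <- ts | ~~ `[< S0 t >]) a t.

(* A vertex outside [S0] keeps a positive coordinate only if it had more than half of the
   total mass; the coordinates in [S0] are rescaled accordingly. *)
Definition push ts a t : R :=
  if `[< S0 t >] then a t / Num.max (1 - new_mass ts a) 2^-1 else Num.max 0 (2 * a t - 1).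

Lemma push_scale_gt0 ts a : 0 < Num.max (1 - new_mass ts a) 2^-1.
Proof. by rewrite lt_max invr_gt0 ltr0n orbT. Qed.

Lemma push_neq0 ts a t : push ts a t != 0 -> a t != 0.
Proof.
rewrite /push; case: ifP => _; first by apply: contraNN => /eqP->; rewrite mul0r.
by apply: contraNN => /eqP->; rewrite mulr0 sub0r; apply/eqP/max_idPl; lra.
Qed.

Lemma push_new_gt_half ts a t : ~ S0 t -> push ts a t != 0 -> 2^-1 < a t.
Proof.
move=> nSt; rewrite /push asboolF //.
by case: (leP (2 * a t - 1) 0) => [_|? _]; [rewrite eqxx|lra].
Qed.

Lemma push_flag_point ts a : uniq ts -> flag_point cmp S ts a -> flag_point cmp S ts (push ts a).
Proof.
move=> uts [a_ge0 a_out aS a_cmp a1]; have k0 := push_scale_gt0 ts a.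
split.
- by move=> t; rewrite /push; case: ifP => _; rewrite ?divr_ge0 ?(ltW k0) // le_max lexx.
- by move=> t nt; apply: contrapT => /eqP /push_neq0; rewrite a_out ?eqxx.
- by move=> t /push_neq0/aS.
- by move=> s t /push_neq0 as0 /push_neq0; exact: a_cmp.
pose m := new_mass ts a; pose k := Num.max (1 - m) 2^-1.
have old_sum : \sum_(t <- ts | `[< S0 t >]) push ts a t = (1 - m) / k.
  rewrite -[in RHS]a1 [in RHS](bigID (fun t => `[< S0 t >])) /= -/m addrK mulr_suml.
  by apply: eq_bigr => t St; rewrite /push St.
have new_sum : \sum_(t <- ts | ~~ `[< S0 t >]) push ts a t = Num.max 0 (2 * m - 1).
  rewrite (eq_bigr (fun t => Num.max 0 (2 * a t - 1))); last first.
    by move=> t /negPf nS; rewrite /push nS.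
  apply: (sum_map_singleton (phi := fun r => Num.max 0 (2 * r - 1)) uts).
    by rewrite /= mulr0 sub0r; apply/max_idPl; lra.
  move=> s t /asboolP nSs /asboolP nSt as0 at0.
  by apply: new_eq => //; [exact: aS|exact: aS|exact: a_cmp].
rewrite (bigID (fun t => `[< S0 t >])) /= old_sum new_sum /k.
case: (leP (1 - m) 2^-1) => m_half.
  by rewrite (max_idPr _); [rewrite invrK; lra|lra].
by rewrite (max_idPl _); [rewrite divff ?addr0 // gt_eqF //; lra|lra].
Qed.

Lemma push_continuous (X : set point) ts (f : point -> T -> R) t :
  (forall s, {within X, continuous (f^~ s)}) -> {within X, continuous (fun x => push ts (f x) t)}.
Proof.
move=> cf; have c_cst (r : R) : {within X, continuous (cst r : point -> R)}.
  by apply: continuous_subspaceT; exact: cst_continuous.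
have c_mass : {within X, continuous (fun x => new_mass ts (f x))}.
  apply: (@continuous_big R T +%R 0 _ _ (subspace X)) => [|s _]; last exact: cf.
  exact: add_continuous.
have c_max (phi psi : point -> R) : {within X, continuous phi} -> {within X, continuous psi} ->
    {within X, continuous (fun x => Num.max (phi x) (psi x))}.
  exact: continuous_maxr.
rewrite /push; case: `[< S0 t >]; last first.
  apply: (c_max _ _ (c_cst 0)) => x.
  exact: (continuousB (continuousM (c_cst 2 x) (cf t x)) (c_cst 1 x)).
have c_scale : {within X, continuous (fun x => Num.max (1 - new_mass ts (f x)) 2^-1)}.
  by apply: (c_max _ _ _ (c_cst 2^-1)) => x; exact: (continuousB (c_cst 1 x) (c_mass x)).
have scale_neq0 x : Num.max (1 - new_mass ts (f x)) 2^-1 != 0.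
  by rewrite gt_eqF // push_scale_gt0.
by move=> x; exact: (continuousM (cf t x) (@continuousV _ _ _ x (scale_neq0 x) (c_scale x))).
Qed.

Lemma push_off (X : set point) (f : point -> T -> R) : flag_map cmp S X f ->
  exists2 f1 : point -> T -> R, flag_map cmp S X f1 & forall x t, X x -> f1 x t != 0 ->
    f x t != 0 /\ (~ S0 t -> 2^-1 < f x t).
Proof.
move=> [ts uts [fS cf]]; exists (fun x => push ts (f x)).
  by exists ts => //; split=> [x /fS|t]; [exact: push_flag_point|exact: push_continuous].
move=> x t _ ft; split; first exact: push_neq0 ft.
by move=> nSt; exact: push_new_gt_half ft.
Qed.

Section AttachPushed.
Variables (D : seq nat) (c : point) (rho : R) (f f1 : point -> T -> R) (i0 n : nat).
Local Notation bd := (cube_boundary D c rho).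
Hypotheses (uniq_D : uniq D) (rho0 : 0 < rho) (i0D : i0 \notin D) (n0 : (0 < n)%N).
Hypotheses (fS : flag_map cmp S bd f) (f1S : flag_map cmp S bd f1).
Hypothesis f1_f : forall x t, bd x -> f1 x t != 0 -> f x t != 0 /\ (~ S0 t -> 2^-1 < f x t).

Let eta := rho / n%:R.
Hypothesis f_mesh : forall x y t, bd x -> bd y ->
  (forall i, i \in D -> `|x i - y i| <= 2 * eta) -> `|f x t - f y t| < 4^-1.

Let b : point := fun i => if i \in D then c i - rho else c i.
Let K i := if i \in D then n.*2 else if i == i0 then 2%N else 0%N.
Local Notation grid := (grid K).
Local Notation cell := (cell b eta (i0 :: D)).

Let eta0 : 0 < eta.
Proof. by rewrite divr_gt0 // ltr0n. Qed.

Let uniq_i0D : uniq (i0 :: D).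
Proof. by rewrite /= i0D. Qed.

Let K_even i : ~~ odd (K i).
Proof. by rewrite /K; case: ifP => _; [rewrite odd_double|case: ifP]. Qed.

Let K_out i : i \notin i0 :: D -> K i = 0%N.
Proof. by rewrite inE negb_or /K => /andP[/negPf-> /negPf->]. Qed.

Let D_neq i : i \in D -> i != i0.
Proof. by apply: contraTneq => ->. Qed.

Definition base (x : point) : point := dfwith x i0 (c i0).

Definition prism : set point := [set x | bd (base x) /\ c i0 <= x i0 <= c i0 + 2 * eta].

Definition prism_cell : set (nat -> nat) :=
  [set m | grid m /\ exists2 i, i \in D & m i = 0%N \/ m i = K i].

Lemma base_in i x : i \in D -> base x i = x i.
Proof. by move=> iD; rewrite /base dfwithout // eq_sym D_neq. Qed.

Lemma base_continuous : continuous base.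
Proof.
apply: continuous_ptws => i; have [->|ii0] := eqVneq i i0.
  have -> : (fun x => base x i0) = cst (c i0) by apply: funext => x; rewrite /base dfwithin.
  exact: cst_continuous.
have -> : (fun x => base x i) = (fun x : point => x i).
  by apply: funext => x; rewrite /base dfwithout // eq_sym.
exact: coord_ptws_continuous.
Qed.

Lemma prismP x : prism x <->
  box b eta K x /\ exists2 i, i \in D & x i = b i \/ x i = b i + eta * (K i)%:R.
Proof.
have KD i : i \in D -> eta * (K i)%:R = 2 * rho.
  by move=> iD; rewrite /K iD /eta -muln2 natrM; field; rewrite pnatr_eq0 -lt0n.
have bD i : i \in D -> b i = c i - rho by rewrite /b => ->.
split=> [[[cx [i iD]]]|[bx [i iD xi]]].
  rewrite base_in // => xi x0; split; last first.
    exists i => //; rewrite KD // bD //.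
    case: (leP 0 (x i - c i)) xi => h; first by rewrite ger0_norm // => ?; right; lra.
    by rewrite ltr0_norm // => ?; left; lra.
  move=> j; have [jD|jD] := boolP (j \in D).
    by have := cx j; rewrite jD base_in // KD // bD // ler_norml; lra.
  rewrite /b /K (negPf jD); have [->|ji0] := eqVneq j i0; first by rewrite mulrC.
  have := cube_out cx jD; rewrite /base dfwithout 1?eq_sym // => ->.
  by rewrite mulr0 addr0 lexx.
split; last first.
  have := bx i0; rewrite /b /K (negPf i0D) eqxx; lra.
have xD j : j \in D -> `|x j - c j| <= rho.
  by move=> jD; have := bx j; rewrite KD // bD // ler_norml; lra.
split; last first.
  exists i => //; rewrite base_in //; rewrite KD // bD // in xi.
  by case: xi => ->; [rewrite ler0_norm|rewrite ger0_norm]; have := rho0; lra.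
move=> j; have [jD|jD] := boolP (j \in D); first by rewrite base_in // xD.
rewrite /base; have [->|ji0] := eqVneq i0 j; first by rewrite dfwithin subrr normr0.
have := bx j; rewrite dfwithout // /b /K (negPf jD) eq_sym (negPf ji0) mulr0 addr0.
by move=> /le_anti ->; rewrite subrr normr0.
Qed.

Lemma prism_cell_sub m : prism_cell m -> cell m `<=` prism.
Proof.
move=> [gm [i iD mi]] x cx; apply/prismP; split; first exact: cell_box cx.
have em : odd (m i) = false by case: mi => ->; rewrite ?(negPf (K_even i)).
have := (cellP b eta K_out x gm).1 cx i; rewrite em normr_le0 subr_eq0 => /eqP xi.
by exists i => //; rewrite xi /corner; case: mi => ->; [left; rewrite mulr0 addr0|right].
Qed.

Lemma prism_cell_face m m' : prism_cell m -> face m' m -> prism_cell m'.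
Proof.
move=> [gm [i iD mi]] fm; split; first exact: face_grid fm.
exists i => //; case: (fm i) => [->//|[om _]].
by case: mi om => ->; rewrite ?(negPf (K_even i)).
Qed.

Lemma prism_cover x : prism x -> exists2 m, prism_cell m & cell m x /\
  forall k, ~~ odd k -> x i0 = c i0 + eta * k%:R -> m i0 = k.
Proof.
move=> /prismP[bx [i iD xi]]; have [m gm [cm m_val]] := box_cell K_even K_out eta0 bx.
exists m; last by split=> // k ek xk; apply: m_val; rewrite // /b (negPf i0D).
split=> //; exists i => //; case: xi => xi; [left|right]; apply: m_val => //.
by rewrite mulr0 addr0.
Qed.

Lemma f_mesh_cell m x y t : prism_cell m -> cell m x -> cell m y ->
  `|f (base x) t - f (base y) t| < 4^-1.
Proof.
move=> pm cx cy; have [[bx _] [by' _]] := (prism_cell_sub pm cx, prism_cell_sub pm cy).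
apply: f_mesh => // i iD; rewrite !base_in //.
have := cx i; have := cy i; have := eta0; case: ifP => _; rewrite !ler_norml; lra.
Qed.

Definition star_cell m v := [/\ S v, ~ S0 v & forall x, cell m x -> f (base x) v != 0].

Definition kept_cell : set (nat -> nat) := [set m | prism_cell m /\
  (m i0 = 0%N \/ forall x t, cell m x -> f1 (base x) t != 0 -> S0 t)].

Definition carrier m : set T :=
  [set t | exists2 v, star_cell m v & link v t \/ m i0 = 1%N /\ t = v].

Lemma kept_cell_face m m' : kept_cell m -> face m' m -> kept_cell m'.
Proof.
move=> [pm km] fm; split; first exact: prism_cell_face fm.
case: km => [m0|km]; first by left; case: (fm i0) => [->//|[]]; rewrite m0.
by right=> x t cx; apply: km; apply: face_cell fm _ cx => //; case: pm.
Qed.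

Lemma height m : prism_cell m -> ~ kept_cell m -> m i0 = 1%N \/ m i0 = 2%N.
Proof.
move=> pm nkm; have [gm _] := pm; have m2 : (m i0 <= 2)%N.
  by have := gm i0; rewrite /K (negPf i0D) eqxx.
have m0 : m i0 <> 0%N by move=> m0; apply: nkm; split=> //; left.
by clear -m2 m0; lia.
Qed.

Lemma star_cell_ex m : prism_cell m -> ~ kept_cell m -> exists v, star_cell m v.
Proof.
move=> pm nkm.
have [x [v [cx fv nSv]]] : exists x v, [/\ cell m x, f1 (base x) v != 0 & ~ S0 v].
  apply: contrapT => none; apply: nkm; split=> //; right=> x t cx ft.
  by apply: contrapT => nSt; apply: none; exists x, t.
have [bx _] := prism_cell_sub pm cx.
exists v; split=> //; first by case: f1S => ts _ [/(_ _ bx)[_ _ + _ _] _]; apply.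
move=> y cy; have [_ /(_ nSv) fv_half] := f1_f bx fv.
have := f_mesh_cell v pm cx cy; rewrite ltr_norml => fxy.
by rewrite gt_eqF //; lra.
Qed.

Lemma star_cell_cmp m v x t : prism_cell m -> star_cell m v -> cell m x ->
  f (base x) t != 0 -> S t /\ cmp t v.
Proof.
move=> pm [_ _ fv] cx ft; have [bx _] := prism_cell_sub pm cx.
have [ts _ [/(_ _ bx)[_ _ fS' f_cmp _] _]] := fS.
by split; [exact: fS'|exact: f_cmp ft (fv x cx)].
Qed.

Lemma star_cell_eq m v v' : prism_cell m -> star_cell m v -> star_cell m v' -> v = v'.
Proof.
move=> pm sv sv'; have cm := corner_cell b (i0 :: D) eta0 m.
have [Sv nSv fv] := sv; have [Sv' nSv' fv'] := sv'.
by apply: new_eq => //; have [] := star_cell_cmp pm sv' cm (fv _ cm).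
Qed.

Lemma star_cell_face m m' v : prism_cell m -> star_cell m v -> face m' m -> star_cell m' v.
Proof.
move=> [gm _] [Sv nSv fv] fm; split=> // x cx.
by apply: fv; exact: (face_cell K_even K_out eta0 gm fm).
Qed.

Lemma carrierE m v : prism_cell m -> star_cell m v ->
  carrier m = [set t | link v t \/ m i0 = 1%N /\ t = v].
Proof.
move=> pm sv; apply/seteqP; split=> t; last by exists v.
by move=> [v' sv']; rewrite (star_cell_eq pm sv' sv).
Qed.

Lemma carrier_sub m : carrier m `<=` S.
Proof. by move=> t [v [Sv _ _]] [[/S0_sub]|[_ ->]]. Qed.

Lemma f1_base_flag_map : flag_map cmp S prism (f1 \o base).
Proof.
apply: flag_map_subst f1S; first by move=> x [].
by apply: continuous_subspaceT; exact: base_continuous.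
Qed.

Lemma f1_base_carried m m' : prism_cell m -> ~ kept_cell m -> face m' m -> kept_cell m' ->
  flag_map cmp (carrier m) (cell m') (f1 \o base).
Proof.
move=> pm nkm fm [pm' km']; have [v sv] := star_cell_ex pm nkm; rewrite (carrierE pm sv).
apply: flag_map_sub f1_base_flag_map; first exact: prism_cell_sub.
move=> x t cx ft _; have cmx := face_cell K_even K_out eta0 (proj1 pm) fm cx.
have [bx _] := prism_cell_sub pm cmx.
have [St tv] := star_cell_cmp pm sv cmx (proj1 (f1_f bx ft)).
have [S0t|nS0t] := pselect (S0 t); first by left.
have [Sv nSv _] := sv; have t_v : t = v by exact: new_eq.
case: (height pm nkm) => m_i0; first by right.
case: km' => [m'0|km']; last by case: nS0t; exact: km' ft.
by case: (fm i0); rewrite m_i0 m'0 // => -[].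
Qed.

Lemma carrier_face m m' : prism_cell m -> ~ kept_cell m -> face m' m -> carrier m' `<=` carrier m.
Proof.
move=> pm nkm fm; have [v sv] := star_cell_ex pm nkm.
rewrite (carrierE pm sv) (carrierE (prism_cell_face pm fm) (star_cell_face pm sv fm)).
move=> t [|[m'1 ->]]; [by left|right; split=> //].
by case: (height pm nkm) => // m2; case: (fm i0); rewrite m'1 m2 // => -[].
Qed.

Hypothesis link_fillable : forall v j, S v -> ~ S0 v -> (j < size D)%N -> fillable R cmp j (link v).

Lemma carrier_fillable m : prism_cell m -> ~ kept_cell m ->
  fillable R cmp (size (free (i0 :: D) m)) (carrier m).
Proof.
move=> pm nkm; have [v sv] := star_cell_ex pm nkm; rewrite (carrierE pm sv).
case: (height pm nkm) => m_i0.
  apply: (cone_fillable cmpxx cmpC (v := v)); first by right.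
  by move=> t [[]//|[_ ->]].
have -> : [set t | link v t \/ m i0 = 1%N /\ t = v] = link v.
  by apply/seteqP; split=> t; [case=> // -[]; rewrite m_i0|left].
have [Sv nSv _] := sv; apply: link_fillable => //.
have [_ [i iD mi]] := pm; rewrite size_filter /= m_i0 add0n ltn_neqAle count_size andbT.
rewrite -all_count; apply/allPn; exists i => //.
by case: mi => ->; rewrite ?(negPf (K_even i)).
Qed.

Lemma prism_extension : exists2 g, flag_map cmp S prism g &
  flag_map cmp S0 (prism `&` [set x | x i0 = c i0 + 2 * eta]) g /\
  forall x, prism x -> x i0 = c i0 -> g x = f1 (base x).
Proof.
have kept_sub : kept_cell `<=` prism_cell by move=> m [].
have cell_grid : prism_cell `<=` grid by move=> m [].
have [g g_kept g_new] := carrier_extension K_even K_out eta0 uniq_i0D cell_grid kept_sub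
  prism_cell_face kept_cell_face carrier_fillable f1_base_carried
  (fun m m' pm nkm fm _ => carrier_face pm nkm fm).
have [s s_grid] := grid_finite K_out.
have g_cell m : prism_cell m -> flag_map cmp S (cell m) g.
  move=> pm; have [km|nkm] := pselect (kept_cell m).
    apply: (@eq_flag_map _ _ _ _ _ _ (f1 \o base)) => [x cx|]; first by rewrite (g_kept m).
    by apply: flag_map_subX f1_base_flag_map; exact: prism_cell_sub.
  exact: flag_map_subS (@carrier_sub m) (g_new m pm nkm).
have g_top_cell m : prism_cell m -> m i0 = 2%N -> flag_map cmp S0 (cell m) g.
  move=> pm m_i0; have [km|nkm] := pselect (kept_cell m).
    apply: flag_map_sub (g_cell m pm) => // x t cx; rewrite (g_kept m) // => ft _.
    by case: km => _ [|km]; [rewrite m_i0|exact: km ft].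
  apply: flag_map_subS (g_new m pm nkm) => t [v _ [[]//|[]]].
  by rewrite m_i0.
exists g; last split.
- apply: (@flag_map_cover _ _ _ _ _ _ _ [seq m <- s | `[< prism_cell m >]] (fun m => cell m)).
  + move=> x /prism_cover[m pm [cx _]]; exists m => //; rewrite mem_filter s_grid ?andbT //.
      exact/asboolP.
    by case: pm.
  + by move=> m _; exact: closed_cube.
  + by move=> m; rewrite mem_filter => /andP[/asboolP pm _]; exact: g_cell.
- apply: (@flag_map_cover _ _ _ _ _ _ _ [seq m <- s | `[< prism_cell m /\ m i0 = 2%N >]]
    (fun m => cell m)).
  + move=> x [/prism_cover[m pm [cx m_val]] xi0]; exists m => //; rewrite mem_filter s_grid ?andbT.
      by apply/asboolP; split=> //; apply: m_val => //; rewrite xi0 mulrC.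
    by case: pm.
  + by move=> m _; exact: closed_cube.
  + by move=> m; rewrite mem_filter => /andP[/asboolP[pm m_i0] _]; exact: g_top_cell.
- move=> x /prism_cover[m pm [cx m_val]] xi0; rewrite (g_kept m) //; split=> //; left.
  by apply: m_val => //; rewrite mulr0 addr0.
Qed.

Definition lift_prism (xs : point * R) : point := dfwith xs.1 i0 (c i0 + 2 * eta * xs.2).

Lemma base_lift_prism x s : bd x -> base (lift_prism (x, s)) = x.
Proof.
move=> [cx _]; apply: funext => i; rewrite /base /lift_prism.
have [->|ii0] := eqVneq i i0; first by rewrite dfwithin (cube_out cx).
by rewrite !dfwithout // eq_sym.
Qed.

Lemma lift_prism_continuous : continuous lift_prism.
Proof.
apply: continuous_ptws => i; have [->|ii0] := eqVneq i i0.
  have -> : (fun xs => lift_prism xs i0) = (fun xs : point * R => c i0 + 2 * eta * xs.2).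
    by apply: funext => xs; rewrite /lift_prism dfwithin.
  have c_cst (r : R) : continuous (cst r : point * R -> R) by exact: cst_continuous.
  have c_snd : continuous (snd : point * R -> R) by move=> xs; exact: cvg_snd.
  move=> xs; have c_mul := continuousM (c_cst (2 * eta) xs) (c_snd xs).
  exact: (continuousD (c_cst (c i0) xs) c_mul).
have -> : (fun xs => lift_prism xs i) = (fun x : point => x i) \o fst.
  by apply: funext => xs; rewrite /lift_prism /= dfwithout // eq_sym.
move=> xs; apply: continuous_comp; first exact: cvg_fst.
exact: coord_ptws_continuous.
Qed.

Lemma lift_prism_in x s : bd x -> 0 <= s <= 1 -> prism (lift_prism (x, s)).
Proof.
move=> bx /andP[s0 s1]; split; first by rewrite base_lift_prism.
rewrite /lift_prism dfwithin /=; have := eta0 => e0.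
have : 0 <= eta * s by rewrite mulr_ge0 // ltW.
have : eta * s <= eta * 1 by rewrite ler_pM2l.
lra.
Qed.

Lemma pushed_extendable : fillable R cmp (size D) S0 -> extendable cmp S D c rho f1.
Proof.
move=> S0_fillable; have [g gS [g_top g_bottom]] := prism_extension.
have lift_top x : bd x -> lift_prism (x, 1) i0 = c i0 + 2 * eta.
  by move=> bx; rewrite /lift_prism dfwithin /= mulr1.
have [|g0 g0S g0_top] := S0_fillable D c rho (fun x => g (lift_prism (x, 1))) uniq_D erefl rho0.
  apply: (@flag_map_subst _ _ _ _ _ _ _ _ (fun x => lift_prism (x, 1))) g_top.
    by move=> x bx; split; [apply: lift_prism_in; rewrite ?ler01 ?lexx|exact: lift_top].
  apply: continuous_subspaceT => x; apply: continuous_comp; last exact: lift_prism_continuous.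
  by apply: continuous_pair => y; [exact: cvg_id|exact: cst_continuous].
apply: (homotopy_extendable (h := g \o lift_prism) rho0).
- apply: flag_map_subst gS; last by apply: continuous_subspaceT; exact: lift_prism_continuous.
  by move=> [x s] [/= bx]; rewrite in_itv; exact: lift_prism_in.
- move=> x bx; rewrite /= g_bottom ?base_lift_prism //.
    by apply: lift_prism_in; rewrite // lexx ler01.
  by rewrite /lift_prism dfwithin /= mulr0 addr0.
- by move=> x _; reflexivity.
- by exists g0 => //; exact: flag_map_subS g0S.
Qed.

End AttachPushed.

Lemma fine_mesh (D : seq nat) (c : point) (rho : R) (f : point -> T -> R) : 0 < rho ->
  flag_map cmp S (cube_boundary D c rho) f -> exists2 n, (0 < n)%N &
    forall x y t, cube_boundary D c rho x -> cube_boundary D c rho y ->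
      (forall i, i \in D -> `|x i - y i| <= 2 * (rho / n%:R)) -> `|f x t - f y t| < 4^-1.
Proof.
move=> rho0 [ts _ [fS cf]].
have out x y i : cube_boundary D c rho x -> cube_boundary D c rho y -> i \notin D -> x i = y i.
  by move=> [cx _] [cy _] iD; rewrite (cube_out cx) ?(cube_out cy).
have quarter : 0 < 4^-1 :> R by rewrite invr_gt0.
have near_d := filter_all_seq (at_right_proper_filter (0 : R)) (fun t (_ : t \in ts) =>
  compact_unif_continuous (cube_boundary_compact rho0) out (cf t) quarter).
have [d [d_mesh d0]] := filter_ex (filterI near_d (nbhs_right_gt (0 : R))).
have rd0 : 0 < 2 * rho / d by rewrite divr_gt0 // mulr_gt0.
have bound_lt := archi_boundP (ltW rd0); set n := Num.bound _ in bound_lt.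
have n0 : 0 < n%:R :> R by apply: lt_trans bound_lt.
exists n => [|x y t bx by' xy]; first by rewrite -(ltr_nat R).
have [tts|tts] := boolP (t \in ts).
  apply: d_mesh => // i iD; apply: le_lt_trans (xy i iD) _.
  by rewrite mulrA ltr_pdivrMr // [d * _]mulrC -ltr_pdivrMr.
have [[_ -> // _ _ _] [_ -> // _ _ _]] := (fS _ bx, fS _ by').
by rewrite subrr normr0.
Qed.

Lemma attach_fillable N :
  (forall v j, S v -> ~ S0 v -> (j < N)%N -> fillable R cmp j (link v)) ->
  fillable R cmp N S0 -> fillable R cmp N S.
Proof.
move=> link_fillable S0_fillable D c rho f uniq_D sD rho0 fS.
rewrite -sD in link_fillable S0_fillable.
have [f1 f1S f1_f] := push_off fS.
have [n n0 f_mesh] := fine_mesh rho0 fS.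
have [i0 i0D] : exists i, i \notin D.
  exists (\max_(i <- D) i).+1; apply/negP => h.
  by have := @leq_bigmax_seq _ D xpredT id _ h isT; rewrite ltnn.
have f1_ext := pushed_extendable uniq_D rho0 i0D n0 fS f1S f1_f f_mesh link_fillable S0_fillable.
apply: (linear_homotopy_extendable cmpC rho0 fS f1S _ f1_ext) => x s t bx fs f1t.
by have [ts _ [/(_ _ bx)[_ _ _ f_cmp _] _]] := fS; apply: f_cmp fs _; have [] := f1_f x t bx f1t.
Qed.

End Attach.

(** * Constructible posets *)

Section Constructible.
Variables (T : eqType) (cmp : rel T).
Hypotheses (cmpxx : reflexive cmp) (cmpC : symmetric cmp).
Implicit Types (S : set T).

(* [constructible N S] certifies that the flag complex of [S] is [(N - 2)]-connected; when [S]
   is spherical, [N] is the number of elements of a maximal chain. *)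
Inductive constructible : nat -> set T -> Prop :=
| constructible0 S : constructible 0 S
| constructible_cone N S v : S v -> (forall s, S s -> cmp s v) -> constructible N S
| constructible_attach N S0 S : S0 `<=` S ->
    (forall u v, S u -> S v -> ~ S0 u -> ~ S0 v -> cmp u v -> u = v) ->
    constructible N S0 ->
    (forall v, S v -> ~ S0 v -> constructible N.-1 (link cmp S0 v)) -> constructible N S.

Lemma constructible_fillable (R : realType) N S : constructible N S ->
  forall j, (j < N)%N -> fillable R cmp j S.
Proof.
elim=> {N S} [//|N S v Sv v_cone j _|N S0 S S0_sub new_eq _ IH0 _ IHlink j jN].
  exact: (cone_fillable cmpxx cmpC Sv v_cone).
apply: (attach_fillable cmpxx cmpC S0_sub new_eq); last exact: IH0.
by move=> v i Sv nSv ij; apply: IHlink => //; lia.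
Qed.

Lemma constructibleW N N' S : (N' <= N)%N -> constructible N S -> constructible N' S.
Proof.
move=> NN' cS; elim: cS N' NN' => {N S} [S|N S v Sv v_cone|N S0 S sub new_eq _ IH0 _ IHlink] N' NN'.
- by move: NN'; rewrite leqn0 => /eqP ->; exact: constructible0.
- exact: constructible_cone Sv v_cone.
- apply: (constructible_attach sub new_eq); first exact: IH0.
  by move=> v Sv nSv; apply: IHlink => //; lia.
Qed.

Lemma constructible_inhabited N S : constructible N.+1 S -> exists t, S t.
Proof.
move: {-1}N.+1 (erefl N.+1) => n nN cS.
elim: cS nN => {n S} // [n S v Sv _ _|n S0 S sub _ _ IH _ _ e].
  by exists v.
by have [v /sub] := IH e; exists v.
Qed.

Lemma constructible_attach_rank N S0 S (r : T -> nat) (B : nat) : S0 `<=` S ->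
  (forall u v, S u -> S v -> cmp u v -> r u = r v -> u = v) ->
  (forall s, S s -> (r s <= B)%N) -> constructible N S0 ->
  (forall v, S v -> ~ S0 v ->
     constructible N.-1 [set s | [/\ S s, S0 s \/ (r s < r v)%N & cmp s v]]) ->
  constructible N S.
Proof.
move=> sub r_inj rB cS0 clink.
suff below b : constructible N [set s | S s /\ (S0 s \/ (r s < b)%N)].
  have -> : S = [set s | S s /\ (S0 s \/ (r s < B.+1)%N)]; last exact: below.
  by apply/seteqP; split=> [s Ss|s []//]; split=> //; right; exact: rB.
elim: b => [|b IH].
  have -> : [set s | S s /\ (S0 s \/ (r s < 0)%N)] = S0; last exact: cS0.
  by apply/seteqP; split=> [s [_ []]//|s S0s]; split; [exact: sub|left].
have new v : S v /\ (S0 v \/ (r v < b.+1)%N) -> ~ (S v /\ (S0 v \/ (r v < b)%N)) ->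
    [/\ S v, ~ S0 v & r v = b].
  move=> [Sv r_v] nv; have nS0v : ~ S0 v by move=> S0v; apply: nv; split=> //; left.
  split=> //; apply/eqP; rewrite eqn_leq; apply/andP; split; first by case: r_v.
  by rewrite leqNgt; apply/negP => rvb; apply: nv; split=> //; right.
apply: constructible_attach IH _.
- by move=> s [Ss h]; split=> //; case: h => [|h]; [left|right; lia].
- move=> u v Su Sv nu nv uv; have [Su' _ ru] := new u Su nu; have [Sv' _ rv] := new v Sv nv.
  by apply: r_inj; rewrite // ru.
- move=> v Sv nv; have [Sv' nS0v rv] := new v Sv nv; have := clink v Sv' nS0v; rewrite rv.
  by congr constructible; apply/seteqP; split=> s; [move=> []|move=> [[]]].
Qed.

Section Join.
Variables (r : T -> nat) (B : nat).
Hypotheses (r_bound : forall x, (r x <= B)%N) (r_inj : forall x y, cmp x y -> r x = r y -> x = y).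

Lemma constructible_join_any N (A A' : set T) : (forall x y, A x -> A' y -> cmp x y) ->
  constructible N A' -> constructible N (A `|` A').
Proof.
move=> AA' cA'.
suff bounded n : forall A : set T, (forall x y, A x -> A' y -> cmp x y) ->
    (forall x, A x -> (r x < n)%N) -> constructible N (A `|` A').
  by apply: (bounded B.+1) => // x _; exact: r_bound.
elim: n => [|n IH] {AA'} {}A AA' rA.
  have -> : A `|` A' = A'; last by [].
  by apply/seteqP; split=> x; [case=> // /rA|right].
apply: (@constructible_attach_rank N A' _ r B) => //; first by move=> u v _ _; exact: r_inj.
move=> v [Av|//] nv; apply: (constructibleW (leq_pred N)).
have -> : [set s | [/\ (A `|` A') s, A' s \/ (r s < r v)%N & cmp s v]] =
    [set s | [/\ A s, (r s < r v)%N & cmp s v]] `|` A'.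
  apply/seteqP; split=> s /=.
    by move=> [[As|As] h c]; [case: h => h; [right|left]|right].
  move=> [[As h c]|As]; first by split=> //; [left|right].
  by split; [right|left|rewrite cmpC; exact: AA'].
apply: IH; first by move=> x y [Ax _ _]; exact: AA'.
by move=> x [_ h _]; apply: leq_trans h _; rewrite -ltnS rA.
Qed.

Lemma constructible_join N N' (A A' : set T) : (forall x y, A x -> A' y -> cmp x y) ->
  constructible N A -> constructible N' A' -> constructible (N + N') (A `|` A').
Proof.
move=> AA' cA cA'; elim: cA AA' => {N A} [A|N A v Av v_cone|N A0 A sub new_eq _ IH0 _ IHlink] AA'.
- exact: constructible_join_any.
- apply: (@constructible_cone _ _ v); first by left.
  by move=> s [/v_cone//|A's]; rewrite cmpC; exact: AA'.
apply: (@constructible_attach _ (A0 `|` A')).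
- by move=> x [/sub|]; [left|right].
- move=> u v [Au|Au] [Av|Av] nu nv; try by [case: nu; right|case: nv; right].
  by apply: new_eq => // h; [apply: nu|apply: nv]; left.
- by apply: IH0 => x y /sub; exact: AA'.
move=> v [Av|Av] nv; last by case: nv; right.
have nA0v : ~ A0 v by move=> A0v; apply: nv; left.
have -> : link cmp (A0 `|` A') v = link cmp A0 v `|` A'.
  apply/seteqP; split=> s /=; first by move=> [[As|As] c]; [left|right].
  by move=> [[As c]|As]; split; [left| |right|rewrite cmpC; exact: AA'].
apply: (constructibleW _ (IHlink v Av nA0v _)); first by lia.
by move=> x y [/sub Ax _]; exact: AA'.
Qed.

End Join.

End Constructible.

Definition comparable (T : Type) (le : rel T) : rel T := fun x y => le x y || le y x.

Definition opposite_rel (T : Type) (le : rel T) : rel T := fun x y => le y x.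

Lemma comparablexx (T : Type) (le : rel T) : reflexive le -> reflexive (comparable le).
Proof. by move=> refl x; rewrite /comparable refl. Qed.

Lemma comparableC (T : Type) (le : rel T) : symmetric (comparable le).
Proof. by move=> x y; rewrite /comparable orbC. Qed.

Lemma comparable_opposite (T : Type) (le : rel T) : comparable (opposite_rel le) = comparable le.
Proof. by apply/funext => x; apply/funext => y; rewrite /comparable orbC. Qed.

Lemma plt_trans (T : eqType) (le : rel T) :
  transitive le -> antisymmetric le -> transitive (plt le).
Proof.
move=> trans anti y x z /andP[xy x_neq_y] /andP[yz y_neq_z]; rewrite /plt (trans _ _ _ xy yz) /=.
by apply: contraNneq x_neq_y => xz; apply/eqP/anti; rewrite xy xz.
Qed.

Definition ranked (T : eqType) (le : rel T) (rk : T -> nat) (B : nat) :=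
  [/\ reflexive le, transitive le, antisymmetric le,
      forall x y, plt le x y -> (rk x < rk y)%N & forall x, (rk x <= B)%N].

Lemma ranked_opposite (T : eqType) (le : rel T) (rk : T -> nat) B : ranked le rk B ->
  ranked (opposite_rel le) (fun x => B - rk x)%N B.
Proof.
move=> [refl trans anti rk_lt rkB]; split=> //.
- by move=> y x z xy yz; exact: trans yz xy.
- by move=> x y; rewrite andbC; exact: anti.
- by move=> x y; rewrite /plt eq_sym => /rk_lt; have := rkB x; have := rkB y; lia.
- by move=> x; exact: leq_subr.
Qed.

Section RankedPoset.
Variables (T : eqType) (le : rel T) (rk : T -> nat) (B : nat).
Hypothesis ranked_le : ranked le rk B.
Implicit Types (S : set T) (x y v : T) (phi : T -> T).

Lemma ranked_plt_trans : transitive (plt le).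
Proof. by have [_ trans anti _ _] := ranked_le; exact: plt_trans. Qed.

Lemma comparable_rank_inj x y : comparable le x y -> rk x = rk y -> x = y.
Proof.
have [_ _ _ rk_lt _] := ranked_le.
move=> /orP[] xy rk_xy; apply: contrapT => /eqP x_neq_y.
  by have := rk_lt x y; rewrite /plt xy x_neq_y rk_xy ltnn => /(_ isT).
by have := rk_lt y x; rewrite /plt xy eq_sym x_neq_y rk_xy ltnn => /(_ isT).
Qed.

Lemma constructible_bottom N S v : S v -> (forall x, S x -> le v x) ->
  constructible (comparable le) N S.
Proof.
by move=> Sv lev; apply: constructible_cone Sv _ => x /lev; rewrite /comparable orbC => ->.
Qed.

Lemma constructible_top N S v : S v -> (forall x, S x -> le x v) ->
  constructible (comparable le) N S.
Proof. by move=> Sv lev; apply: constructible_cone Sv _ => x /lev; rewrite /comparable => ->. Qed.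

Lemma constructible_attach_increasing N S0 S : S0 `<=` S -> constructible (comparable le) N S0 ->
  (forall v, S v -> ~ S0 v -> exists a b, [/\ (N.-1 <= a + b)%N,
     constructible (comparable le) a [set x | S x /\ plt le x v] &
     constructible (comparable le) b [set x | S0 x /\ plt le v x]]) ->
  constructible (comparable le) N S.
Proof.
have [_ trans _ rk_lt rkB] := ranked_le; move=> sub cS0 clink.
apply: (@constructible_attach_rank _ _ N S0 S rk B) => // [x y _ _|v Sv nS0v].
  exact: comparable_rank_inj.
have [a [b [ab ca cb]]] := clink v Sv nS0v; apply: (constructibleW ab).
have -> : [set x | [/\ S x, S0 x \/ (rk x < rk v)%N & comparable le x v]] =
    [set x | S x /\ plt le x v] `|` [set x | S0 x /\ plt le v x].
  apply/seteqP; split=> x /=.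
    move=> [Sx hx c]; have x_neq_v : x != v.
      by apply/eqP => e; case: hx; rewrite e ?ltnn.
    case/orP: c => xv; first by left; rewrite /plt xv.
    have vx : plt le v x by rewrite /plt xv eq_sym.
    by right; split=> //; case: hx => //; have := rk_lt _ _ vx; lia.
  move=> [[Sx xv]|[S0x vx]].
    by split=> //; [right; exact: rk_lt|rewrite /comparable; case/andP: xv => ->].
  by split; [exact: sub|left|rewrite /comparable; case/andP: vx => ->; rewrite orbT].
apply: (constructible_join (@comparableC _ le) rkB comparable_rank_inj _ ca cb).
move=> x y [_ /andP[xv _]] [_ /andP[vy _]].
by rewrite /comparable (trans _ _ _ xv vy).
Qed.

(* The elements below [v] form a cone; any other [x] is added along [[set y | y < x]], which
   again contracts conically, to [phi x]. *)
Lemma constructible_conical_down N S v phi : S v ->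
  (forall x, S x -> [/\ S (phi x), le (phi x) x & le (phi x) v]) ->
  (forall x y, S x -> S y -> le x y -> le (phi x) (phi y)) ->
  constructible (comparable le) N S.
Proof.
have [refl trans anti rk_lt rkB] := ranked_le.
have bounded n : forall S v, (forall x, S x -> (rk x < n)%N) -> S v ->
    (forall x, S x -> [/\ S (phi x), le (phi x) x & le (phi x) v]) ->
    (forall x y, S x -> S y -> le x y -> le (phi x) (phi y)) ->
    constructible (comparable le) N S.
  elim: n => [|n IH] {}S {}v rkS Sv phiP phi_mono; first by have := rkS v Sv.
  apply: (@constructible_attach_increasing _ [set x | S x /\ le x v]) => [x []//||x Sx nxv].
    by apply: (@constructible_top _ _ v) => // x [].
  have [Sphix phix_x phix_v] := phiP x Sx.
  exists N, 0%N; split; [by rewrite addn0 leq_pred| |exact: constructible0].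
  apply: (IH _ (phi x)).
  - by move=> y [Sy /rk_lt yx]; apply: leq_trans yx _; rewrite -ltnS rkS.
  - by split=> //; rewrite /plt phix_x; apply/eqP => e; apply: nxv; rewrite -e.
  - move=> y [Sy /andP[yx y_neq_x]]; have [Sphiy phiy_y _] := phiP y Sy.
    split=> //; last exact: phi_mono.
    split=> //; rewrite /plt (trans _ _ _ phiy_y yx); apply: contraNneq y_neq_x => e.
    by apply/eqP/anti; rewrite yx -e phiy_y.
  - by move=> y z [Sy _] [Sz _]; exact: phi_mono.
by move=> Sv; apply: (bounded B.+1) => // x _; rewrite ltnS.
Qed.

Lemma constructible_retract_down N S phi :
  (forall x, S x -> S (phi x) /\ le (phi x) x) ->
  (forall x y, S x -> S y -> le x y -> le (phi x) (phi y)) ->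
  constructible (comparable le) N [set x | S x /\ phi x = x] -> constructible (comparable le) N S.
Proof.
have [_ trans anti _ _] := ranked_le; move=> phiP phi_mono.
move/constructible_attach_increasing; apply=> [x []//|v Sv nfix].
have [Sphiv phiv_v] := phiP v Sv.
exists N, 0%N; split; [by rewrite addn0 leq_pred| |exact: constructible0].
apply: (@constructible_conical_down _ _ (phi v) phi).
- by split=> //; rewrite /plt phiv_v; apply/eqP => e; apply: nfix.
- move=> x [Sx /andP[xv x_neq_v]]; have [Sphix phix_x] := phiP x Sx.
  split=> //; last exact: phi_mono.
  split=> //; rewrite /plt (trans _ _ _ phix_x xv); apply: contraNneq x_neq_v => e.
  by apply/eqP/anti; rewrite xv -e phix_x.
- by move=> x y [Sx _] [Sy _]; exact: phi_mono.
Qed.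

End RankedPoset.

Section RankedPosetUp.
Variables (T : eqType) (le : rel T) (rk : T -> nat) (B : nat).
Hypothesis ranked_le : ranked le rk B.
Implicit Types (S : set T) (x y v : T) (phi : T -> T).

Let plt_opposite x y : plt (opposite_rel le) x y = plt le y x.
Proof. by rewrite /plt eq_sym. Qed.

Lemma constructible_attach_decreasing N S0 S : S0 `<=` S -> constructible (comparable le) N S0 ->
  (forall v, S v -> ~ S0 v -> exists a b, [/\ (N.-1 <= a + b)%N,
     constructible (comparable le) a [set x | S0 x /\ plt le x v] &
     constructible (comparable le) b [set x | S x /\ plt le v x]]) ->
  constructible (comparable le) N S.
Proof.
rewrite -comparable_opposite => sub cS0 clink.
apply: (constructible_attach_increasing (ranked_opposite ranked_le) sub cS0) => v Sv nS0v.
have [a [b [ab ca cb]]] := clink v Sv nS0v; exists b, a; rewrite addnC; split=> //.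
  by under eq_set do rewrite plt_opposite.
by under eq_set do rewrite plt_opposite.
Qed.

Lemma constructible_retract_up N S phi :
  (forall x, S x -> S (phi x) /\ le x (phi x)) ->
  (forall x y, S x -> S y -> le x y -> le (phi x) (phi y)) ->
  constructible (comparable le) N [set x | S x /\ phi x = x] -> constructible (comparable le) N S.
Proof.
rewrite -comparable_opposite => phiP phi_mono.
apply: (constructible_retract_down (ranked_opposite ranked_le)) => // x y Sx Sy.
exact: phi_mono.
Qed.

End RankedPosetUp.

(** * Spheres in the realization of a poset *)

Section Realization.
Variables (T : eqType) (le : rel T).
Hypotheses (refl_le : reflexive le) (trans_le : transitive le) (anti_le : antisymmetric le).
Implicit Types (S : set T) (c ts : seq T) (a : T -> RR) (O : set (T -> RR)).

Lemma chain_uniq S c : is_chain le S c -> uniq c.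
Proof.
move=> [c_sorted _]; apply: sorted_uniq c_sorted; first exact: plt_trans.
by move=> x; rewrite /plt eqxx andbF.
Qed.

Lemma chain_comparable S c x y : is_chain le S c -> x \in c -> y \in c -> comparable le x y.
Proof.
move=> [c_sorted _]; elim: c c_sorted => // t c IH /= t_c.
have t_lt := order_path_min (plt_trans trans_le anti_le) t_c.
rewrite !inE => /predU1P[->|xc] /predU1P[->|yc]; first by rewrite /comparable refl_le.
- by move/allP: t_lt => /(_ _ yc)/andP[ty _]; rewrite /comparable ty.
- by move/allP: t_lt => /(_ _ xc)/andP[tx _]; rewrite /comparable tx orbT.
- by apply: IH => //; exact: path_sorted t_c.
Qed.

Lemma sort_is_chain S c : uniq c -> (forall t, t \in c -> S t) ->
  (forall s t, s \in c -> t \in c -> comparable le s t) -> is_chain le S (sort le c).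
Proof.
move=> c_uniq cS c_cmp; split; last by move=> t; rewrite mem_sort; exact: cS.
have c_sorted : sorted le (sort le c).
  apply: (@sort_sorted_in _ (mem c)) => [s t sc tc|]; first exact: c_cmp.
  exact/allP.
rewrite (sorted_pairwise (plt_trans trans_le anti_le)).
rewrite -[pairwise _ _]/(pairwise [rel x y | le x y && (x != y)] (sort le c)).
by rewrite pairwise_relI -uniq_pairwise sort_uniq c_uniq andbT -(sorted_pairwise trans_le).
Qed.

Definition supp_chain ts a := sort le [seq t <- ts | a t != 0].

Lemma mem_supp_chain S ts a t : flag_point (comparable le) S ts a ->
  (t \in supp_chain ts a) = (a t != 0).
Proof.
move=> [_ a_out _ _ _]; rewrite mem_sort mem_filter andb_idr //.
by apply: contraNT => /a_out ->.
Qed.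

Lemma supp_chain_is_chain S ts a : uniq ts -> flag_point (comparable le) S ts a ->
  is_chain le S (supp_chain ts a).
Proof.
move=> uts [_ _ aS a_cmp _]; apply: sort_is_chain; first exact: filter_uniq.
  by move=> t; rewrite mem_filter => /andP[/aS].
by move=> s t; rewrite !mem_filter => /andP[s0 _] /andP[t0 _]; exact: a_cmp.
Qed.

Lemma flag_point_sum S ts c a : uniq ts -> uniq c -> flag_point (comparable le) S ts a ->
  (forall t, t \notin c -> a t = 0) -> \sum_(t <- c) a t = 1.
Proof.
move=> uts uc [_ a_out _ _ <-] a_outc.
rewrite -[LHS](@sum_supported _ _ c (undup (c ++ ts))) ?undup_uniq // => [|t tc].
  apply: sum_supported; rewrite ?undup_uniq // => t tts.
  by rewrite mem_undup mem_cat tts orbT.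
by rewrite mem_undup mem_cat tc.
Qed.

Lemma flag_point_realization S ts a : uniq ts -> flag_point (comparable le) S ts a ->
  realization le S a.
Proof.
move=> uts aS; have c_chain := supp_chain_is_chain uts aS; have a_mem := mem_supp_chain _ aS.
have a_out t : t \notin supp_chain ts a -> a t = 0 by rewrite a_mem negbK => /eqP.
exists (supp_chain ts a); split=> //; first by case: aS.
exact: flag_point_sum uts (chain_uniq c_chain) aS a_out.
Qed.

Lemma realization_flag_point S a : realization le S a ->
  exists2 ts, uniq ts & flag_point (comparable le) S ts a.
Proof.
move=> [c [c_chain a_out a_ge0 a1]]; exists c; first exact: chain_uniq c_chain.
have mem_c t : a t != 0 -> t \in c by apply: contraNT => /a_out ->.
split=> //; first by move=> t /mem_c; exact: (proj2 c_chain).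
by move=> s t /mem_c sc /mem_c; exact: chain_comparable c_chain _.
Qed.

Definition barycentric c a : 'rV[RR]_(size c) := \row_(i < size c) a (tnth (in_tuple c) i).

Lemma bary_barycentric c a : uniq c -> (forall t, t \notin c -> a t = 0) ->
  bary (barycentric c a) = a.
Proof.
move=> c_uniq a_out; apply/funext => t; rewrite /bary.
rewrite (eq_bigr (fun i => a (tnth (in_tuple c) i))); last by move=> i _; rewrite mxE.
rewrite (eq_bigl (fun i => tnth (in_tuple c) i == t)); last by move=> i; rewrite (tnth_nth t).
rewrite -(big_tnth _ _ c (fun s => s == t)) /=; have [tc|tc] := boolP (t \in c); last first.
  by rewrite a_out // big_seq_cond big1 // => s /andP[sc /eqP e]; rewrite e (negPf tc) in sc.
rewrite (big_rem t) //= eqxx big_seq_cond big1 ?addr0 // => s /andP[].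
by rewrite mem_rem_uniq // inE => /andP[/negPf->].
Qed.

Lemma barycentric_simplex S ts c a : uniq ts -> uniq c -> flag_point (comparable le) S ts a ->
  (forall t, t \notin c -> a t = 0) -> std_simplex (barycentric c a).
Proof.
move=> uts uc aS a_out; split=> [i|]; first by rewrite mxE; case: aS.
rewrite -(flag_point_sum uts uc aS a_out) [RHS]big_tnth.
by apply: eq_bigr => i _; rewrite mxE.
Qed.

Lemma bary_continuous c t : continuous (fun l : 'rV[RR]_(size c) => bary l t).
Proof.
exact: (@continuous_sum_coord RR).
Qed.

Lemma coh_open_coord S t (A : set RR) : open A -> coh_open le S [set a | A (a t)].
Proof.
move=> oA c _; exists ((fun l => bary l t) @^-1` A); split=> //.
by apply: open_comp => // l _; exact: bary_continuous.
Qed.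

Section Maps.
Variables (m : nat) (K : set 'rV[RR]_m) (f : 'rV[RR]_m -> T -> RR).

Lemma cont_into_coord S t : cont_into le S K f -> {within K, continuous (f^~ t)}.
Proof.
move=> [_ f_open]; apply/continuousP => A oA; apply/open_subspaceP.
have [V [oV eV]] := f_open _ (@coh_open_coord S t A oA).
by exists V => //; rewrite setIC -eV setIC.
Qed.

Lemma coh_open_near_cell S ts x O c : uniq ts ->
  (forall y, K y -> flag_point (comparable le) S ts (f y)) ->
  (forall t, {within K, continuous (f^~ t)}) -> coh_open le S O -> K x -> O (f x) ->
  \forall y \near within K (nbhs x), supp_chain ts (f y) = c -> O (f y).
Proof.
move=> uts fS cf oO Kx Ox.
have near_K : \forall y \near within K (nbhs x), K y by exact: withinT.
have [c_chain|nchain] := pselect (is_chain le S c); last first.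
  apply: filterS near_K => y Ky ec; case: nchain; rewrite -ec.
  exact: supp_chain_is_chain (fS y Ky).
have [[t fxt tc]|fx_out] := pselect (exists2 t, f x t != 0 & t \notin c).
  have near_t := within_continuous_near_neq0 (cf t) Kx fxt.
  apply: filterS2 near_K near_t => y Ky fyt ec; move: tc.
  by rewrite -ec (mem_supp_chain t (fS y Ky)) fyt.
have fx_out' t : t \notin c -> f x t = 0.
  by move=> tc; apply: contrapT => /eqP fxt; apply: fx_out; exists t.
have c_uniq := chain_uniq c_chain; have [V [oV eV]] := oO c c_chain.
have Vx : V (barycentric c (f x)).
  suff : (@std_simplex (size c) `&` (@bary _ c @^-1` O)) (barycentric c (f x)) by rewrite eV => -[].
  by split; [exact: barycentric_simplex uts c_uniq (fS x Kx) _|rewrite /= bary_barycentric].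
have c_bary : {within K, continuous (fun y => barycentric c (f y))}.
  apply: (@continuous_row RR (subspace K)) => i.
  have -> : (fun y => barycentric c (f y) ord0 i) = f^~ (tnth (in_tuple c) i).
    by apply/funext => y; rewrite mxE.
  exact: cf.
have near_V : \forall y \near within K (nbhs x), V (barycentric c (f y)).
  exact: ((subspace_continuousP _ _).1 c_bary x Kx _ (open_nbhs_nbhs (conj oV Vx))).
apply: filterS2 near_K near_V => y Ky Vy ec.
have fy_out t : t \notin c -> f y t = 0.
  by rewrite -ec (mem_supp_chain t (fS y Ky)) negbK => /eqP.
suff : (@std_simplex (size c) `&` (@bary _ c @^-1` O)) (barycentric c (f y)).
  by move=> [_]; rewrite /= bary_barycentric.
by rewrite eV; split=> //; exact: barycentric_simplex uts c_uniq (fS y Ky) _.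
Qed.

Lemma flag_map_cont_into S : flag_map (comparable le) S K f -> cont_into le S K f.
Proof.
move=> [ts uts [fS cf]]; split=> [x Kx|O oO]; first exact: flag_point_realization (fS x Kx).
have near_O x : K x -> O (f x) -> \forall y \near within K (nbhs x), O (f y).
  move=> Kx Ox.
  have near_cells := filter_forall (within_filter K (nbhs_filter x))
    (fun b : (size ts).-tuple bool =>
       coh_open_near_cell (sort le (mask b ts)) uts fS cf oO Kx Ox).
  apply: filterS near_cells => y /(_ (map_tuple (fun t => f y t != 0) (in_tuple ts))); apply.
  by rewrite /supp_chain filter_mask.
have : open (f @^-1` O `&` K : set (subspace K)).
  rewrite openE => x [Ox Kx]; rewrite /interior /nbhs /= -nbhs_subspace_in //.
  by apply: filterS2 (near_O x Kx Ox) (withinT _ _) => y.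
move=> /open_subspaceP[V oV eV]; exists V; split=> //.
by rewrite setIC (setIC K V) eV -setIA setIid.
Qed.

Hypothesis K_compact : compact K.

Lemma fresh_support_sequence : (forall x, K x -> exists c, forall t, f x t != 0 -> t \in c) ->
  ~ (exists ts : seq T, forall x t, K x -> f x t != 0 -> t \in ts) ->
  exists (x : nat -> 'rV[RR]_m) (t : nat -> T), [/\ forall i, K (x i),
    forall i, f (x i) (t i) != 0 & forall i j, (i < j)%N -> f (x i) (t j) = 0].
Proof.
move=> supp unbounded.
have /choice[p p_fresh] : forall ts : seq T, exists p : 'rV[RR]_m * T,
    [/\ K p.1, f p.1 p.2 != 0 & p.2 \notin ts].
  move=> ts; apply: contrapT => none; apply: unbounded; exists ts => x t Kx ft.
  by apply: contrapT => /negP nt; apply: none; exists (x, t).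
have /choice[su su_supp] : forall x, exists c, K x -> forall t, f x t != 0 -> t \in c.
  by move=> x; have [/supp[c c_supp]|nKx] := pselect (K x); [exists c|exists [::]].
pose used n := iter n (fun ts => ts ++ su (p ts).1) [::].
exists (fun n => (p (used n)).1), (fun n => (p (used n)).2); split=> [i|i|i j ij].
- by have [] := p_fresh (used i).
- by have [] := p_fresh (used i).
have used_mono k : {subset used i.+1 <= used (i.+1 + k)%N}.
  elim: k => [|k IH]; first by rewrite addn0.
  by rewrite addnS => s /IH; rewrite /used iterS mem_cat => ->.
apply: contrapT => /eqP fij; have [_ _ /negP] := p_fresh (used j); apply.
rewrite -(subnKC ij); apply: used_mono; rewrite /used iterS mem_cat; apply/orP; right.
by apply: su_supp; [have [] := p_fresh (used i)|rewrite (subnKC ij)].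
Qed.

Lemma coh_open_tail S (a : nat -> T -> RR) (t : nat -> T) j :
  (forall i, a i (t i) != 0) -> (forall i k, (i < k)%N -> a i (t k) = 0) ->
  coh_open le S [set b | forall i, (j <= i)%N -> b <> a i].
Proof.
move=> at_neq0 at_fresh c _.
have t_inj : injective t.
  move=> i k e; have [ik|ki|//] := ltngtP i k.
    by move/eqP: (at_neq0 i); case; rewrite e (at_fresh i k).
  by move/eqP: (at_neq0 k); case; rewrite -e (at_fresh k i).
exists (~` (\bigcup_(i in [set i | (j <= i)%N /\ t i \in c])
  [set l : 'rV[RR]_(size c) | @bary _ c l = a i])); split.
  apply: closed_openC; apply: closed_bigcup => [|i _].
    apply: (@sub_finite_set _ _ (t @^-1` [set` c])) => [i []//|].
    by apply: finite_preimage; [move=> i k _ _; exact: t_inj|exact: finite_seq].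
  have -> : [set l : 'rV[RR]_(size c) | @bary _ c l = a i] =
      \bigcap_(s in setT) (fun l => @bary _ c l s) @^-1` [set a i s].
    apply/seteqP; split=> l; first by move=> e s _; rewrite /= e.
    by move=> h; apply/funext => s; exact: h s I.
  apply: closed_bigI => s _; apply: preimage_closed; last exact: (@closed_eq (RR : realType)).
  by move=> l _; exact: bary_continuous.
apply/seteqP; split=> l [sl h]; split=> //.
  by move=> [i [ji _] /= e]; exact: h i ji e.
move=> i ji e; apply: h; exists i => //=; split=> //; apply: contraT => tc.
have := at_neq0 i; rewrite -e /bary big1 ?eqxx // => k /eqP ek.
by move: tc; rewrite -{1}ek mem_nth.
Qed.

(* If infinitely many vertices were involved, there would be points [x i] of [K] such that
   [f (x i)] involves a vertex of no earlier [f (x j)]. Any set of the [f (x i)] would then be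
   closed, against the compactness of [K]. *)
Lemma compact_cont_into_flag_map S : cont_into le S K f -> flag_map (comparable le) S K f.
Proof.
move=> cf; have [f_real f_open] := cf.
have supp x : K x -> exists c, forall t, f x t != 0 -> t \in c.
  move=> /f_real/realization_flag_point[c _ [_ f_out _ _ _]].
  by exists c => t; apply: contraNT => /f_out ->.
suff [ts ts_supp] : exists ts : seq T, forall x t, K x -> f x t != 0 -> t \in ts.
  exists (undup ts); first exact: undup_uniq.
  split=> [x Kx|t]; last exact: cont_into_coord cf.
  have [c uc fc] := realization_flag_point (f_real x Kx).
  have f_out t : t \notin undup ts -> f x t = 0.
    by rewrite mem_undup => nt; apply: contrapT => /eqP /(ts_supp x t Kx); exact/negP.
  by have fc_sum := flag_point_sum uc (undup_uniq ts) fc f_out; case: fc.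
apply: contrapT => /(fresh_support_sequence supp)[x [t [Kx ft_neq0 ft_fresh]]].
have [|y [Ky y_cluster]] := K_compact (fmap_proper_filter x _ : ProperFilter (x @ \oo)).
  by exists 0%N => // i _; exact: Kx.
have [j f_y_j] : exists j, forall i, (j <= i)%N -> f y <> f (x i).
  have [[i ei]|none] := pselect (exists i, f y = f (x i)); last first.
    by exists 0%N => i _ e; apply: none; exists i.
  by exists i.+1 => k ik; rewrite ei => e; move/eqP: (ft_neq0 k); apply; rewrite -e ft_fresh.
have [V [oV eV]] := f_open _ (@coh_open_tail S (fun i => f (x i)) t j ft_neq0 ft_fresh).
have Vy : V y.
  have : (K `&` f @^-1` [set b | forall i, (j <= i)%N -> b <> f (x i)]) y by [].
  by rewrite eV => -[].
have nbhs_V := open_nbhs_nbhs (conj oV Vy).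
have [|_ [[i ji <-] Vxi]] := y_cluster (x @` [set i | (j <= i)%N]) V _ nbhs_V.
  by exists j => // i ji; exists i.
have : (K `&` V) (x i) by split.
by rewrite -eV => -[_ /(_ i ji)].
Qed.

End Maps.

End Realization.

Section SphereCube.
Variables (R : realType) (n : nat).
Local Notation point := {ptws nat -> R}.
Local Notation row := 'rV[R]_n.+1.
Let D := iota 0 n.+1.
Let origin : point := fun=> 0.
Implicit Types (v : row) (x : point).

Definition sqnorm v : R := \sum_(i < n.+1) v ord0 i ^+ 2.

Definition normalize x : row :=
  \row_(i < n.+1) (x i / Num.sqrt (\sum_(j < n.+1) x j ^+ 2)).

(* The coordinates of [v] divided by its sup norm, as soon as the latter is at least
   [1 / (n + 1)]; this includes the Euclidean unit sphere. *)
Definition to_cube v : point := fun i =>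
  if insub i is Some k then v ord0 k / Num.max `|v| n.+1%:R^-1 else 0.

Lemma sqnorm_continuous : continuous sqnorm.
Proof.
apply: (@continuous_big R _ +%R 0) => [|i _ v]; first exact: add_continuous.
have ci : {for v, continuous (fun v : row => v ord0 i)} := @coord_continuous R 1 n.+1 ord0 i v.
exact: (continuousM ci ci).
Qed.

Lemma le_row_norm v i : `|v ord0 i| <= `|v|.
Proof. by rewrite [leRHS]/Num.norm /= mx_normrE; exact: (le_bigmax _ _ (ord0, i)). Qed.

Lemma row_norm_attained v : 0 < `|v| -> exists i, `|v ord0 i| = `|v|.
Proof.
rewrite normr_gt0 => v0; have [|[j i] e] := mx_norm_neq0 (x := v).
  by apply: contraNneq v0 => /mx_norm_eq0 ->.
by exists i; rewrite [RHS]/Num.norm /= e (ord1 j).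
Qed.

Lemma sqnorm1_norm_ge v : sqnorm v = 1 -> n.+1%:R^-1 <= `|v|.
Proof.
move=> v1; rewrite leNgt; apply/negP => v_lt.
have n_gt0 : 0 < n.+1%:R :> R by rewrite ltr0n.
have : sqnorm v <= n.+1%:R * `|v| ^+ 2.
  rewrite /sqnorm mulr_natl -[X in _ *+ X]card_ord -sumr_const; apply: ler_sum => i _.
  by rewrite -[leLHS]real_normK ?num_real // ler_sqr ?nnegrE // le_row_norm.
rewrite v1 leNgt => /negP; apply.
have n_inv : n.+1%:R^-1 <= 1 :> R by rewrite invf_le1 // ler1n.
have nv_lt : n.+1%:R * `|v| < 1 by rewrite -ltr_pdivlMl // mulr1.
rewrite expr2 mulrA; apply: le_lt_trans (lt_le_trans v_lt n_inv).
by rewrite -[leRHS]mul1r ler_wpM2r // ltW.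
Qed.

Lemma to_cube_ord v (i : 'I_n.+1) : to_cube v i = v ord0 i / Num.max `|v| n.+1%:R^-1.
Proof. by rewrite /to_cube valK. Qed.

Let denom_gt0 v : 0 < Num.max `|v| n.+1%:R^-1.
Proof. by rewrite lt_max invr_gt0 ltr0n orbT. Qed.

Lemma to_cube_cube v : cube D origin 1 (to_cube v).
Proof.
move=> i; rewrite /origin subr0 mem_iota /= add0n /to_cube; case: insubP => [k -> _|/negPf ->].
  rewrite normrM normfV (gtr0_norm (denom_gt0 v)) ler_pdivrMr // mul1r le_max.
  by rewrite le_row_norm.
by rewrite normr0.
Qed.

Lemma to_cube_boundary v : sqnorm v = 1 -> cube_boundary D origin 1 (to_cube v).
Proof.
move=> v1; split; first exact: to_cube_cube.
have v_ge := sqnorm1_norm_ge v1; have v_gt0 : 0 < `|v|.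
  by apply: lt_le_trans v_ge; rewrite invr_gt0 ltr0n.
have [i vi] := row_norm_attained v_gt0; exists (i : nat); first by rewrite mem_iota /= add0n.
rewrite /origin subr0 to_cube_ord (max_idPl v_ge) normrM normfV normr_id vi divff //.
by rewrite gt_eqF.
Qed.

Lemma to_cube_continuous : continuous to_cube.
Proof.
apply: continuous_ptws => i; rewrite /to_cube; case: insubP => [k _ _|_]; last first.
  exact: cst_continuous.
have c_max : continuous (fun v : row => Num.max `|v| n.+1%:R^-1).
  by apply: continuous_maxr; [exact: norm_continuous|exact: cst_continuous].
have ck : continuous (fun v : row => v ord0 k) by exact: coord_continuous.
move=> v; have denom_neq0 : Num.max `|v| n.+1%:R^-1 != 0 by rewrite gt_eqF.
exact: (continuousM (ck v) (@continuousV _ _ _ v denom_neq0 (c_max v))).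
Qed.

Lemma sumsq_gt0 x : cube_boundary D origin 1 x -> 0 < \sum_(j < n.+1) x j ^+ 2.
Proof.
move=> [_ [i]]; rewrite mem_iota /= add0n => ilt; rewrite /origin subr0 => xi.
rewrite (bigD1 (Ordinal ilt)) //= -[x i ^+ 2]real_normK ?num_real // xi expr1n.
by rewrite ltr_wpDr // sumr_ge0 // => j _; exact: sqr_ge0.
Qed.

Lemma sqnorm_normalize x : cube_boundary D origin 1 x -> sqnorm (normalize x) = 1.
Proof.
move=> /sumsq_gt0 x0; rewrite /sqnorm.
under eq_bigr do rewrite mxE expr_div_n sqr_sqrtr ?ltW //.
by rewrite -mulr_suml divff // gt_eqF.
Qed.

Lemma to_cubeK v : sqnorm v = 1 -> normalize (to_cube v) = v.
Proof.
move=> v1; have d0 := denom_gt0 v; set d := Num.max _ _ in d0.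
have -> : normalize (to_cube v) = \row_i (v ord0 i / d / Num.sqrt (d^-1 ^+ 2)).
  apply/rowP => i; rewrite !mxE to_cube_ord -/d; congr (_ / Num.sqrt _).
  rewrite -[RHS]mul1r -v1 mulr_suml; apply: eq_bigr => j _.
  by rewrite to_cube_ord -/d exprMn.
by apply/rowP => i; rewrite mxE sqrtr_sqr gtr0_norm ?invr_gt0 // mulfK // invr_eq0 gt_eqF.
Qed.

Lemma normalize_continuous : {within cube_boundary D origin 1, continuous normalize}.
Proof.
have c_coord i : {within cube_boundary D origin 1, continuous (fun x : point => x i)}.
  by apply: continuous_subspaceT; exact: coord_ptws_continuous.
have c_norm : {within cube_boundary D origin 1,
    continuous (fun x : point => Num.sqrt (\sum_(j < n.+1) x j ^+ 2))}.
  move=> x; apply: continuous_comp; last exact: sqrt_continuous.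
  apply: (@continuous_big R _ +%R 0 _ _ (subspace _)) => [|j _ y]; first exact: add_continuous.
  exact: (continuousM (c_coord j y) (c_coord j y)).
apply: (@continuous_row R (subspace _)) => i.
have -> : (fun x => normalize x ord0 i) =
    (fun x => x i / Num.sqrt (\sum_(j < n.+1) x j ^+ 2)).
  by apply: funext => x; rewrite mxE.
rewrite continuous_subspace_in => x; rewrite inE => bx.
have norm_neq0 : Num.sqrt (\sum_(j < n.+1) x j ^+ 2) != 0.
  by rewrite gt_eqF // sqrtr_gt0 sumsq_gt0.
have c_inv := @continuousV R (subspace (cube_boundary D origin 1)) _ x norm_neq0 (c_norm x).
exact: (@continuousM R (subspace (cube_boundary D origin 1)) _ _ x (c_coord i x) c_inv).
Qed.

Lemma unit_sphere_compact : compact [set v | sqnorm v = 1].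
Proof.
apply: bounded_closed_compact.
  exists 1; split; first exact: real1.
  move=> r r1 v /= v1; apply: le_trans (ltW r1); rewrite leNgt; apply/negP => v_gt.
  have [i vi] := row_norm_attained (lt_trans ltr01 v_gt).
  have : v ord0 i ^+ 2 <= sqnorm v.
    by rewrite /sqnorm (bigD1 i) //= lerDl sumr_ge0 // => j _; exact: sqr_ge0.
  by rewrite v1 -real_normK ?num_real // vi; nra.
apply: (@preimage_closed _ _ sqnorm [set 1]); last exact: closed_eq.
by move=> v _; exact: sqnorm_continuous.
Qed.

End SphereCube.

Section KConnected.
Variables (T : eqType) (le : rel T).
Hypotheses (refl_le : reflexive le) (trans_le : transitive le) (anti_le : antisymmetric le).

Lemma fillable_sphere (S : set T) n f : fillable RR (comparable le) n.+1 S ->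
  cont_into le S (@sphere n) f ->
  exists g, cont_into le S (@ball_closed n) g /\ (forall x, sphere x -> g x = f x).
Proof.
move=> S_fillable cf.
have fS := compact_cont_into_flag_map refl_le trans_le anti_le (@unit_sphere_compact RR n) cf.
have fS_cube := flag_map_subst (@sqnorm_normalize RR n) (@normalize_continuous RR n) fS.
have [g gS gf] := S_fillable _ _ _ _ (iota_uniq _ _) (size_iota _ _) ltr01 fS_cube.
exists (g \o @to_cube RR n); split.
  apply: flag_map_cont_into => //; apply: flag_map_subst gS.
    by move=> v _; exact: to_cube_cube.
  by apply: continuous_subspaceT; exact: to_cube_continuous.
move=> v v1; rewrite /= gf; last exact: (to_cube_boundary (R := RR)).
by rewrite /= (to_cubeK (R := RR)).
Qed.

Lemma constructible_k_connected N (S : set T) : constructible (comparable le) N S ->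
  k_connected le S (N%:Z - 2).
Proof.
move=> cS; have S_fillable j : (j < N)%N -> fillable RR (comparable le) j S.
  exact: (constructible_fillable (comparablexx refl_le) (@comparableC _ le) cS).
split=> [N1|n nN f]; last by apply: fillable_sphere; apply: S_fillable; lia.
have [v Sv] : exists v, S v.
  by apply: (@constructible_inhabited _ (comparable le) 0); apply: constructibleW cS; lia.
exists (fun t => (t == v)%:R).
apply: (flag_point_realization trans_le anti_le (ts := [:: v])) => //.
exact: (flag_point_vertex RR (comparablexx refl_le) Sv).
Qed.

End KConnected.

(** * Graded posets *)

Section Grading.
Variables (T : eqType) (le : rel T) (rk : T -> nat) (B : nat).
Hypothesis ranked_le : ranked le rk B.
Variables (X : set T) (lo hi : nat).
Implicit Types (x y : ext T) (c : seq T) (w t : T) (d : nat).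

Definition lower_rank x := match x with Bot => lo | Mid a => (rk a).+1 | Top => hi.+1 end.

Definition upper_rank y := match y with Bot => lo | Mid b => rk b | Top => hi.+1 end.

Hypothesis X_rank : forall w, X w -> (lo <= rk w <= hi)%N.
Hypothesis X_dense : forall x y d, in_ext X x -> in_ext X y -> ext_le le x y ->
  (lower_rank x <= d < upper_rank y)%N -> exists2 w, open_interval le X x y w & rk w = d.

Lemma ext_lt_Mid t w : ext_lt le (Mid t) (Mid w) <-> plt le t w.
Proof.
split=> [[tw t_neq_w]|/andP[tw t_neq_w]]; last by split=> // -[]; exact/eqP.
by apply/andP; split=> //; apply/eqP => e; apply: t_neq_w; rewrite e.
Qed.

Lemma ext_lt_Midl x t w : ext_lt le x (Mid t) -> plt le t w -> ext_lt le x (Mid w).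
Proof.
case: x => [|a|] xt tw; [by split| |by case: xt].
by apply/ext_lt_Mid; apply: (ranked_plt_trans ranked_le) tw; exact/ext_lt_Mid.
Qed.

Lemma ext_lt_Midr w t y : plt le w t -> ext_lt le (Mid t) y -> ext_lt le (Mid w) y.
Proof.
case: y => [|b|] wt ty; [by case: ty| |by split].
by apply/ext_lt_Mid; apply: (ranked_plt_trans ranked_le) wt _; exact/ext_lt_Mid.
Qed.

Lemma open_interval_rank x y w : open_interval le X x y w ->
  (lower_rank x <= rk w < upper_rank y)%N.
Proof.
have [_ _ _ rk_lt _] := ranked_le.
move=> [/X_rank/andP[low whi] [xw wy]]; apply/andP; split.
  by case: x xw => [|a|] //=; [move/ext_lt_Mid; exact: rk_lt|case].
by case: y wy => [|b|] //=; [case|move/ext_lt_Mid; exact: rk_lt].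
Qed.

Lemma chain_insert x y d c : in_ext X x -> in_ext X y -> ext_le le x y ->
  sorted (plt le) c -> (forall w, w \in c -> open_interval le X x y w) ->
  (lower_rank x <= d < upper_rank y)%N -> d \notin map rk c ->
  exists w c', [/\ open_interval le X x y w, rk w = d, sorted (plt le) c' & perm_eq c' (w :: c)].
Proof.
move=> + Xy; elim: c x => [|t c IH] x Xx xy /= c_sorted cX d_range d_new.
  by have [w xwy rkw] := X_dense Xx Xy xy d_range; exists w, [:: w].
have [Xt [xt ty]] := cX t (mem_head _ _).
have t_lt := order_path_min (ranked_plt_trans ranked_le) c_sorted.
move: d_new; rewrite inE negb_or neq_ltn => /andP[/orP[d_lt|d_gt] d_new].
  have [|w [Xw [xw wt]] rkw] := @X_dense x (Mid t) d Xx Xt (proj1 xt).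
    by case/andP: d_range => ->.
  have wt' : plt le w t by exact/ext_lt_Mid.
  exists w, (w :: t :: c); rewrite /= wt'; split=> //.
  by split=> //; split=> //; exact: ext_lt_Midr ty.
have [||||w [c' [[Xw [tw wy]] rkw c'_sorted c'_perm]]] := IH (Mid t) Xt (proj1 ty).
- exact: path_sorted c_sorted.
- move=> s sc; have [|Xs [_ sy]] := cX s; first by rewrite inE sc orbT.
  by split=> //; split=> //; apply/ext_lt_Mid; move/allP: t_lt; apply.
- by rewrite /= d_gt; case/andP: d_range.
- by [].
have tw' : plt le t w by exact/ext_lt_Mid.
exists w, (t :: c'); split=> //.
- by split=> //; split=> //; exact: ext_lt_Midl tw'.
- rewrite /= (path_sortedE (ranked_plt_trans ranked_le)) c'_sorted andbT (perm_all _ c'_perm) /=.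
  by rewrite tw'.
- rewrite -(perm_cons t) in c'_perm; apply: perm_trans c'_perm _.
  by rewrite (perm_catCA [:: t] [:: w] c).
Qed.

Section Interval.
Variables (x y : ext T).
Hypotheses (Xx : in_ext X x) (Xy : in_ext X y) (xy : ext_le le x y).
Let I := open_interval le X x y.
Let N := (upper_rank y - lower_rank x)%N.

Lemma chain_rank c : is_chain le I c -> uniq (map rk c) /\
  {subset map rk c <= iota (lower_rank x) N}.
Proof.
have [_ _ _ rk_lt _] := ranked_le; move=> [c_sorted cI]; split.
  by apply: (sorted_uniq ltn_trans ltnn); exact: homo_sorted c_sorted.
move=> _ /mapP[w wc ->]; rewrite mem_iota; have := open_interval_rank (cI w wc).
by rewrite /N; lia.
Qed.

Lemma chain_size_le c : is_chain le I c -> (size c <= N)%N.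
Proof.
move=> /chain_rank[rk_uniq rk_sub].
by have := uniq_leq_size rk_uniq rk_sub; rewrite size_map size_iota.
Qed.

Lemma chain_extend c : is_chain le I c -> (size c < N)%N ->
  exists c', [/\ is_chain le I c', {subset c <= c'} & size c' = (size c).+1].
Proof.
move=> [c_sorted cI] c_lt.
have [d d_range d_new] : exists2 d, (lower_rank x <= d < upper_rank y)%N & d \notin map rk c.
  apply: contrapT => none; move: c_lt; rewrite ltnNge => /negP; apply.
  rewrite -(size_map rk c) -(size_iota (lower_rank x) N); apply: uniq_leq_size (iota_uniq _ _) _.
  move=> d; rewrite mem_iota => d_range; apply: contraT => d_new; case: none; exists d => //.
  by move: d_range; rewrite /N; lia.
have [w [c' [Iw rkw c'_sorted c'_perm]]] := chain_insert Xx Xy xy c_sorted cI d_range d_new.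
exists c'; split; last by rewrite (perm_size c'_perm).
  by split=> // t; rewrite (perm_mem c'_perm) inE => /predU1P[->//|]; exact: cI.
by move=> t tc; rewrite (perm_mem c'_perm) inE tc orbT.
Qed.

Lemma maxchain_size c : is_maxchain le I c -> size c = N.
Proof.
move=> [cI c_max]; apply/eqP; rewrite eqn_leq chain_size_le //= leqNgt; apply/negP => c_lt.
have [c' [c'I cc' size_c']] := chain_extend cI c_lt.
have c'_uniq : uniq c' by have [/map_uniq] := chain_rank c'I.
by have := uniq_leq_size c'_uniq (c_max c' c'I cc'); rewrite size_c' ltnn.
Qed.

Lemma open_interval_has_dim : has_dim le I (N%:Z - 1).
Proof.
split; last by move=> c /chain_size_le; rewrite subrK lez_nat.
suff [c cI sc] : exists2 c, is_chain le I c & size c = N by exists c; rewrite sc subrK.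
have : (N <= N)%N by []; elim: {-2}N => [|k IH] kN; first by exists [::].
have [c cI sc] := IH (ltnW kN); have [|c' [c'I _ sc']] := chain_extend cI; first by rewrite sc.
by exists c'; rewrite // sc' sc.
Qed.

End Interval.

Lemma open_interval_Bot_Top : open_interval le X (Bot T) (Top T) = X.
Proof. by apply/seteqP; split=> w; [case|move=> Xw; split; [|split; split]]. Qed.

Lemma open_interval_Bot_Mid b :
  open_interval le X (Bot T) (Mid b) = [set w | X w /\ plt le w b].
Proof.
apply/seteqP; split=> w; first by move=> [Xw [_ /ext_lt_Mid]].
by move=> [Xw wb]; split=> //; split; [split|exact/ext_lt_Mid].
Qed.

Lemma open_interval_Mid_Top a :
  open_interval le X (Mid a) (Top T) = [set w | X w /\ plt le a w].
Proof.
apply/seteqP; split=> w; first by move=> [Xw [/ext_lt_Mid]].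
by move=> [Xw wb]; split=> //; split; [exact/ext_lt_Mid|split].
Qed.

Lemma open_interval_Mid_Mid a b :
  open_interval le X (Mid a) (Mid b) = [set w | X w /\ (plt le a w /\ plt le w b)].
Proof.
apply/seteqP; split=> w; first by move=> [Xw [/ext_lt_Mid aw /ext_lt_Mid]].
by move=> [Xw [aw wb]]; split=> //; split; exact/ext_lt_Mid.
Qed.

Lemma constructible_cohen_macaulay : (forall x y, in_ext X x -> in_ext X y -> ext_le le x y ->
    constructible (comparable le) (upper_rank y - lower_rank x) (open_interval le X x y)) ->
  cohen_macaulay le X.
Proof.
have [refl trans anti _ _] := ranked_le; move=> cX; split; last first.
  move=> x y Xx Xy xy; exists ((upper_rank y - lower_rank x)%N%:Z - 1).
  split; first exact: open_interval_has_dim.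
  rewrite -addrA -opprD -[(1 + 1)%R]/(2 : int).
  exact: (constructible_k_connected refl trans anti (cX x y Xx Xy xy)).
exists ((hi.+1 - lo)%N%:Z - 1); rewrite -open_interval_Bot_Top; split.
  exact: (@open_interval_has_dim (Bot T) (Top T)).
by move=> c; rewrite subrK => /(@maxchain_size (Bot T) (Top T) _ _ _) ->.
Qed.

End Grading.

(** * Posets of subspaces *)

Local Notation vlt := (plt (@vsub_le _ _)).
Local Notation vconstructible := (constructible (comparable (@vsub_le _ _))).

Section Subspaces.
Variables (F : fieldType) (E : vectType F).
Implicit Types (A H K L V W X : {vspace E}) (S : set {vspace E}) (y z : E).

Lemma vltE W V : vlt W V = (W <= V)%VS && ~~ (V <= W)%VS.
Proof. by rewrite /plt /vsub_le eqEsubv; case: (W <= V)%VS. Qed.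

Lemma vltE_dim W V : vlt W V = (W <= V)%VS && (\dim W < \dim V)%N.
Proof.
rewrite vltE; case: (boolP (W <= V)%VS) => //= WV.
by rewrite ltnNge -(dimv_leqif_sup WV).2 eqn_leq dimvS.
Qed.

Lemma vlt_dim W V : vlt W V -> (\dim W < \dim V)%N.
Proof. by rewrite vltE_dim => /andP[]. Qed.

Lemma ranked_vsub : ranked (@vsub_le F E) (fun W => \dim W) (\dim {:E}).
Proof.
split; [exact: subvv|exact: subv_trans|exact: subv_anti|exact: vlt_dim|].
by move=> W; exact/dimvS/subvf.
Qed.

Lemma constructible_capv N S H : vconstructible N [set W | S W /\ (W <= H)%VS] ->
  vconstructible N [set W | S W /\ S (W :&: H)%VS].
Proof.
move=> cH; apply: (constructible_retract_down ranked_vsub (phi := fun W => (W :&: H)%VS)).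
- by move=> W [SW SWH]; rewrite /= -capvA capvv; split=> //; exact: capvSl.
- by move=> V W _ _ VW; exact: capvS.
suff -> : [set W | [set W | S W /\ S (W :&: H)%VS] W /\ (W :&: H)%VS = W] =
  [set W | S W /\ (W <= H)%VS] by [].
apply/seteqP; split=> W; first by move=> [[SW _] /capv_idPl].
by move=> [SW /capv_idPl WH] /=; rewrite WH.
Qed.

Lemma constructible_addv N S L : vconstructible N [set W | S W /\ (L <= W)%VS] ->
  vconstructible N [set W | S W /\ S (W + L)%VS].
Proof.
move=> cL; apply: (constructible_retract_up ranked_vsub (phi := fun W => (W + L)%VS)).
- by move=> W [SW SWL]; rewrite /= -addvA addvv; split=> //; exact: addvSl.
- by move=> V W _ _ VW; exact: addvS.
suff -> : [set W | [set W | S W /\ S (W + L)%VS] W /\ (W + L)%VS = W] =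
  [set W | S W /\ (L <= W)%VS] by [].
apply/seteqP; split=> W; first by move=> [[SW _] /addv_idPl].
by move=> [SW /addv_idPl WL] /=; rewrite WL.
Qed.

Lemma dim_addv_line W y : \dim (W + <[y]>) = (\dim W + (y \notin W))%N.
Proof.
have [yW|yW] := boolP (y \in W); first by rewrite (addv_idPl _) ?addn0 // -memvE.
have y0 : y != 0 by apply: contraNneq yW => ->; exact: mem0v.
rewrite dimv_disjoint_sum ?dim_vline ?y0 //; apply/eqP; rewrite -subv0; apply/subvP => x.
rewrite memv_cap => /andP[xW /vlineP[a e]]; rewrite e rpredZeq (negPf yW) orbF in xW.
by rewrite e (eqP xW) scale0r mem0v.
Qed.

Lemma vlt_addv_line W y : y \notin W -> vlt W (W + <[y]>)%VS.
Proof. by move=> yW; rewrite vltE addvSl subv_add subvv -memvE. Qed.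

Lemma hyperplane_ex A V y : (A <= V)%VS -> y \in V -> y \notin A ->
  exists H, [/\ (A <= H)%VS, y \notin H & (H + <[y]>)%VS = V].
Proof.
move=> AV yV yA; pose C := (V :\: (A + <[y]>))%VS.
have AyV : (A + <[y]> <= V)%VS by rewrite subv_add AV -memvE.
exists (A + C)%VS; split; first exact: addvSl.
  apply/negP => /memv_addP[a aA [c cC e]]; case/negP: yA.
  have : c \in (C :&: (A + <[y]>))%VS.
    by rewrite memv_cap cC /= -[c](addKr a) -e memv_add ?memvN // memv_line.
  by rewrite capv_diff memv0 => /eqP c0; rewrite e c0 addr0.
by rewrite -addvA (addvC C) addvA addvC addv_diff; exact/addv_idPl.
Qed.

Lemma addv_line_exchange H y z : z \in (H + <[y]>)%VS -> z \notin H ->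
  (H + <[z]>)%VS = (H + <[y]>)%VS.
Proof.
move=> zHy zH; have yH : y \notin H.
  by apply: contra zH => yH; rewrite (addv_idPl _) // -memvE in zHy.
by apply/eqP; rewrite eqEdim subv_add addvSl -memvE zHy !dim_addv_line zH yH leqnn.
Qed.

Lemma hyperplane_ex2 A V y z : (A <= V)%VS -> y \in V -> y \notin A -> z \notin A ->
  exists H, [/\ (A <= H)%VS, y \notin H, z \notin H & (H + <[y]>)%VS = V].
Proof.
move=> AV yV yA zA; have [zV|zV] := boolP (z \in V); last first.
  have [H [AH yH HyV]] := hyperplane_ex AV yV yA; exists H; split=> //.
  by apply: contra zV => zH; rewrite -HyV (subvP (addvSl _ _)).
have [zAy|zAy] := boolP (z \in (A + <[y]>)%VS).
  have [H [AH yH HyV]] := hyperplane_ex AV yV yA; exists H; split=> //.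
  apply: contra yH => zH; rewrite memvE (subv_trans (addvSr A _)) //.
  by rewrite -(addv_line_exchange zAy zA) subv_add AH -memvE.
have yA' : y \notin (A + <[y - z]>)%VS.
  apply: contra zAy => yAyz; have := addv_line_exchange yAyz yA => e.
  by rewrite -[z](subKr y) e rpredB // (subvP (addvSr _ _)) ?memv_line.
have A'V : (A + <[y - z]> <= V)%VS by rewrite subv_add AV -memvE rpredB.
have [H [A'H yH HyV]] := hyperplane_ex A'V yV yA'.
exists H; split=> //; first by apply: subv_trans A'H; exact: addvSl.
apply: contra yH => zH; rewrite -(subrK z y) rpredD // (subvP A'H) //.
by rewrite (subvP (addvSr _ _)) ?memv_line.
Qed.

Lemma dim_cap_hyperplane H X y : (X <= H + <[y]>)%VS ->
  \dim X = (\dim (X :&: H) + ~~ (X <= H)%VS)%N.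
Proof.
move=> XHy; have [XH|XH] := boolP (X <= H)%VS; first by rewrite (capv_idPl XH) addn0.
have /subvPn[x xX xH] := XH.
have sum_XH : (X + H)%VS = (H + <[y]>)%VS.
  apply/eqP; rewrite eqEsubv subv_add XHy addvSl -(addv_line_exchange (subvP XHy _ xX) xH).
  by rewrite subv_add addvSr -memvE (subvP (addvSl _ _)).
have yH : y \notin H.
  by apply: contra xH => yH; have := subvP XHy _ xX; rewrite (addv_idPl _) // -memvE.
by have := dimv_sum_cap X H; rewrite sum_XH dim_addv_line yH; lia.
Qed.

(* Both sides say that passing to the hyperplane [H] lowers the dimensions of [X] and of
   [X :&: K] by one. *)
Lemma addv_cap_hyperplane H X K y : (X + K)%VS = (H + <[y]>)%VS -> ~~ (X <= H)%VS ->
  ((X :&: H) + K == H + <[y]>)%VS = ~~ (X :&: K <= H)%VS.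
Proof.
move=> XK XH; have XHy : (X <= H + <[y]>)%VS by rewrite -XK addvSl.
have KHy : (K <= H + <[y]>)%VS by rewrite -XK addvSr.
rewrite eqEdim subv_add KHy (subv_trans (capvSl _ _) XHy) /= -XK.
have dX := dim_cap_hyperplane XHy; rewrite XH in dX.
have dXK := dim_cap_hyperplane (subv_trans (capvSl X K) XHy).
have := dimv_sum_cap X K; have := dimv_sum_cap (X :&: H)%VS K.
rewrite -capvA (capvC H) capvA; case: (X :&: K <= H)%VS dXK => /= dXK.
  by move=> *; apply/negbTE; rewrite -ltnNge; lia.
by move=> *; lia.
Qed.

Definition supplements A V K L : set {vspace E} :=
  [set W | [/\ (A <= W)%VS, (W + K)%VS = V, W != V & ~~ (L <= W)%VS]].

Lemma supplements_below A V K L W : supplements A V K L W ->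
  [set X | supplements A V K L X /\ vlt X W] = supplements A W (W :&: K)%VS L.
Proof.
move=> [AW WK W_neq_V LW]; have WV : (W <= V)%VS by rewrite -WK addvSl.
apply/seteqP; split=> X /=.
  move=> [[AX XK _ LX] /andP[XW X_neq_W]]; split=> //.
  by rewrite capvC (vspace_modl _ XW) XK; apply/capv_idPr.
move=> [AX XWK X_neq_W LX]; have XW : (X <= W)%VS by rewrite -XWK addvSl.
split; last by apply/andP.
split=> //; last by apply: contraNneq X_neq_W => e; rewrite eqEsubv XW /= e.
by rewrite -{1}(addv_idPr (capvSr W K)) addvA XWK.
Qed.

Section Hyperplane.
Variables (A V K L H : {vspace E}) (y : E).
Hypotheses (AH : (A <= H)%VS) (HyV : (H + <[y]>)%VS = V) (KV : (K <= V)%VS).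
Hypotheses (KH : ~~ (K <= H)%VS) (LH : ~~ (L <= H)%VS).
Let S := supplements A V K L.

Lemma supplements_hyperplane : S H.
Proof.
have HV : (H <= V)%VS by rewrite -HyV addvSl.
split=> //; last by apply: contraNneq KH => ->.
have [x xK xH] := subvPn KH.
apply/eqP; rewrite eqEsubv subv_add HV KV /= -HyV -(addv_line_exchange _ xH).
  by rewrite addvS // -memvE.
by rewrite HyV (subvP KV).
Qed.

Lemma supplements_cap_hyperplane W : S W -> ~~ (W <= H)%VS ->
  S (W :&: H)%VS <-> ~~ (W :&: K <= H)%VS.
Proof.
move=> [AW WK _ LW] WH; rewrite -(addv_cap_hyperplane (y := y)) ?HyV //.
split=> [[_ ->]//|/eqP WHK]; split=> //; first by rewrite subv_cap AW.
  by apply: contraNneq KH => e; rewrite (subv_trans KV) // -e capvSr.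
by apply: contra LW => /subv_trans; apply; exact: capvSl.
Qed.

Lemma supplements_above W : S W -> ~~ (W <= H)%VS -> (W :&: K <= H)%VS ->
  [set X | (S X /\ S (X :&: H)%VS) /\ vlt W X] = supplements W V (W + (H :&: K))%VS L.
Proof.
move=> SW WH WKH; have [AW WK _ _] := SW.
have above X : (W <= X)%VS -> (X <= V)%VS ->
    ~~ (X :&: K <= H)%VS = ((X + (W + (H :&: K))) == V)%VS.
  move=> WX XV; have XK : (X + K)%VS = V.
    by apply/eqP; rewrite eqEsubv subv_add XV KV -WK addvS.
  rewrite addvA (addv_idPl WX) addvC (capvC H) -HyV capvC.
  by rewrite -(addv_cap_hyperplane (y := y)) ?HyV // addvC.
apply/seteqP; split=> X /=.
  move=> [[SX SXH] /andP[WX _]]; have [AX XK X_neq_V LX] := SX.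
  split=> //; apply/eqP; rewrite -above //; last by rewrite -XK addvSl.
  by apply/supplements_cap_hyperplane=> //; apply: contra WH; exact: subv_trans.
move=> [WX XK2 X_neq_V LX]; have XV : (X <= V)%VS by rewrite -XK2 addvSl.
have XKH : ~~ (X :&: K <= H)%VS by rewrite above //; apply/eqP.
have SX : S X.
  split=> //; first exact: subv_trans AW WX.
  by apply/eqP; rewrite eqEsubv subv_add XV KV -WK addvS.
split; last by rewrite /plt /vsub_le WX; apply: contraNneq XKH => <-.
by split=> //; apply/supplements_cap_hyperplane=> //; apply: contra WH; exact: subv_trans.
Qed.

End Hyperplane.

(* For a hyperplane [H >= A] of [V] containing neither [K] nor [L], the supplements [W] of [K]
   such that [W :&: H] is again one contract to [H]; the other ones, those with
   [W :&: K <= H], are added by increasing dimension, along the join of two smaller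
   instances. *)
Lemma supplements_constructible A V K L : (A <= K)%VS -> (K <= V)%VS -> ~~ (L <= A)%VS ->
  vconstructible (\dim K - \dim A) (supplements A V K L).
Proof.
have [n] := ubnP (\dim V - \dim A)%N; elim: n A V K L => // n IH A V K L dn AK KV LA.
have AV := subv_trans AK KV.
have [KA|KA] := boolP (K <= A)%VS.
  by have /eqP -> : (\dim K - \dim A == 0)%N; [rewrite subn_eq0 dimvS|exact: constructible0].
have [eKV|K_neq_V] := eqVneq K V.
  apply: (@constructible_bottom _ _ _ _ A) => [|W []//].
  by split=> //; [rewrite eKV; exact/addv_idPr|apply: contraNneq KA => ->].
have [[y yK yA] [z zL zA]] := (subvPn KA, subvPn LA).
have [H [AH yH zH HyV]] := hyperplane_ex2 AV (subvP KV _ yK) yA zA.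
have KH : ~~ (K <= H)%VS by apply: contra yH => /subvP; apply.
have LH : ~~ (L <= H)%VS by apply: contra zH => /subvP; apply.
pose S := supplements A V K L.
apply: (constructible_attach_increasing ranked_vsub (S0 := [set W | S W /\ S (W :&: H)%VS])).
- by move=> W [].
- apply: constructible_capv; apply: (@constructible_top _ _ _ _ H) => [|W []//].
  by split; [exact: (supplements_hyperplane AH HyV KV KH LH)|exact: subvv].
move=> W SW nS0W; have [AW WK W_neq_V LW] := SW; have WV : (W <= V)%VS by rewrite -WK addvSl.
have WH : ~~ (W <= H)%VS by apply: contra_notN nS0W => /capv_idPl WH; split; rewrite // WH.
have WKH : (W :&: K <= H)%VS.
  by apply/negPn/negP => WKH; apply: nS0W; split=> //; apply/(supplements_cap_hyperplane AH HyV).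
pose K2 := (W + (H :&: K))%VS; have K2V : (K2 <= V)%VS.
  by rewrite subv_add WV (subv_trans (capvSr _ _)).
have A_neq_W : A != W by apply: contraNneq K_neq_V => A_eq_W; rewrite -WK -A_eq_W (addv_idPr AK).
have dimW : (\dim A < \dim W < \dim V)%N by rewrite !vlt_dim //; exact/andP.
exists (\dim (W :&: K) - \dim A)%N, (\dim K2 - \dim W)%N; split.
- have := dimv_sum_cap W (H :&: K)%VS; rewrite -/K2 capvA (capvC W) -capvA (capv_idPr WKH).
  have KHy : (K <= H + <[y]>)%VS by rewrite HyV.
  have := dim_cap_hyperplane KHy; rewrite KH capvC.
  have : (\dim A <= \dim (W :&: K))%N by rewrite dimvS // subv_cap AW.
  by clear=> /=; lia.
- rewrite supplements_below //; apply: IH; rewrite ?capvSl ?subv_cap ?AW //.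
  by move: dimW dn; clear; lia.
- rewrite (supplements_above AH HyV KV KH SW WH WKH).
  by apply: IH; rewrite ?addvSl //; move: dimW dn; clear; lia.
Qed.

Lemma between_constructible A V : (A <= V)%VS ->
  vconstructible (\dim V - \dim A).-1 [set W | vlt A W /\ vlt W V].
Proof.
have [n] := ubnP (\dim V); elim: n V => // n IH V dn AV.
pose I := [set W | vlt A W /\ vlt W V].
have [dimV|dimV] := leqP (\dim V - \dim A) 1.
  by have -> : (\dim V - \dim A).-1 = 0%N; [lia|exact: constructible0].
have /subvPn[y yV yA] : ~~ (V <= A)%VS by apply/negP => /dimvS; lia.
have AyV : vlt (A + <[y]>)%VS V.
  rewrite vltE subv_add AV -memvE yV; apply/negP => /dimvS.
  by rewrite dim_addv_line yA; lia.
apply: (constructible_attach_increasing ranked_vsub (S0 := [set W | I W /\ I (W + <[y]>)%VS])).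
- by move=> W [].
- apply: constructible_addv; apply: (@constructible_bottom _ _ _ _ (A + <[y]>)%VS) => [|W].
    by split; [split=> //; exact: vlt_addv_line|exact: addvSr].
  by move=> [[/andP[AW _] _] yW]; rewrite /vsub_le subv_add yW andbT.
move=> W IW nI; have [AW WV] := IW.
have WyV : (W + <[y]>)%VS = V.
  apply: contrapT => /eqP WyV; apply: nI; split=> //; split.
    have [yW|yW] := boolP (y \in W); first by rewrite (addv_idPl _) // -memvE.
    exact: (ranked_plt_trans ranked_vsub AW (vlt_addv_line yW)).
  by case/andP: WV => WV _; rewrite /plt /vsub_le WyV subv_add [(W <= V)%VS]WV -memvE yV.
exists (\dim W - \dim A).-1, 0%N; split; last exact: constructible0.
  by have := dim_addv_line W y; rewrite WyV; case: (y \in W); lia.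
have -> : [set X | I X /\ vlt X W] = [set X | vlt A X /\ vlt X W].
  apply/seteqP; split=> X; first by move=> [[]].
  by move=> [AX XW]; split=> //; split=> //; exact: (ranked_plt_trans ranked_vsub XW WV).
by apply: IH; [have := vlt_dim WV; lia|case/andP: AW].
Qed.

Lemma subspace_between A V d : (A <= V)%VS -> (\dim A <= d <= \dim V)%N ->
  exists W, [/\ (A <= W)%VS, (W <= V)%VS & \dim W = d].
Proof.
move=> AV /andP[]; rewrite leq_eqVlt => /predU1P[<- _|]; first by exists A.
elim: d => // d IH Ad dV.
have [W [AW WV dimW]] : exists W, [/\ (A <= W)%VS, (W <= V)%VS & \dim W = d].
  rewrite ltnS leq_eqVlt in Ad; case/predU1P: Ad => [<-|Ad]; first by exists A.
  by apply: IH => //; exact: ltnW.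
have /subvPn[y yV yW] : ~~ (V <= W)%VS by apply/negP => /dimvS; lia.
exists (W + <[y]>)%VS; rewrite dim_addv_line yW dimW addn1 subv_add WV -memvE; split=> //.
exact: subv_trans AW (addvSl _ _).
Qed.

End Subspaces.

(** * Formed spaces *)

Section FormedSpace.
Variables (F : fieldType) (E : vectType F).
Variables (sigma : {rmorphism F -> F}) (eps : F) (Lambda : pred F) (q : E -> E -> F).
Implicit Types (A C M U V W X Y Z : {vspace E}) (u v w y z : E) (N d : nat).

Let om := omega sigma eps q.
Let Qz := Qzero Lambda q.
Let iso := isotropic sigma eps Lambda q.

Definition orth U : {vspace E} :=
  lker (linfun (fun v => \row_(i < \dim U) om (vbasis U)`_i v)).

Definition formker : {vspace E} := orth fullv.

Definition contains_radical A := forall v, Rad sigma eps Lambda q v -> v \in A.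

Definition witt_index : nat :=
  \max_(d < (\dim {:E}).+1 | `[< exists2 W, iso W & \dim W = d >]) d.

Definition iso_above A : set {vspace E} := [set W | iso W /\ vlt A W].

Definition opposite A Z : set {vspace E} :=
  [set W | [/\ iso W, (A <= W)%VS & (Z :&: orth W)%VS = 0%VS]].

Hypothesis params : form_parameters sigma eps Lambda.
Hypothesis sesq : sesquilinear sigma q.

Let sigmaK : involutive sigma. Proof. by case: params. Qed.

Let LambdaB a b : a \in Lambda -> b \in Lambda -> a - b \in Lambda.
Proof. by case: params => _ _ closedB _ _; exact: closedB. Qed.

Let Lambda0 : 0 \in Lambda.
Proof. by case: params => _ _ _ /(_ 0); rewrite rmorph0 mulr0 subr0. Qed.

Let LambdaD a b : a \in Lambda -> b \in Lambda -> a + b \in Lambda.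
Proof. by move=> aL bL; rewrite -[b]opprK -[- b]add0r !LambdaB ?Lambda0. Qed.

Lemma omegaC v w : om w v = eps * sigma (om v w).
Proof.
rewrite /om /omega rmorphD rmorphM sigmaK mulrDr mulrA.
by case: params => _ -> _ _ _; rewrite mul1r addrC.
Qed.

Lemma omega_eq0C v w : om v w = 0 -> om w v = 0.
Proof. by move=> vw; rewrite omegaC vw rmorph0 mulr0. Qed.

Lemma omegaDr u v w : om u (v + w) = om u v + om u w.
Proof. by case: sesq => qDl qDr _; rewrite /om /omega qDl qDr rmorphD mulrDr addrACA. Qed.

Lemma omegaZr u a v : om u (a *: v) = om u v * a.
Proof.
case: sesq => _ _ qZ; rewrite /om /omega -{1}(scale1r u) -{2}(scale1r u) !qZ rmorph1 mul1r mulr1.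
by rewrite rmorphM sigmaK mulrDl (mulrC a) mulrA.
Qed.

Lemma omegaDl u v w : om (u + v) w = om u w + om v w.
Proof. by rewrite omegaC omegaDr rmorphD mulrDr -!omegaC. Qed.

Lemma omegaZl a u v : om (a *: u) v = sigma a * om u v.
Proof. by rewrite omegaC omegaZr rmorphM mulrA -omegaC mulrC. Qed.

Lemma omegaBr u v w : om u (v - w) = om u v - om u w.
Proof. by rewrite -scaleN1r omegaDr omegaZr mulrN1. Qed.

Lemma omega0l v : om 0 v = 0.
Proof. by rewrite -(scale0r 0) omegaZl rmorph0 mul0r. Qed.

Lemma omega_Qzero v : Qz v -> om v v = 0.
Proof. by case: params => _ _ _ _; apply. Qed.

Lemma QzeroD u v : om u v = 0 -> Qz u -> Qz v -> Qz (u + v).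
Proof.
rewrite /Qz /Qzero /om /omega => uv Qu Qv; case: sesq => qDl qDr _; rewrite qDl !qDr.
have -> : q u u + q u v + (q v u + q v v) = (q u u + q v v) + (q v u - eps * sigma (q v u)).
  by have -> : q u v = - (eps * sigma (q v u)); [apply/eqP; rewrite -addr_eq0 uv|ring].
by apply: LambdaD; [exact: LambdaD|case: params].
Qed.

Lemma orthP U v : reflect (forall u, u \in U -> om u v = 0) (v \in orth U).
Proof.
have lin : linear (fun v => \row_(i < \dim U) om (vbasis U)`_i v : 'rV_(\dim U)).
  by move=> a x y; apply/rowP => i; rewrite !mxE omegaDr omegaZr mulrC.
pose f : {linear E -> 'rV[F]_(\dim U)} :=
  HB.pack (fun v => \row_(i < \dim U) om (vbasis U)`_i v : 'rV_(\dim U))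
    (GRing.isLinear.Build F E _ _ _ lin).
rewrite /orth memv_ker (lfunE f); apply: (iffP eqP) => [/rowP fv u uU|uv].
  rewrite (coord_vbasis uU) (big_morph (om^~ v) (fun x y => omegaDl x y v) (omega0l v)).
  by rewrite big1 // => i _; have := fv i; rewrite !mxE omegaZl => ->; rewrite mulr0.
by apply/rowP => i; rewrite !mxE uv // vbasis_mem ?mem_nth ?size_tuple.
Qed.

Lemma omega_orth U u v : v \in orth U -> u \in U -> om u v = 0.
Proof. by move=> /orthP; apply. Qed.

Lemma omega_orthC U u v : v \in orth U -> u \in U -> om v u = 0.
Proof. by move=> vU uU; apply: omega_eq0C; exact: omega_orth vU uU. Qed.

Lemma orthS U V : (U <= V)%VS -> (orth V <= orth U)%VS.
Proof. by move=> /subvP UV; apply/subvP => v /orthP vV; apply/orthP => u /UV/vV. Qed.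

Lemma sub_orthC U V : (U <= orth V)%VS = (V <= orth U)%VS.
Proof.
suff sub X Y : (X <= orth Y)%VS -> (Y <= orth X)%VS by apply/idP/idP; exact: sub.
by move=> /subvP XY; apply/subvP => y yY; apply/orthP => x /XY xY; exact: omega_orthC xY yY.
Qed.

Lemma orth_line z v : (v \in orth <[z]>%VS) = (om z v == 0).
Proof.
apply/orthP/eqP => [|zv _ /vlineP[c ->]]; first by apply; exact: memv_line.
by rewrite omegaZl zv mulr0.
Qed.

Lemma orthD U V : orth (U + V) = (orth U :&: orth V)%VS.
Proof.
apply/eqP; rewrite eqEsubv subv_cap !orthS ?addvSl ?addvSr //=; apply/subvP => v.
rewrite memv_cap => /andP[/orthP vU /orthP vV].
by apply/orthP => _ /memv_addP[a aU [b bV ->]]; rewrite omegaDl vU // vV // addr0.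
Qed.

Lemma formker_sub_orth U : (formker <= orth U)%VS.
Proof. exact/orthS/subvf. Qed.

Lemma formkerP v : reflect (Kset sigma eps q v) (v \in formker).
Proof. by apply: (iffP (orthP _ _)) => [vE u|vE u _]; [exact/vE/memvf|exact: vE]. Qed.

Lemma codim_orth M C : (\dim M <= \dim (M :&: orth C) + \dim C)%N.
Proof.
rewrite -{1}(limg_ker_dim (linfun (fun v => \row_(i < \dim C) om (vbasis C)`_i v)) M).
rewrite leq_add2l; apply: leq_trans (dimvS (subvf _)) _.
by rewrite dimvf /dim /= mul1n.
Qed.

Lemma dim_orth_swap M W : (\dim M + \dim (W :&: orth M) = \dim W + \dim (M :&: orth W))%N.
Proof.
suff le M' W' : (\dim M' + \dim (W' :&: orth M') <= \dim W' + \dim (M' :&: orth W'))%N.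
  by apply/eqP; rewrite eqn_leq !le.
pose C := (W' :\: orth M')%VS; have := dimv_cap_compl W' (orth M'); rewrite -/C.
have <- : (M' :&: orth C)%VS = (M' :&: orth W')%VS.
  rewrite -{1}(addv_diff_cap W' (orth M')) orthD capvA; apply/esym/capv_idPl.
  by apply: subv_trans (capvSl _ _) _; rewrite sub_orthC capvSr.
by have := codim_orth M' C; lia.
Qed.

Lemma dim_cap_orth Y Z : (Z :&: orth Y = 0)%VS -> (\dim (Y :&: orth Z) + \dim Z = \dim Y)%N.
Proof. by move=> ZY; have := dim_orth_swap Z Y; rewrite ZY dimv0; lia. Qed.

Lemma dim_orth X : (\dim (orth X) + \dim X = \dim {:E} + \dim (X :&: formker))%N.
Proof. by rewrite -dim_orth_swap capfv addnC. Qed.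

Lemma orth_orth X : orth (orth X) = (X + formker)%VS.
Proof.
apply/esym/eqP; rewrite eqEdim subv_add sub_orthC subvv formker_sub_orth /=.
have := dim_orth X; have := dim_orth (orth X); have := dimv_sum_cap X formker.
by rewrite (capv_idPr (formker_sub_orth X)); lia.
Qed.

Lemma dim_addv_orth W Z :
  (\dim (W + orth Z) + \dim (Z :&: orth W) = \dim {:E} + \dim (Z :&: formker))%N.
Proof.
have := dimv_sum_cap W (orth Z); have := dim_orth Z; have := dim_orth_swap Z W.
by lia.
Qed.

Lemma orth_addv_formker X : orth (X + formker) = orth X.
Proof. by rewrite orthD; apply/capv_idPl; rewrite sub_orthC formker_sub_orth. Qed.

Lemma orth_cap_orth W X : orth (W :&: orth X) = (orth W + X)%VS.
Proof.
rewrite -[LHS]orth_addv_formker capvC vspace_modr ?formker_sub_orth // capvC -orth_orth.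
by rewrite -orthD orth_orth -addvA (addvC X) addvA (addv_idPl (formker_sub_orth W)).
Qed.

Lemma omega_off_orth A z : z \notin (A + formker)%VS -> exists2 v, v \in orth A & om z v != 0.
Proof.
rewrite -orth_orth => zA; apply: contrapT => none; case/negP: zA; apply/orthP => v vA.
by apply: omega_eq0C; apply: contrapT => /eqP zv; apply: none; exists v.
Qed.

Lemma isotropicS W V : (W <= V)%VS -> iso V -> iso W.
Proof. by move=> /subvP WV [om0 Q0]; split=> [v w /WV vV /WV|v /WV]; [exact: om0|exact: Q0]. Qed.

Lemma isotropic_sub_orth W : iso W -> (W <= orth W)%VS.
Proof. by move=> [om0 _]; apply/subvP => v vW; apply/orthP => u uW; exact: om0. Qed.

Lemma isotropic0 : iso 0%VS.
Proof.
split=> [v w|v]; rewrite !memv0 => /eqP ->; first by move=> _; exact: omega0l.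
have [qDl _ _] := sesq; have := qDl 0 0 0; rewrite addr0 => /eqP.
by rewrite addrC -subr_eq subrr eq_sym /Qz /Qzero => /eqP ->.
Qed.

Lemma isotropic_dim_le W : iso W -> (\dim W <= witt_index)%N.
Proof.
move=> isoW; have dimW : (\dim W < (\dim {:E}).+1)%N by rewrite ltnS dimvS ?subvf.
rewrite -[\dim W]/(Ordinal dimW : nat) /witt_index.
by apply: leq_bigmax_cond; apply/asboolP; exists W.
Qed.

Lemma witt_index_attained : exists2 M, iso M & \dim M = witt_index.
Proof.
pose P (d : 'I_(\dim {:E}).+1) := `[< exists2 W, iso W & \dim W = d >].
have [|d + dimM] := @eq_bigmax_cond _ P (@nat_of_ord _).
  apply/card_gt0P; exists ord0; apply/asboolP.
  by exists 0%VS; [exact: isotropic0|exact: dimv0].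
by move=> /asboolP[M isoM dM]; exists M; rewrite // dM -dimM.
Qed.

Lemma isotropic_vector A : iso A -> (\dim A < witt_index)%N ->
  exists v, [/\ v \in orth A, Qz v & v \notin A].
Proof.
move=> isoA dimA; have [M isoM dimM] := witt_index_attained.
have /subvPn[v] : ~~ (M :&: orth A <= A)%VS.
  apply/negP => MA; have : (M :&: orth A <= A :&: orth M)%VS.
    by rewrite subv_cap MA (subv_trans (capvSl _ _) (isotropic_sub_orth isoM)).
  by move/dimvS; have := dim_orth_swap M A; lia.
by rewrite memv_cap => /andP[vM vA] vnA; exists v; split=> //; case: isoM => _; apply.
Qed.

Hypothesis Lambda_stable : forall a c, c \in Lambda -> sigma a * c * a \in Lambda.

Lemma QzeroZ a v : Qz v -> Qz (a *: v).
Proof. by rewrite /Qz /Qzero => Qv; case: sesq => _ _ ->; exact: Lambda_stable. Qed.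

(* Modulo [Lambda], the equation [q (v + c *: u) (v + c *: u) = 0] is linear in [sigma c]. *)
Lemma isotropize u v : Qz u -> om u v != 0 -> exists c, Qz (v + c *: u).
Proof.
move=> Qu uv; pose d := - (q v v) / om u v; exists (sigma d).
rewrite /Qz /Qzero; case: sesq => qDl qDr qZ; rewrite qDl !qDr.
have qZr a x y : q x (a *: y) = q x y * a by rewrite -{1}(scale1r x) qZ rmorph1 mul1r.
have qZl a x y : q (a *: x) y = sigma a * q x y by rewrite -{1}(scale1r y) qZ mulr1.
rewrite qZ qZr qZl sigmaK; set x := q v u * sigma d.
have -> : q v v + x + (d * q u v + d * q u u * sigma d) =
    (q v v + d * om u v) + (x - eps * sigma x) + sigma (sigma d) * q u u * sigma d.
  by rewrite /x /om /omega rmorphM sigmaK; ring.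
rewrite /d divfK // subrr add0r; apply: LambdaD; last exact: Lambda_stable.
by case: params.
Qed.

Lemma isotropic_addv_line W v : iso W -> Qz v -> v \in orth W -> iso (W + <[v]>).
Proof.
move=> [om0 Q0] Qv vW; split.
  move=> _ _ /memv_addP[a aW [_ /vlineP[c ->] ->]] /memv_addP[b bW [_ /vlineP[d ->] ->]].
  rewrite -/om !omegaDl !omegaDr !omegaZl !omegaZr [om a b]om0 // (omega_Qzero Qv).
  by rewrite (omega_orth vW) // (omega_orthC vW) // !(mul0r, mulr0) !addr0.
move=> _ /memv_addP[a aW [_ /vlineP[c ->] ->]]; apply: QzeroD.
- by rewrite omegaZr (omega_orth vW) // mul0r.
- exact: Q0.
- exact: QzeroZ.
Qed.

Lemma isotropic_extension W d : iso W -> (\dim W <= d <= witt_index)%N ->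
  exists V, [/\ iso V, (W <= V)%VS & \dim V = d].
Proof.
move=> isoW /andP[]; rewrite leq_eqVlt => /predU1P[<- _|]; first by exists W.
elim: d => // d IH Wd d_lt.
have [V [isoV WV dimV]] : exists V, [/\ iso V, (W <= V)%VS & \dim V = d].
  rewrite ltnS leq_eqVlt in Wd; case/predU1P: Wd => [<-|Wd]; first by exists W.
  by apply: IH => //; exact: ltnW.
have [|v [vV Qv vnV]] := isotropic_vector isoV; first by rewrite dimV.
exists (V + <[v]>)%VS; rewrite dim_addv_line vnV dimV addn1; split=> //.
  exact: isotropic_addv_line.
exact: subv_trans WV (addvSl _ _).
Qed.

Section PerpAbove.
Variables (A : {vspace E}) (v : E).
Hypotheses (isoA : iso A) (vA : v \in orth A) (Qv : Qz v) (vnA : v \notin A).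
Let o := orth <[v]>%VS.

Let Ao : (A <= o)%VS. Proof. by rewrite sub_orthC -memvE. Qed.

Lemma iso_above_perp_constructible N :
  vconstructible N [set W | iso_above A W /\ (W <= o)%VS].
Proof.
have vo : (<[v]> <= o)%VS by rewrite -memvE orth_line omega_Qzero.
have iso_addv W : iso W -> (W <= o)%VS -> iso (W + <[v]>).
  by move=> isoW Wo; apply: isotropic_addv_line => //; rewrite memvE sub_orthC.
pose S := [set W | iso_above A W /\ (W <= o)%VS].
have -> : [set W | iso_above A W /\ (W <= o)%VS] = [set W | S W /\ S (W + <[v]>)%VS].
  apply/seteqP; split=> W; last by move=> [].
  move=> [[isoW AW] Wo]; split=> //; split; last by rewrite subv_add Wo.
  split; first exact: iso_addv.
  have [vW|vW] := boolP (v \in W); first by rewrite (addv_idPl _) // -memvE.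
  exact: (ranked_plt_trans (ranked_vsub E) AW (vlt_addv_line vW)).
apply: constructible_addv; apply: (@constructible_bottom _ _ _ _ (A + <[v]>)%VS) => [|W].
  split; last exact: addvSr.
  by split; [split; [exact: iso_addv|exact: vlt_addv_line]|rewrite subv_add Ao].
by move=> [[[_ /andP[AW _]] _] vW]; rewrite /vsub_le subv_add vW andbT.
Qed.

Lemma iso_above_cap_perp W : iso W -> vlt A W -> ((W :&: o)%VS != A) -> iso_above A (W :&: o)%VS.
Proof.
move=> isoW /andP[AW _] WA; split; first exact: isotropicS (capvSl _ _) isoW.
by rewrite /plt /vsub_le subv_cap Ao [(A <= W)%VS]AW eq_sym.
Qed.

End PerpAbove.

Lemma dim_cap_orth_line W v : (\dim W <= (\dim (W :&: orth <[v]>)).+1)%N.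
Proof. by have := codim_orth W <[v]>%VS; rewrite dim_vline; case: (v != 0); lia. Qed.

(* For [v] orthogonal to [A], the [W] whose intersection with [v^perp] is larger than [A]
   contract to [A + <[v]>]; the other ones contain [A] with codimension one. *)
Lemma iso_above_constructible A : iso A -> vconstructible (witt_index - \dim A) (iso_above A).
Proof.
suff bounded N B : iso B -> (N <= witt_index - \dim B)%N -> vconstructible N (iso_above B).
  by move=> isoA; exact: bounded.
elim: N B => [|N IH] {}A isoA dimA; first exact: constructible0.
have [|v [vA Qv vnA]] := isotropic_vector isoA; first by lia.
pose S := iso_above A; pose o := orth <[v]>%VS.
apply: (constructible_attach_increasing (ranked_vsub E) (S0 := [set W | S W /\ S (W :&: o)%VS])).
- by move=> W [].
- exact/constructible_capv/iso_above_perp_constructible.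
move=> V SV nSVo; have [isoV AV] := SV; exists 0%N, N; split=> //; first exact: constructible0.
have VoA : (V :&: o)%VS = A.
  by apply: contrapT => /eqP VoA; apply: nSVo; split=> //; exact: iso_above_cap_perp.
have dimV : (\dim V = (\dim A).+1)%N.
  by have := dim_cap_orth_line V v; have := vlt_dim AV; rewrite -/o VoA; clear; lia.
have -> : [set W | (S W /\ S (W :&: o)%VS) /\ vlt V W] = iso_above V.
  apply/seteqP; split=> W; first by move=> [[[isoW _] _]].
  move=> [isoW VW]; have AW := ranked_plt_trans (ranked_vsub E) AV VW.
  split=> //; split; [by split|apply: iso_above_cap_perp => //]; apply/eqP => WoA.
  have := dim_cap_orth_line W v; have := vlt_dim VW; rewrite -/o WoA dimV.
  by clear; lia.
by apply: IH => //; rewrite dimV; move: dimA; clear; lia.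
Qed.

Lemma opposite_up A Z V W : opposite A Z V -> iso W -> (V <= W)%VS -> opposite A Z W.
Proof.
move=> [_ AV ZV] isoW VW; split=> //; first exact: subv_trans AV VW.
by apply/eqP; rewrite -subv0 -ZV capvS // orthS.
Qed.

Lemma opposite_sub A Z V W : opposite A Z V -> (W <= V)%VS ->
  opposite A Z W <-> (A <= W)%VS /\ (W + (V :&: orth Z))%VS = V.
Proof.
move=> [isoV AV ZV] WV; split=> [[isoW AW ZW]|[AW WZ]]; split=> //.
- apply/eqP; rewrite eqEdim subv_add WV capvSl /=.
  have := dimv_sum_cap W (V :&: orth Z)%VS; rewrite capvA (capv_idPl WV).
  by have := dim_cap_orth ZW; have := dim_cap_orth ZV; lia.
- exact: isotropicS WV isoV.
- apply/eqP; rewrite -subv0 -ZV subv_cap capvSl -WZ orthD subv_cap capvSr.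
  by apply: subv_trans (capvSl _ _) _; rewrite sub_orthC capvSr.
Qed.

Lemma opposite_below A Z V : opposite A Z V ->
  [set W | opposite A Z W /\ vlt W V] = supplements A V (V :&: orth Z)%VS V.
Proof.
move=> SV; apply/seteqP; split=> W.
  rewrite /= vltE => -[SW /andP[WV VW]]; have [AW WZ] := (opposite_sub SV WV).1 SW.
  by split=> //; apply: contraNneq VW => ->; exact: subvv.
move=> [AW WZ W_neq_V VW]; have WV : (W <= V)%VS by rewrite -WZ addvSl.
by split; [exact/(opposite_sub SV WV)|rewrite vltE WV].
Qed.

Lemma opposite_line A y W : y != 0 ->
  opposite A <[y]> W <-> [/\ iso W, (A <= W)%VS & y \notin orth W].
Proof.
move=> y0; split=> -[isoW AW yW]; split=> //.
  apply: contra y0 => y_orth; rewrite -memv0 -yW memv_cap memv_line y_orth //.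
apply/eqP; rewrite -subv0; apply/subvP => x; rewrite memv_cap => /andP[/vlineP[c ->]].
by rewrite rpredZeq (negPf yW) orbF => /eqP ->; rewrite scale0r mem0v.
Qed.

Section OppositeRank.
Variables (A Z : {vspace E}).
Hypothesis ZA : (Z <= orth A)%VS.

Lemma opposite_dim W : opposite A Z W -> (\dim A + \dim Z <= \dim W <= witt_index)%N.
Proof.
move=> [isoW AW ZW]; rewrite isotropic_dim_le // andbT -(dim_cap_orth ZW) leq_add2r dimvS //.
by rewrite subv_cap AW sub_orthC.
Qed.

Lemma opposite_below_constructible V : opposite A Z V ->
  vconstructible (\dim V - (\dim A + \dim Z)) [set W | opposite A Z W /\ vlt W V].
Proof.
move=> SV; have [_ AV ZV] := SV; have dimV := dim_cap_orth ZV.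
have [VA|VA] := boolP (V <= A)%VS.
  have /eqP -> : (\dim V - (\dim A + \dim Z) == 0)%N; last exact: constructible0.
  by rewrite subn_eq0; have := dimvS VA; lia.
rewrite opposite_below // -[X in (X - _)%N]dimV subnDr.
by apply: supplements_constructible; rewrite // ?capvSl // subv_cap AV sub_orthC.
Qed.

Lemma opposite_restriction V d : opposite A Z V -> (\dim A + \dim Z <= d <= \dim V)%N ->
  exists W, [/\ opposite A Z W, (W <= V)%VS & \dim W = d].
Proof.
move=> SV /andP[d_ge d_le]; have [_ AV ZV] := SV.
pose D := (V :&: orth Z)%VS; pose W0 := (A + (V :\: D))%VS.
have W0V : (W0 <= V)%VS by rewrite subv_add AV diffvSl.
have dimW0 : (\dim W0 <= \dim A + \dim Z)%N.
  have := dimv_sum_cap A (V :\: D)%VS; have := dimv_cap_compl V D.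
  by rewrite (capv_idPr (capvSl _ _)) -(dim_cap_orth ZV) -/D -/W0; clear; lia.
have [|W [W0W WV dimW]] := subspace_between W0V (d := d).
  by rewrite (leq_trans dimW0 d_ge).
exists W; split=> //; apply/(opposite_sub SV WV); split; first exact: subv_trans (addvSl _ _) W0W.
apply/eqP; rewrite eqEsubv subv_add WV capvSl /= -/D.
apply: (@subv_trans _ _ (W0 + D)%VS); last exact: addvS.
by rewrite /W0 -addvA addv_diff (subv_trans (addvSl V D)) ?addvSr.
Qed.

End OppositeRank.

Lemma opposite0_constructible A N : iso A -> vconstructible N (opposite A 0).
Proof.
move=> isoA; apply: (@constructible_bottom _ _ _ _ A) => [|W []//].
by split; [|exact: subvv|exact: cap0v].
Qed.

Lemma contains_radicalS A X : (A <= X)%VS -> contains_radical A -> contains_radical X.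
Proof. by move=> /subvP AX RA v /RA/AX. Qed.

Lemma cap_addv_formker X W : contains_radical X -> iso W -> (X <= W)%VS ->
  (W :&: (X + formker))%VS = X.
Proof.
move=> RX [_ Q0] XW; rewrite capvC -vspace_modl //; apply/addv_idPl/subvP => v.
by rewrite memv_cap => /andP[/formkerP vK vW]; apply: RX; split=> //; exact: Q0.
Qed.

Section Contraction.
Variables (A Z : {vspace E}) (w : E).
Hypotheses (wA : w \in orth A) (Qw : Qz w).
Let o := orth <[w]>%VS.
Let S := opposite A Z.
Let S_cap_o := [set W | S W /\ S (W :&: o)%VS].

Let Ao : (A <= o)%VS. Proof. by rewrite sub_orthC -memvE. Qed.

Lemma opposite_containing :
  [set W | S W /\ (<[w]> <= W)%VS] = opposite (A + <[w]>) (Z :&: o).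
Proof.
have cap_o W : (<[w]> <= W)%VS -> (Z :&: o :&: orth W = Z :&: orth W)%VS.
  by move=> wW; rewrite -capvA (capv_idPr (orthS wW)).
apply/seteqP; split=> W.
  by move=> [[isoW AW ZW] wW]; split; rewrite ?cap_o // subv_add AW.
by rewrite /opposite /= => -[isoW + ZW]; rewrite subv_add => /andP[AW wW]; rewrite cap_o // in ZW.
Qed.

Lemma opposite_cap_constructible N :
  vconstructible N (opposite (A + <[w]>) (Z :&: o)) -> vconstructible N S_cap_o.
Proof.
rewrite -opposite_containing => cSw; apply: constructible_capv.
pose S_o := [set W | S W /\ (W <= o)%VS].
have w_o : (<[w]> <= o)%VS by rewrite -memvE orth_line omega_Qzero.
have -> : [set W | S W /\ (W <= o)%VS] = [set W | S_o W /\ S_o (W + <[w]>)%VS].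
  apply/seteqP; split=> W; last by move=> [].
  move=> [SW Wo]; split=> //; split; last by rewrite subv_add Wo.
  apply: (opposite_up SW); last exact: addvSl.
  by case: SW => isoW _ _; apply: isotropic_addv_line => //; rewrite memvE sub_orthC.
apply: constructible_addv.
suff <- : [set W | S W /\ (<[w]> <= W)%VS] = [set W | S_o W /\ (<[w]> <= W)%VS] by [].
apply/seteqP; split=> W; last by move=> [[]].
move=> [SW wW]; split=> //; split=> //; case: SW => isoW _ _.
by rewrite sub_orthC (subv_trans wW) // isotropic_sub_orth.
Qed.

Definition shadow W y := [/\ y \in orth W, w - y \in Z & y != w].

Lemma shadowP W : S W -> (exists y, shadow W y) <-> ~ S_cap_o W.
Proof.
move=> SW; have [isoW AW ZW] := SW; split=> [[y [yW zZ y_neq_w]] [_ [_ _]]|nSWo].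
  rewrite orth_cap_orth => ZWw; case/negP: y_neq_w.
  rewrite eq_sym -subr_eq0 -memv0 -ZWw memv_cap zZ /= addrC.
  by rewrite memv_add ?rpredN ?memv_line.
have /subvPn[x] : ~~ (Z :&: (orth W + <[w]>) <= 0)%VS.
  rewrite subv0; apply/eqP => ZWw; apply: nSWo; split=> //; split.
  - exact: isotropicS (capvSl _ _) isoW.
  - by rewrite subv_cap AW.
  - by rewrite orth_cap_orth.
rewrite memv_cap => /andP[xZ /memv_addP[x' x'W [_ /vlineP[c ->] x_def]]]; rewrite memv0 => x0.
have c0 : c != 0.
  apply: contra x0 => /eqP c0; rewrite -memv0 -ZW memv_cap xZ /=.
  by rewrite x_def c0 scale0r addr0.
have w_def : w - - (c^-1 *: x') = c^-1 *: x.
  by rewrite x_def scalerDr scalerA mulVf // scale1r opprK addrC.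
exists (- (c^-1 *: x')); split.
- by rewrite rpredN rpredZ.
- by rewrite w_def rpredZ.
- by rewrite eq_sym -subr_eq0 w_def scaler_eq0 invr_eq0 negb_or c0.
Qed.

Lemma shadow_uniq W y y' : S W -> shadow W y -> shadow W y' -> y = y'.
Proof.
move=> [_ _ ZW] [yW zZ _] [y'W z'Z _]; apply/eqP; rewrite -subr_eq0 -memv0 -ZW memv_cap.
apply/andP; split; last exact: rpredB.
by have -> : y - y' = (w - y') - (w - y); [rewrite opprB [RHS]addrC addrA subrK|exact: rpredB].
Qed.

Lemma shadowS W X y : (X <= W)%VS -> shadow W y -> shadow X y.
Proof. by move=> XW [yW zZ y_neq_w]; split=> //; exact: (subvP (orthS XW)). Qed.

Lemma opposite_cap_above W y : S W -> shadow W y -> y \notin (W + formker)%VS ->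
  [set X | S_cap_o X /\ vlt W X] = opposite W <[y]>.
Proof.
move=> SW Wy yWK; have [yW zZ y_neq_w] := Wy.
have y0 : y != 0 by apply: contraNneq yWK => ->; exact: mem0v.
have capP X : S X -> (W <= X)%VS -> S_cap_o X <-> y \notin orth X.
  move=> SX WX; split=> [|yX].
    by apply: contraPN => yX; apply/(shadowP SX); exists y.
  apply: contrapT => /(shadowP SX)[y' Xy']; case/negP: yX.
  by rewrite (shadow_uniq SW Wy (shadowS WX Xy')); case: Xy'.
apply/seteqP; split=> X.
  move=> [SXo /andP[WX _]]; have [SX _] := SXo.
  by apply/(opposite_line _ _ y0); split=> //; [case: SX|exact/capP].
move=> /(opposite_line _ _ y0)[isoX WX yX]; have SX := opposite_up SW isoX WX.
split; first exact/capP.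
by rewrite /plt /vsub_le WX; apply: contraNneq yX => <-.
Qed.

Hypotheses (RA : contains_radical A) (ZA : (Z <= orth A)%VS).
Hypotheses (Zo : ~~ (Z <= o)%VS) (Z_orth_o : (Z <= orth (Z :&: o))%VS).

Lemma shadow_off W y : shadow W y -> y \notin (A + formker)%VS.
Proof.
move=> [_ zZ _]; apply/negP => yAK.
have om_y u : u \in orth A -> om u y = 0.
  by rewrite -orth_addv_formker => uA; exact: omega_orthC uA yAK.
have zZo : w - y \in (Z :&: o)%VS.
  by rewrite memv_cap zZ orth_line omegaBr om_y // (omega_Qzero Qw) subr0 eqxx.
case/negP: Zo; apply/subvP => z z_Z; rewrite orth_line; apply/eqP/omega_eq0C.
have := omega_orthC (subvP Z_orth_o _ z_Z) zZo.
by rewrite omegaBr om_y ?subr0 //; exact: subvP ZA _ z_Z.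
Qed.

Definition unshadowed := [set W | S W /\ forall y, shadow W y -> y \notin (W + formker)%VS].

Let N := (witt_index.+1 - (\dim A + \dim Z))%N.

Let attach_dim W : S W ->
  (N.-1 <= (\dim W - (\dim A + \dim Z)) + (witt_index - \dim W))%N.
Proof. by move=> /(opposite_dim ZA); rewrite /N; lia. Qed.

Lemma unshadowed_constructible :
  (forall W y, S W -> y \in orth W -> y \notin (W + formker)%VS ->
     vconstructible (witt_index - \dim W) (opposite W <[y]>)) ->
  vconstructible N S_cap_o -> vconstructible N unshadowed.
Proof.
move=> line; move/(constructible_attach_increasing (ranked_vsub E)); apply.
  by move=> W [SW SWo]; split=> // y Wy; case: (shadowP SW).1 => //; exists y.
move=> W [SW unW] nSWo; have [y Wy] : exists y, shadow W y.
  by apply/(shadowP SW).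
exists (\dim W - (\dim A + \dim Z))%N, (witt_index - \dim W)%N; split; first exact: attach_dim.
  suff -> : [set X | unshadowed X /\ vlt X W] = [set X | S X /\ vlt X W].
    exact: opposite_below_constructible.
  apply/seteqP; split=> X; first by move=> [[]].
  move=> [SX XW]; split=> //; split=> // y' Xy'; have /andP[XW' _] := XW.
  rewrite (shadow_uniq SX Xy' (shadowS XW' Wy)).
  by apply: contra (unW y Wy); apply/subvP/addvS.
by rewrite (opposite_cap_above SW Wy) ?unW //; apply: line => //; [case: Wy|exact: unW].
Qed.

Lemma unshadowed_below W y t : S W -> shadow W y -> t \in W -> y - t \in formker ->
  [set X | unshadowed X /\ vlt X W] = supplements A W (W :&: orth Z) <[t]>.
Proof.
move=> SW Wy tW ytK; have [isoW _ _] := SW.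
have unshadowedP X : S X -> (X <= W)%VS -> unshadowed X <-> t \notin X.
  move=> SX XW; have Xy := shadowS XW Wy; have [_ AX _] := SX.
  have tX : (y \in (X + formker)%VS) = (t \in X).
    rewrite -[y](subrK t) rpredDl; last exact: subvP (addvSr X _) _ ytK.
    by rewrite -{2}(cap_addv_formker (contains_radicalS AX RA) isoW XW) memv_cap tW.
  split=> [[_ /(_ y Xy)]|tnX]; first by rewrite tX.
  by split=> // y' Xy'; rewrite (shadow_uniq SX Xy' Xy) tX.
have below := opposite_below SW; apply/seteqP; split=> X.
  move=> [unX XW]; have [SX _] := unX; have XW' : (X <= W)%VS by case/andP: XW.
  have [AX XZ X_neq_W _] : supplements A W (W :&: orth Z)%VS W X by rewrite -below.
  by split=> //; rewrite -memvE; exact/unshadowedP.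
move=> [AX XZ X_neq_W]; rewrite -memvE => tX.
have [SX XW] : [set X | S X /\ vlt X W] X.
  by rewrite below; split=> //; apply: contra tX => /subvP; apply.
by split=> //; apply/unshadowedP => //; case/andP: XW.
Qed.

Lemma opposite_contraction_constructible :
  (forall W y, S W -> y \in orth W -> y \notin (W + formker)%VS ->
     vconstructible (witt_index - \dim W) (opposite W <[y]>)) ->
  vconstructible N (opposite (A + <[w]>) (Z :&: o)) -> vconstructible N S.
Proof.
move=> line cSw; have := unshadowed_constructible line (opposite_cap_constructible cSw).
move/(constructible_attach_decreasing (ranked_vsub E)); apply=> [W []//|W SW shadowedW].
have [isoW AW ZW] := SW.
have [y Wy yWK] : exists2 y, shadow W y & y \in (W + formker)%VS.
  apply: contrapT => none; apply: shadowedW; split=> // y Wy.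
  by apply/negP => yWK; apply: none; exists y.
have /memv_addP[t tW [k kK y_def]] := yWK.
exists (\dim W - (\dim A + \dim Z))%N, (witt_index - \dim W)%N; split; first exact: attach_dim.
  rewrite (unshadowed_below SW Wy tW); last by rewrite y_def addrAC subrr add0r.
  rewrite -{1}(dim_cap_orth ZW) subnDr; apply: supplements_constructible.
  - by rewrite subv_cap AW sub_orthC.
  - exact: capvSl.
  - by rewrite -memvE; apply: contra (shadow_off Wy) => tA; rewrite y_def memv_add.
have -> : [set X | S X /\ vlt W X] = iso_above W; last exact: iso_above_constructible.
apply/seteqP; split=> X; first by move=> [[isoX _ _]].
by move=> [isoX WX]; split=> //; apply: (opposite_up SW isoX); case/andP: WX.
Qed.

End Contraction.

Lemma isotropic_off_orth A z : iso A -> contains_radical A -> (\dim A < witt_index)%N ->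
  z \notin (A + formker)%VS -> exists w, [/\ w \in orth A, Qz w & om z w != 0].
Proof.
move=> isoA RA dimA zAK; have [p [pA Qp npA]] := isotropic_vector isoA dimA.
have [zp|zp] := eqVneq (om z p) 0; last by exists p.
have pAK : p \notin (A + formker)%VS.
  have isoAp := isotropic_addv_line isoA Qp pA.
  apply: contra npA => pAK; rewrite -(cap_addv_formker RA isoAp (addvSl _ _)) memv_cap pAK.
  by rewrite (subvP (addvSr A _)) ?memv_line.
have [[v vA zv] [u uA pu]] := (omega_off_orth zAK, omega_off_orth pAK).
have [x [xA zx px]] : exists x, [/\ x \in orth A, om z x != 0 & om p x != 0].
  have [zu|zu] := eqVneq (om z u) 0; last by exists u.
  have [pv|pv] := eqVneq (om p v) 0; last by exists v.
  by exists (v + u); split; [rewrite rpredD|rewrite omegaDr zu addr0|rewrite omegaDr pv add0r].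
have [c Qc] := isotropize Qp px.
by exists (x + c *: p); split; [rewrite rpredD ?memvZ| |rewrite omegaDr omegaZr zp mul0r addr0].
Qed.

Lemma opposite_line_constructible A z : iso A -> contains_radical A -> z \in orth A ->
  z \notin (A + formker)%VS -> vconstructible (witt_index - \dim A) (opposite A <[z]>).
Proof.
have [n] := ubnP (witt_index - \dim A)%N; elim: n A z => // n IH A z dimA isoA RA zA zAK.
have [A_max|A_lt] := leqP witt_index (\dim A).
  by have /eqP -> : (witt_index - \dim A == 0)%N; [rewrite subn_eq0|exact: constructible0].
have [w [wA Qw zw]] := isotropic_off_orth isoA RA A_lt zAK.
have z0 : z != 0 by apply: contraNneq zAK => ->; exact: mem0v.
have zw_line : z \notin orth <[w]> by rewrite orth_line; apply: contra zw => /eqP/omega_eq0C ->.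
have cap0 : (<[z]> :&: orth <[w]>)%VS = 0%VS.
  apply/eqP; rewrite -subv0; apply/subvP => x; rewrite memv_cap => /andP[/vlineP[c ->]].
  by rewrite rpredZeq (negPf zw_line) orbF => /eqP ->; rewrite scale0r mem0v.
have zA_line : (<[z]> <= orth A)%VS by rewrite -memvE.
have -> : (witt_index - \dim A = witt_index.+1 - (\dim A + \dim <[z]>))%N.
  by rewrite dim_vline z0; lia.
apply: (opposite_contraction_constructible wA Qw RA) => //.
- by rewrite cap0 sub_orthC sub0v.
- move=> W y SW yW yWK; have [isoW AW _] := SW.
  apply: IH => //; last exact: contains_radicalS AW RA.
  by have := opposite_dim zA_line SW; move: dimA A_lt; rewrite dim_vline z0; clear; lia.
- by rewrite cap0; exact/opposite0_constructible/isotropic_addv_line.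
Qed.

Lemma isotropic_off_sub_orth A Z : iso Z -> (Z <= orth A)%VS -> Z != 0%VS ->
  (Z :&: (A + formker))%VS = 0%VS ->
  exists w, [/\ w \in orth A, Qz w & ~~ (Z <= orth <[w]>)%VS].
Proof.
move=> [_ Q0] ZA Z0 ZAK; have /subvPn[z z_Z z0] : ~~ (Z <= 0)%VS by rewrite subv0.
have zAK : z \notin (A + formker)%VS.
  by apply: contra z0 => zAK; rewrite -ZAK memv_cap z_Z.
have [v vA zv] := omega_off_orth zAK; have [c Qw] := isotropize (Q0 z z_Z) zv.
exists (v + c *: z); split=> //; first by rewrite rpredD // rpredZ // (subvP ZA).
apply: contra zv => /subvP/(_ z z_Z); rewrite orth_line => /eqP/omega_eq0C.
by rewrite omegaDr omegaZr omega_Qzero ?mul0r ?addr0 => [->|]; [|exact: Q0].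
Qed.

Lemma cap_perp_addv_line A Z w : iso Z -> (Z <= orth A)%VS -> ~~ (Z <= orth <[w]>)%VS ->
  (Z :&: (A + formker))%VS = 0%VS ->
  (Z :&: orth <[w]> :&: (A + <[w]> + formker))%VS = 0%VS.
Proof.
move=> [om0 _] ZA /subvPn[z z_Z zw] ZAK; apply/eqP; rewrite -subv0 -ZAK.
apply/subvP => x; rewrite !memv_cap => /andP[/andP[xZ _]].
move=> /memv_addP[_ /memv_addP[a aA [_ /vlineP[c ->] ->]] [k /formkerP kK x_def]].
have : om z x = 0 by exact: om0.
rewrite xZ x_def !omegaDr omegaZr [om z k]kK (omega_orthC (subvP ZA _ z_Z) aA) addr0 add0r.
move=> /eqP; rewrite mulf_eq0 => /orP[/eqP/omega_eq0C zw0|/eqP ->].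
  by rewrite orth_line zw0 eqxx in zw.
by rewrite scale0r addr0 memv_add //; exact/formkerP.
Qed.

Lemma opposite_constructible A Z : iso A -> contains_radical A -> iso Z -> (Z <= orth A)%VS ->
  (Z :&: (A + formker))%VS = 0%VS ->
  vconstructible (witt_index.+1 - (\dim A + \dim Z)) (opposite A Z).
Proof.
have [n] := ubnP (\dim Z); elim: n A Z => // n IH A Z dimZ isoA RA isoZ ZA ZAK.
have [->|Z0] := eqVneq Z 0%VS; first exact: opposite0_constructible.
have [w [wA Qw Zw]] := isotropic_off_sub_orth isoZ ZA Z0 ZAK.
apply: (opposite_contraction_constructible wA Qw RA) => //.
- by apply: subv_trans (isotropic_sub_orth isoZ) (orthS (capvSl _ _)).
- move=> W y [isoW AW _] yW; apply: opposite_line_constructible => //.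
  exact: contains_radicalS AW RA.
have dimZw : (\dim (Z :&: orth <[w]>) < \dim Z)%N.
  by rewrite vlt_dim // vltE capvSl subv_cap subvv.
apply: (@constructibleW _ _ (witt_index.+1 - (\dim (A + <[w]>) + \dim (Z :&: orth <[w]>)))).
  by have := dim_addv_line A w; move: dimZw; case: (w \notin A); clear=> /=; lia.
apply: IH.
- by move: dimZ dimZw; clear; lia.
- exact: isotropic_addv_line.
- exact: contains_radicalS (addvSl _ _) RA.
- exact: isotropicS (capvSl _ _) isoZ.
- by rewrite orthD subv_cap capvSr andbT; apply: subv_trans (capvSl _ _) ZA.
- exact: cap_perp_addv_line.
Qed.

Section CohenMacaulay.
Variables (A Z : {vspace E}).
Hypotheses (isoA : iso A) (RA : contains_radical A) (isoZ : iso Z) (ZA : (Z <= orth A)%VS).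
Hypothesis ZAK : (Z :&: (A + formker))%VS = 0%VS.
Let X := opposite A Z.
Let lo := (\dim A + \dim Z)%N.
Let rk W := \dim W.

Lemma opposite_dense (x y : ext {vspace E}) d :
  in_ext X x -> in_ext X y -> ext_le (@vsub_le F E) x y ->
  (lower_rank rk lo witt_index x <= d < upper_rank rk lo witt_index y)%N ->
  exists2 W, open_interval (@vsub_le F E) X x y W & rk W = d.
Proof.
case: x y => [|a|] [|b|] //= Xa Xb ab /andP[d_ge d_lt]; try by move: d_ge d_lt; lia.
- have [|W [XW Wb dimW]] := opposite_restriction Xb (d := d); first by rewrite d_ge ltnW.
  by exists W => //; rewrite open_interval_Bot_Mid /=; split=> //; rewrite vltE_dim Wb dimW.
- have [V XV] : exists V, X V.
    apply: (@constructible_inhabited _ (comparable (@vsub_le F E)) 0).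
    apply: constructibleW (opposite_constructible isoA RA isoZ ZA ZAK).
    by move: d_ge d_lt; rewrite /lo; lia.
  rewrite open_interval_Bot_Top; have [d_le|d_gt] := leqP d (\dim V).
    by have [|W [XW _ dimW]] := opposite_restriction XV (d := d); [rewrite d_ge|exists W].
  have [isoV _ _] := XV.
  have [|W [isoW VW dimW]] := isotropic_extension isoV (d := d); first by rewrite ltnW.
  by exists W => //; exact: opposite_up XV isoW VW.
- have [|W [aW Wb dimW]] := subspace_between (ab : (a <= b)%VS) (d := d).
    by rewrite (ltnW d_ge) (ltnW d_lt).
  exists W => //; rewrite open_interval_Mid_Mid /= !vltE_dim aW Wb dimW d_ge d_lt; split=> //.
  by apply: (opposite_up Xa) aW; case: Xb => isoB _ _; exact: isotropicS Wb isoB.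
have [isoa _ _] := Xa.
have [|W [isoW aW dimW]] := isotropic_extension isoa (d := d); first by rewrite ltnW.
exists W => //; rewrite open_interval_Mid_Top /= vltE_dim aW dimW d_ge; split=> //.
exact: opposite_up Xa isoW aW.
Qed.

Lemma opposite_interval_constructible (x y : ext {vspace E}) :
  in_ext X x -> in_ext X y -> ext_le (@vsub_le F E) x y ->
  vconstructible (upper_rank rk lo witt_index y - lower_rank rk lo witt_index x)
    (open_interval (@vsub_le F E) X x y).
Proof.
case: x y => [|a|] [|b|] //= Xa Xb ab; rewrite ?subnn; try exact: constructible0.
- by rewrite open_interval_Bot_Mid; exact: opposite_below_constructible.
- by rewrite open_interval_Bot_Top; exact: opposite_constructible.
- rewrite open_interval_Mid_Mid subnS.
  have <- : [set W | vlt a W /\ vlt W b] = [set W | X W /\ (vlt a W /\ vlt W b)].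
    apply/seteqP; split=> W [] // aW Wb; split=> //.
    have [[isob _ _] [/andP[aW' _] /andP[Wb' _]]] := (Xb, conj aW Wb).
    exact: opposite_up Xa (isotropicS Wb' isob) aW'.
  exact: between_constructible.
rewrite open_interval_Mid_Top subSS; have [isoa _ _] := Xa.
have <- : iso_above a = [set W | X W /\ vlt a W]; last exact: iso_above_constructible.
apply/seteqP; split=> W; last by move=> [[]].
by move=> [isoW aW]; split=> //; case/andP: aW => aW _; exact: opposite_up Xa isoW aW.
Qed.

Lemma opposite_cohen_macaulay : cohen_macaulay (@vsub_le F E) X.
Proof.
exact: (constructible_cohen_macaulay (ranked_vsub E) (opposite_dim ZA) opposite_dense
  opposite_interval_constructible).
Qed.

End CohenMacaulay.

Lemma orth_diffv_formker U : orth (U :\: formker) = orth U.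
Proof.
rewrite -[in RHS](addv_diff_cap U formker) orthD; apply/esym/capv_idPl.
by rewrite sub_orthC; apply: subv_trans (capvSr _ _) (formker_sub_orth _).
Qed.

Lemma addv_orth_full W Z : (Z :&: formker)%VS = 0%VS ->
  (W + orth Z == fullv)%VS = (Z :&: orth W == 0)%VS.
Proof.
move=> ZK; have := dim_addv_orth W Z; rewrite ZK dimv0 addn0 eqEdim subvf /= -dimv_eq0.
by clear; lia.
Qed.

Lemma perp_supplementP U W :
  (forall e, exists w x, [/\ w \in W, perp sigma eps q U x & e = w + x]) <->
  ((U :\: formker) :&: orth W)%VS = 0%VS.
Proof.
have perpP x : perp sigma eps q U x <-> x \in orth U.
  by split=> [Ux|/orthP xU u /xU/omega_eq0C//]; apply/orthP => u /Ux/omega_eq0C.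
split=> [WU|/eqP].
  apply/eqP; rewrite -addv_orth_full ?capv_diff // orth_diffv_formker eqEsubv subvf /=.
  by apply/subvP => e _; have [w [x [wW /perpP xU ->]]] := WU e; exact: memv_add.
rewrite -addv_orth_full ?capv_diff // orth_diffv_formker => /eqP WU e.
have : e \in (W + orth U)%VS by rewrite WU memvf.
by move=> /memv_addP[w wW [x xU ->]]; exists w, x; split=> //; exact/perpP.
Qed.

Lemma PomegaU_opposite U : Pomega sigma eps Lambda q U ->
  PomegaU sigma eps Lambda q U = opposite (U :&: formker) (U :\: formker).
Proof.
move=> [isoU RU [u uU u_nRad] _]; set Z := (U :\: formker)%VS.
have RadP v : Rad sigma eps Lambda q v <-> v \in (U :&: formker)%VS.
  rewrite memv_cap; split=> [Rv|/andP[vU /formkerP vK]].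
    by rewrite RU //; apply/formkerP; case: Rv.
  by split=> //; case: isoU => _; apply.
have Z0 : Z != 0%VS.
  apply: contra_notN u_nRad => /eqP Z0; apply/RadP.
  by rewrite -(addv_diff_cap U formker) -/Z Z0 add0v in uU.
apply/seteqP; split=> W; first move=> [[isoW RW _ _] /perp_supplementP ZW].
  by split=> //; apply/subvP => v /RadP/RW.
move=> [isoW UW ZW]; have notZ : ~~ (Z <= orth W)%VS.
  by apply: contra Z0 => /capv_idPl; rewrite ZW => <-.
split; last exact/perp_supplementP.
split=> //.
- by move=> v /RadP; exact: subvP.
- apply: contrapT => WR; case/negP: notZ; rewrite sub_orthC.
  apply: subv_trans (formker_sub_orth Z); apply/subvP => w wW; apply/formkerP.
  by apply: contrapT => wK; apply: WR; exists w => // -[].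
- move=> W_full; case/negP: notZ; apply: subv_trans (isotropic_sub_orth isoW).
  by rewrite W_full subvf.
Qed.

End FormedSpace.

Section StablePart.
Variables (F : fieldType) (E : vectType F).
Variables (sigma : {rmorphism F -> F}) (eps : F) (Lambda : pred F) (q : E -> E -> F).
Hypothesis params : form_parameters sigma eps Lambda.
Hypothesis sesq : sesquilinear sigma q.

(* [Lambda] need not be stable under [c |-> sigma a * c * a]. Isotropy of a subspace
   only depends on the largest stable subgroup of [Lambda]. *)
Definition stable_part : pred F := fun c => `[< forall a, sigma a * c * a \in Lambda >].

Lemma stable_partP c : reflect (forall a, sigma a * c * a \in Lambda) (c \in stable_part).
Proof. exact: asboolP. Qed.

Lemma stable_part_sub c : c \in stable_part -> c \in Lambda.
Proof. by move/stable_partP/(_ 1); rewrite rmorph1 mul1r mulr1. Qed.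

Lemma stable_part_form_parameters : form_parameters sigma eps stable_part.
Proof.
have [sigmaK eps1 LambdaB Lambda_min Lambda_max] := params; split=> //.
- move=> a b /stable_partP aL /stable_partP bL; apply/stable_partP => c.
  by rewrite mulrBr mulrBl; exact: LambdaB.
- move=> c; apply/stable_partP => a.
  have -> : sigma a * (c - eps * sigma c) * a = sigma a * c * a - eps * sigma (sigma a * c * a).
    by rewrite !rmorphM sigmaK; ring.
  exact: Lambda_min.
- by move=> c /stable_part_sub; exact: Lambda_max.
Qed.

Lemma stable_part_stable a c : c \in stable_part -> sigma a * c * a \in stable_part.
Proof.
move=> /stable_partP cL; apply/stable_partP => b.
have -> : sigma b * (sigma a * c * a) * b = sigma (a * b) * c * (a * b) by rewrite rmorphM; ring.
exact: cL.
Qed.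

Lemma isotropic_stable_part : isotropic sigma eps stable_part q = isotropic sigma eps Lambda q.
Proof.
apply/funext => W; apply/propext; split=> -[om0 Q0]; split=> // v vW.
  exact/stable_part_sub/Q0.
by apply/stable_partP => a; have [_ _ <-] := sesq; apply: Q0; rewrite memvZ.
Qed.

Lemma opposite_stable_part A Z :
  opposite sigma eps stable_part q A Z = opposite sigma eps Lambda q A Z.
Proof. by rewrite /opposite isotropic_stable_part. Qed.

End StablePart.

Theorem theorem4p7 (F : fieldType) (E : vectType F)
    (sigma : {rmorphism F -> F}) (eps : F) (Lambda : pred F)
    (q : E -> E -> F) :
  form_parameters sigma eps Lambda ->
  sesquilinear sigma q ->
  forall U : {vspace E}, Pomega sigma eps Lambda q U ->
    cohen_macaulay (@vsub_le F E) (PomegaU sigma eps Lambda q U).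
Proof.
move=> params sesq U PU; have [isoU RU _ _] := PU.
have isoS W : (W <= U)%VS -> isotropic sigma eps (stable_part sigma Lambda) q W.
  by move=> WU; rewrite isotropic_stable_part //; exact: isotropicS WU isoU.
rewrite (PomegaU_opposite params sesq PU) -opposite_stable_part //.
apply: (opposite_cohen_macaulay (stable_part_form_parameters params) sesq).
- exact: stable_part_stable.
- exact/isoS/capvSl.
- move=> v [vK Qv]; rewrite memv_cap RU /=; first exact/(formkerP params sesq).
  by split=> //; exact: stable_part_sub Qv.
- exact/isoS/diffvSl.
- rewrite (sub_orthC params sesq).
  exact: subv_trans (capvSr _ _) (formker_sub_orth params sesq _).
- by rewrite (addv_idPr (capvSr _ _)) capv_diff.
Qed.
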